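(* For every $n$, there is $N$ such that every prime graph on at least $N$ vertices has a vertex-minor isomorphic to $C_n$ or to the graph obtained from two disjoint copies of $K_n$ by adding a perfect matching between them (joining the $i$-th vertex of the first copy to the $i$-th vertex of the second copy for each $i$).
   Context: All graphs are simple and undirected. A graph is prime (with respect to split decomposition) if its vertex set has no partition $(A,B)$ with $|A|,|B|\ge 2$ such that the edges between $A$ and $B$ form a complete bipartite graph between some $A_0\subseteq A$ and $B_0\subseteq B$. A graph $H$ is a vertex-minor of $G$ if $H$ is an induced subgraph of a graph obtained from $G$ by a sequence of local complementations (local complementation at $v$ replaces the subgraph induced on the neighborhood of $v$ by its complement). $C_n$ is the cycle on $n$ vertices. *)

(* Defs.v *)
(* Simple graphs: a symmetric irreflexive relation e : rel T
   on a finite type T. *)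
From mathcomp Require Import all_boot.
Set Implicit Arguments. Unset Strict Implicit. Unset Printing Implicit Defensive.

Definition local_compl (T : finType) (e : rel T) (v : T) : rel T :=
  fun x y => if [&& x != y, e v x & e v y] then ~~ e x y else e x y.

Definition local_compls (T : finType) (e : rel T) (s : seq T) : rel T :=
  foldl (@local_compl T) e s.

Definition vertex_minor (U : finType) (h : rel U) (T : finType) (e : rel T) : Prop :=
  exists (s : seq T) (f : U -> T),
    injective f /\ forall u w, h u w = local_compls e s (f u) (f w).

Definition is_split (T : finType) (e : rel T) (A : {set T}) : Prop :=
  [/\ 2 <= #|A|, 2 <= #|~: A| &
   exists (A0 B0 : {set T}), [/\ A0 \subset A, B0 \subset ~: A &
     forall x y, x \in A -> y \in ~: A -> e x y = (x \in A0) && (y \in B0)]].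

Definition prime_graph (T : finType) (e : rel T) : Prop :=
  forall A : {set T}, ~ is_split e A.

Definition cycle_graph (n : nat) : rel 'I_n :=
  fun i j => (i != j) && ((i.+1 %% n == j) || (j.+1 %% n == i)).

Definition matched_cliques (n : nat) : rel (bool * 'I_n) :=
  fun x y => ((x.1 == y.1) && (x.2 != y.2)) || ((x.1 != y.1) && (x.2 == y.2)).
Arguments cycle_graph n : clear implicits.
Arguments matched_cliques n : clear implicits.

(* Main.v *)
(* Local equivalence preserves primality, so the graph may be replaced by a
   locally equivalent one at any time.

   A large prime graph has a vertex of large degree or a long induced path. In
   the first case it contains, up to local equivalence, a broom: an induced path
   (the handle) with many pairwise anticomplete connected sets (the fibers)
   attached to its first vertex. By primality every fiber is seen in a nontrivial
   way by an outside vertex, and by Ramsey's theorem the outside vertices see all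
   the fibers in the same way. If one of them sees many fibers differently from
   the first vertex of the handle, each fiber shrinks to a rung between these two
   vertices and matched cliques appear; a half graph between outside vertices and
   fibers is locally equivalent to a long induced path; otherwise the outside
   vertices can be added to the fibers. A fiber that has become huge contains a
   long induced path or a vertex of large degree, which lengthens the handle.

   Given a long induced path, primality yields a chain of outside vertices that
   leads from an initial segment of the path to the rest. Shortened to at most two
   vertices, it prolongs a ladder: a sequence of steps, each replacing one of two
   frontier vertices, that follows the path from its first edge. If the ladder
   stays short, it is a connected set that touches only few vertices of the path,
   unless some vertex forms a large fan with the path; in both situations a long
   cycle arises. If it gets long, local complementations inside the ladder turn
   its beginning into an induced path joining the two frontier vertices. This path
   can be lengthened again and again, and it is finally closed to a long cycle
   through the remainder of the ladder. *)

(* Two invariants keep the local complementations under control. Across a partition, complementing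
   at a vertex adds its row to other rows on its side, so a cut of rank one stays a cut of rank one;
   this is how the tail of the long path remains attached to the rest in a single place. Inside a
   ladder, a dropped vertex has no neighbour among the later steps, so complementing at dropped
   vertices leaves the later part untouched. Every surgery on a ladder thus lives in a graph of
   bounded size and can be checked by computation. Finitely many checks suffice because ladders have
   a normal form: their chord pattern is rewritten, by contracting or reordering chordless steps and
   by replacing four triangles in a row on one side with one, to a word over three letters. Every
   word of seven letters without four equal triangles in a row starts with a tabulated word; the
   rewriting fails only at a run so long that it yields the cycle by itself. In the broom argument,
   enlarging the fibers preserves the length of the handle, and zooming into a fiber strictly
   increases it. *)
Require Import Defs.
From mathcomp Require Import all_boot zify.
Set Implicit Arguments. Unset Strict Implicit. Unset Printing Implicit Defensive.

(* Identifies the two ways the carrier of a finType is displayed after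
   rewriting with lemmas on eqTypes, which [lia] would not unify. *)
Ltac nrm := repeat match goal with
  | |- context [Equality.sort (fintype_Finite__to__eqtype_Equality ?T)] =>
      change (Equality.sort (fintype_Finite__to__eqtype_Equality T)) with (Finite.sort T)
  end.

(* Boolean tautologies: membership and equality tests become atoms (up to
   conversion and up to symmetry of equality). *)
Ltac blia :=
  nrm; repeat match goal with
  | |- context [@eq_op ?A ?x ?y] =>
      let b := fresh "b" in try rewrite [@eq_op _ y x]eq_sym; set b := (@eq_op A x y); clearbody b
  end;
  repeat match goal with
  | |- context [@in_mem ?A ?x ?m] =>
      let b := fresh "b" in set b := (@in_mem A x m); clearbody b
  end;
  repeat match goal with
  | |- context [@uniq ?A ?s] =>
      let b := fresh "b" in set b := (@uniq A s); clearbody b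
  end; clear; lia.

(** * Local equivalence and primality *)

Definition simple_graph (T : finType) (e : rel T) := symmetric e /\ irreflexive e.

Definition lequiv (T : finType) (e e' : rel T) := exists s, e' = local_compls e s.

(** With exclusive or, the effect of several complementations is settled by Boolean case
    analysis. *)
Lemma lcE (T : finType) (e : rel T) v x y :
  local_compl e v x y = e x y (+) [&& x != y, e v x & e v y].
Proof. by rewrite /local_compl; case: ifP; case: (e x y). Qed.

Lemma lc_sg (T : finType) (e : rel T) v : simple_graph e -> simple_graph (local_compl e v).
Proof.
move=> [es ei]; split=> [x y|x]; last by rewrite lcE eqxx ei.
by rewrite !lcE es eq_sym [e v x && _]andbC.
Qed.

Lemma lc_nbr (T : finType) (e : rel T) v x : simple_graph e -> local_compl e v v x = e v x.
Proof. by move=> [_ ei]; rewrite lcE ei andbF addbF. Qed.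

Lemma lequiv_refl (T : finType) (e : rel T) : lequiv e e.
Proof. by exists [::]. Qed.

Lemma lequiv_lc (T : finType) (e e' : rel T) v : lequiv e e' -> lequiv e (local_compl e' v).
Proof. by move=> [s ->]; exists (rcons s v); rewrite /local_compls -cats1 foldl_cat. Qed.

Lemma lequiv_lcs (T : finType) (e e' : rel T) s : lequiv e e' -> lequiv e (local_compls e' s).
Proof. by move=> [s' ->]; exists (s' ++ s); rewrite /local_compls foldl_cat. Qed.

Lemma lequiv_trans (T : finType) (e1 e2 e3 : rel T) :
  lequiv e1 e2 -> lequiv e2 e3 -> lequiv e1 e3.
Proof. by move=> h [s ->]; apply: lequiv_lcs. Qed.

Lemma lcs_sg (T : finType) (e : rel T) s : simple_graph e -> simple_graph (local_compls e s).
Proof. by elim: s e => //= v s IH e /(lc_sg v) /IH. Qed.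

Lemma lequiv_sg (T : finType) (e e' : rel T) : lequiv e e' -> simple_graph e -> simple_graph e'.
Proof. by move=> [s ->]; apply: lcs_sg. Qed.

Lemma vm_lequiv (U : finType) (h : rel U) (T : finType) (e e' : rel T) :
  lequiv e e' -> vertex_minor h e' -> vertex_minor h e.
Proof.
move=> [s ->] [s' [f [fi hf]]]; exists (s ++ s'), f; split=> // u w.
by rewrite hf /local_compls foldl_cat.
Qed.

(** In this form a split is a partition whose adjacency matrix across the two sides has rank at most
    one. *)
Lemma is_splitP (T : finType) (e : rel T) (A : {set T}) :
  is_split e A <-> [/\ 2 <= #|A|, 2 <= #|~: A| &
    exists g h : pred T, forall x y, x \in A -> y \notin A -> e x y = g x && h y].
Proof.
split=> -[c1 c2].
  move=> [A0 [B0 [_ _ he]]]; split=> //; exists (mem A0), (mem B0) => x y xA yA.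
  by apply: he; rewrite // inE.
move=> [g [h he]]; split=> //.
exists (A :&: [set x | g x]), (~: A :&: [set x | h x]); split; try exact: subsetIl.
by move=> x y xA yA; rewrite !inE xA he //; move: yA; rewrite inE // => ->.
Qed.

(** Over the field with two elements, complementing at [v] adds a multiple of the row of [v] to the
    rows on its side, which keeps the rank across the partition at most one. The row of [v] itself
    is the same before and after, so the operation can be undone in the formulas. *)
Lemma prime_lc (T : finType) (e : rel T) v :
  simple_graph e -> prime_graph e -> prime_graph (local_compl e v).
Proof.
move=> sg pr A /is_splitP [c1 c2 [g [h he]]]; apply: (pr A); apply/is_splitP; split=> //.
have [es _] := sg.
have ex x y : x != y -> e x y = local_compl e v x y (+) (e v x && e v y).
  by move=> xy; rewrite lcE xy addbK.
case vA : (v \in A).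
  exists (fun x => g x (+) (e v x && g v)), h => x y xA yA.
  have xy : x != y by apply: contraNneq yA => <-.
  rewrite (ex _ _ xy) he // -[e v y](lc_nbr v y sg) he ?vA //.
  by case: (g x) (h y) (e v x) (g v) => -[] [] [].
exists g, (fun y => h y (+) (h v && e v y)) => x y xA yA.
have xy : x != y by apply: contraNneq yA => <-.
rewrite (ex _ _ xy) he // -[e v x](lc_nbr v x sg).
have -> : local_compl e v v x = g x && h v.
  by rewrite (proj1 (lc_sg v sg)) he ?vA.
by case: (g x) (h y) (e v y) (h v) => -[] [] [].
Qed.

Lemma prime_lequiv (T : finType) (e e' : rel T) :
  lequiv e e' -> simple_graph e -> prime_graph e -> prime_graph e'.
Proof.
move=> [s ->]; elim: s e => //= v s IH e sg pr.
by apply: IH; [apply: lc_sg | apply: prime_lc].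
Qed.

(** * Induced paths *)

Definition nadj (T : eqType) (e : rel T) (x y : T) := (x != y) && ~~ e x y.

Lemma nadjC (T : eqType) (e : rel T) : symmetric e -> symmetric (nadj e).
Proof. by move=> es x y; rewrite /nadj eq_sym es. Qed.

Fixpoint ipath (T : eqType) (e : rel T) (p : seq T) : bool :=
  if p is x :: q then
    (if q is y :: r then e x y && all (nadj e x) r else true) && ipath e q
  else true.

Definition anti (T : eqType) (e : rel T) (p q : seq T) := all (fun x => all (nadj e x) q) p.

Lemma antiP (T : eqType) (e : rel T) (p q : seq T) :
  reflect (forall x y, x \in p -> y \in q -> nadj e x y) (anti e p q).
Proof.
apply: (iffP allP) => [h x y xp yq|h x xp]; first by apply: (allP (h x xp)).
by apply/allP => y yq; apply: h.
Qed.

Lemma ipath_cat (T : eqType) (e : rel T) p a b q :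
  ipath e (rcons p a ++ b :: q) =
  [&& ipath e (rcons p a), ipath e (b :: q), e a b, anti e p (b :: q) & all (nadj e a) q].
Proof.
elim: p => [|x p IH]; first by rewrite /=; lia.
have -> : ipath e (rcons (x :: p) a ++ b :: q) =
  [&& ipath e (rcons p a ++ b :: q),
   (if rcons p a is y :: r then e x y && all (nadj e x) r else true) & all (nadj e x) (b :: q)].
  rewrite rcons_cons cat_cons; case: p {IH} => [|y p] /=; first by lia.
  by rewrite all_cat all_rcons /=; lia.
rewrite IH rcons_cons [ipath e (x :: _)]/= -[anti e (x :: p) _]/(all (nadj e x) (b :: q) && anti e p (b :: q)).
by set A := all _ (b :: q); set B := (if _ is _ :: _ then _ else _); lia.
Qed.

Lemma ipath_cons2 (T : eqType) (e : rel T) a b q :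
  ipath e (a :: b :: q) = [&& e a b, all (nadj e a) q & ipath e (b :: q)].
Proof. by rewrite /= -andbA. Qed.

Lemma ipath_catl (T : eqType) (e : rel T) p q : ipath e (p ++ q) -> ipath e p.
Proof.
elim: p => //= x p IH /andP [h /IH ->]; rewrite andbT.
by case: p h {IH} => //= y p /andP[->]; rewrite all_cat => /andP[-> _].
Qed.

Lemma ipath_catr (T : eqType) (e : rel T) p q : ipath e (p ++ q) -> ipath e q.
Proof. by elim: p => //= x p IH /andP [_ /IH]. Qed.

Lemma ipath_uniq (T : eqType) (e : rel T) p : irreflexive e -> ipath e p -> uniq p.
Proof.
move=> ei; elim: p => //= x p IH /andP[h /IH ->]; rewrite andbT.
case: p h {IH} => //= y p /andP[exy /allP hp]; rewrite inE negb_or.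
apply/andP; split; first by apply: contraTneq exy => ->; rewrite ei.
by apply/negP => /hp; rewrite /nadj eqxx.
Qed.

Lemma ipath_rev (T : eqType) (e : rel T) p : symmetric e -> ipath e (rev p) = ipath e p.
Proof.
move=> es; elim: p => // x [|y p] IH //.
rewrite rev_cons.
have -> : ipath e (rcons (rev (y :: p)) x) = ipath e (rcons (rev p) y ++ [:: x]).
  by rewrite rev_cons -cats1.
rewrite ipath_cat -rev_cons IH ipath_cons2 es [ipath e [:: x]]/= [all _ [::]]/=.
have -> : anti e (rev p) [:: x] = all (nadj e x) p.
  by rewrite /anti all_rev; apply: eq_all => z /=; rewrite andbT nadjC.
by set A := ipath e (y :: p); lia.
Qed.

Lemma eq_ipath (T : eqType) (e e' : rel T) p :
  {in p &, e =2 e'} -> ipath e p = ipath e' p.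
Proof.
elim: p => //= x p IH h; congr andb; last first.
  by apply: IH => u w up wp; apply: h; rewrite inE ?up ?wp orbT.
case: p h {IH} => //= y p h; congr andb; first by apply: h; rewrite !inE eqxx ?orbT.
apply: eq_in_all => z zp; rewrite /nadj h // !inE ?eqxx ?zp ?orbT //.
Qed.

Lemma ipath_nth (T : eqType) (e : rel T) x0 p i j : ipath e p -> i < j < size p ->
  e (nth x0 p i) (nth x0 p j) = (i.+1 == j).
Proof.
elim: p i j => [|x p IH] i j; first by rewrite andbF.
case: i j => [|i] [|j] //=; last by move=> /andP[_ ip] lj; rewrite IH.
rewrite ltnS; case: p {IH} => //= y p /andP[/andP[exy /allP h] ip].
case: j => [|j] //= lj; apply/negbTE.
by have /h /andP[] : nth x0 p j \in p by rewrite mem_nth.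
Qed.

Lemma split_last (T : Type) (P : pred T) s : has P s ->
  exists s1 z s2, [/\ s = s1 ++ z :: s2, P z & ~~ has P s2].
Proof.
elim: s => //= x s IH; case hs : (has P s); last first.
  by rewrite orbF => px; exists [::], x, s; rewrite hs.
by move=> _; have [s1 [z [s2 [-> pz h]]]] := IH hs; exists (x :: s1), z, s2.
Qed.

Lemma split_first (T : Type) (P : pred T) s : has P s ->
  exists s1 z s2, [/\ s = s1 ++ z :: s2, P z & ~~ has P s1].
Proof.
elim: s => //= x s IH; case px : (P x); first by exists [::], x, s.
by move=> /= /IH [s1 [z [s2 [-> pz h]]]]; exists (x :: s1), z, s2; rewrite /= px.
Qed.

Lemma belast_cat (T : Type) (x : T) s1 z s2 :
  belast x (s1 ++ z :: s2) = x :: s1 ++ belast z s2.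
Proof. by elim: s1 x => //= y s1 IH x; rewrite IH. Qed.

(** The new first vertex [x] jumps to its last neighbour on the induced path already found for the
    rest of the walk. Stopping at the first vertex in [Q] keeps all earlier ones out of [Q]. *)
Lemma walk_ipath (T : finType) (e : rel T) (Q : pred T) (x : T) (w : seq T) :
  path e x w -> Q (last x w) ->
  exists p : seq T, [/\ ipath e (x :: p), {subset p <= w}, Q (last x p) & all (predC Q) (belast x p)].
Proof.
elim: w x => [|y w IH] x; first by move=> _ qx; exists [::].
rewrite [path _ _ _]/= [last _ _]/= => /andP[exy pw] ql.
have [qx|nqx] := boolP (Q x); first by exists [::].
have [p [ip sp lp ap]] := IH y pw ql.
have : has (fun z => (x == z) || e x z) (y :: p) by rewrite /= exy orbT.
move=> /split_last [s1 [z [s2 [ez xz hs]]]].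
have ls : last y p = last z s2 by move: (congr1 (last y) ez) => /=; rewrite last_cat.
have sub : {subset z :: s2 <= y :: w}.
  move=> u us; have : u \in y :: p by rewrite ez mem_cat us orbT.
  by rewrite !inE => /orP[->//|/sp ->]; rewrite orbT.
have iz : ipath e (z :: s2) by apply: (@ipath_catr _ _ s1); rewrite -ez.
have az : all (predC Q) (belast z s2).
  apply/allP => u uz; apply: (allP ap).
  have : belast y p = belast y (behead (s1 ++ z :: s2)) by rewrite -ez.
  case: s1 ez {sub} => [[-> ->]|y' s1 [-> ->]] /=; first by [].
  by rewrite belast_cat inE mem_cat uz !orbT.
move: ls lp => -> lz.
have [exz|nxz] := eqVneq x z.
  subst z; exists s2; split=> // u us; apply: sub; by rewrite inE us orbT.
move: xz; rewrite (negbTE nxz) /= => xz.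
exists (z :: s2); split=> //; last by rewrite /= nqx.
rewrite xz iz andbT /=.
apply/allP => u us; rewrite /nadj -negb_or; apply: contra hs => h; apply/hasP; by exists u.
Qed.

(** * Connectivity inside a set of vertices *)

Definition rel_on (T : finType) (e : rel T) (D : pred T) : rel T :=
  fun u v => [&& D u, D v & e u v].
Definition connd (T : finType) (e : rel T) (D : pred T) :=
  forall x y, D x -> D y -> connect (rel_on e D) x y.

Lemma rel_on_sym (T : finType) (e : rel T) D : symmetric e -> symmetric (rel_on e D).
Proof. by move=> es x y; rewrite /rel_on es; lia. Qed.

Lemma connect_on_sym (T : finType) (e : rel T) D :
  symmetric e -> symmetric (connect (rel_on e D)).
Proof. by move=> es; apply: sym_connect_sym; apply: rel_on_sym. Qed.

Lemma connect_on_sub (T : finType) (e e' : rel T) (D D' : pred T) x y :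
  (forall u v, D u -> D v -> e u v -> [&& D' u, D' v & e' u v]) ->
  connect (rel_on e D) x y -> connect (rel_on e' D') x y.
Proof.
move=> h; apply: connect_sub => u v /and3P[du dv euv]; apply: connect1.
by rewrite /rel_on; apply: h.
Qed.

Lemma connect_ipath (T : finType) (e : rel T) (D Q : pred T) (x y : T) :
  connect (rel_on e D) x y -> Q y ->
  exists p : seq T, [/\ ipath e (x :: p), all D p, Q (last x p) & all (predC Q) (belast x p)].
Proof.
move=> /connectP [w pw ->] ql.
have pe : path e x w by apply: sub_path pw => u v /and3P[].
have [p [ip sp lp ap]] := walk_ipath pe ql; exists p; split=> //.
have Dw : all D w by elim: w x pw {pe ql ip sp lp ap} => //= z w IH x /andP[/and3P[_ -> _] /IH].
by apply/allP => u /sp; apply: (allP Dw).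
Qed.

Lemma conndU (T : finType) (e : rel T) (D D' : pred T) : symmetric e ->
  connd e D -> (forall u, D u -> D' u) ->
  (forall u, D' u -> ~~ D u -> exists2 v, D v & connect (rel_on e D') u v) -> connd e D'.
Proof.
move=> es cD sD h.
have mono u v : D u -> D v -> connect (rel_on e D') u v.
  move=> du dv; apply: connect_on_sub (cD u v du dv) => a b da db ->.
  by rewrite !sD.
have h' u : D' u -> exists2 v, D v & connect (rel_on e D') u v.
  by move=> d'u; case du : (D u); [exists u => //; apply: connect0 | apply: h; rewrite ?du].
move=> x y /h' [x' dx' cx] /h' [y' dy' cy].
apply: connect_trans cx _; apply: connect_trans (mono _ _ dx' dy') _.
by rewrite connect_on_sym.
Qed.

(** * Fans *)

(** A word records which vertices of a path see a hub. [wred_rm] is complementation at an inner path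
    vertex with letter [v], followed by its deletion: its two path neighbours become adjacent, and
    their edges to the hub are toggled if [v] holds. [wred_infix] passes to a subpath. *)
Inductive wred : seq bool -> seq bool -> Prop :=
| wred_refl w : wred w w
| wred_rm w1 a v b w2 w : wred (w1 ++ (a (+) v) :: (b (+) v) :: w2) w ->
    wred (w1 ++ a :: v :: b :: w2) w
| wred_infix w1 w2 w3 w : wred w2 w -> wred (w1 ++ w2 ++ w3) w.

Lemma wred_trans w1 w2 w3 : wred w1 w2 -> wred w2 w3 -> wred w1 w3.
Proof.
by elim=> // [u a v b u' u'' _ IH h | u u' u'' u3 _ IH h];
  [apply: wred_rm; apply: IH | apply: wred_infix; apply: IH].
Qed.

Lemma wred_rm0 w1 a b w2 w : wred (w1 ++ a :: b :: w2) w -> wred (w1 ++ a :: false :: b :: w2) w.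
Proof. by move=> h; apply: wred_rm; rewrite !addbF. Qed.

(** With this word, hub and path form an induced cycle of length [m + 3]. *)
Definition gword m := true :: nseq m false ++ [:: true].

Lemma gword_le m k : m <= k -> wred (gword k) (gword m).
Proof.
move=> /subnK <-; elim: (k - m) => [|d IH]; first exact: wred_refl.
rewrite addSn; case: (d + m) IH => [|j] IH; apply: (@wred_rm0 [::]); exact: IH.
Qed.

Lemma nseq_catS (T : Type) k (a : T) s : nseq k a ++ a :: s = nseq k.+1 a ++ s.
Proof. by elim: k => //= k ->. Qed.

(** Removing the middle one of three letters [true] turns the other two into [false]: three ones are
    traded for two zeros. *)
Lemma ones_gword t c : wred (true :: nseq c false ++ nseq (3 * t).+1 true) (gword (c + 2 * t)).
Proof.
elim: t c => [|t IH] c; first by rewrite muln0 addn0; apply: wred_refl.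
have -> : (3 * t.+1).+1 = (3 * t).+4 by lia.
have -> : c + 2 * t.+1 = c.+2 + 2 * t by lia.
apply: (@wred_rm (true :: nseq c false) true true true).
by have := IH c.+2; rewrite cat_cons !nseq_catS.
Qed.

(** Removing a [false] changes no other letter, so just the ones survive. *)
Lemma zeros_ones k w :
  wred (nseq k.+1 true ++ w ++ [:: true]) (nseq (k + count id w).+2 true).
Proof.
elim: w k => [|b w IH] k.
  by rewrite [[::] ++ _]/= nseq_catS cats0 addn0; apply: wred_refl.
case: b; first by rewrite [(_ :: _) ++ _]/= nseq_catS; have := IH k.+1; rewrite /= !addSn !addnS.
have ew : w ++ [:: true] = head true w :: behead (w ++ [:: true]) by case: (w).
have -> : nseq k.+1 true ++ (false :: w) ++ [:: true] =
    nseq k true ++ true :: false :: head true w :: behead (w ++ [:: true]).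
  by rewrite -ew nseq_catS.
by apply: wred_rm0; rewrite -ew nseq_catS; exact: IH.
Qed.

(** Pigeonhole: at most [k] ones cut [w] into at most [k + 1] intervals, one of which has at least
    [m] zeros. *)
Lemma gap_gword m k w : count id w <= k ->
  k.+1 * m.+1 <= (size w).+1 -> wred (true :: w ++ [:: true]) (gword m).
Proof.
elim: k w => [|k IH] w cw sw.
  have -> : w = nseq (size w) false.
    by elim: (w) cw => //= -[] //= v IHv /IHv {1}->.
  by apply: gword_le; lia.
have [hw|] := boolP (has id w); last first.
  move=> hw; have -> : w = nseq (size w) false.
    by elim: (w) hw => //= -[] //= v IHv /IHv {1}->.
  by apply: gword_le; nia.
have [s1 [[] [s2 [ew // _ h1]]]] := split_first hw.
have es1 : s1 = nseq (size s1) false.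
  by elim: (s1) h1 => //= -[] //= v IHv /IHv {1}->.
have [lm|lm] := leqP m (size s1).
  have -> : true :: w ++ [:: true] = [::] ++ gword (size s1) ++ (s2 ++ [:: true]).
    by rewrite ew /gword -es1 /= -!catA.
  by apply: wred_infix; apply: gword_le.
have -> : true :: w ++ [:: true] = (true :: s1) ++ (true :: s2 ++ [:: true]) ++ [::].
  by rewrite ew cats0 /= -catA.
apply: wred_infix; apply: IH.
  by move: cw; rewrite ew count_cat /=; lia.
by move: sw; rewrite ew size_cat /=; nia.
Qed.

(** With more than [3 * m + 3] ones [ones_gword] applies; with fewer, this is the length that
    [gap_gword] asks for. *)
Definition fan_bound m := (3 * m).+4 * m.+1.

Lemma fan_word m w : fan_bound m <= size w -> wred (true :: w ++ [:: true]) (gword m).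
Proof.
move=> sw; have [c|c] := leqP (count id w) (3 * m).+3; last first.
  apply: wred_trans (zeros_ones 0 w) _.
  have lc : 3 * m <= count id w by lia.
  have -> : (0 + count id w).+2 = (3 * m).+2 + (count id w - 3 * m) by lia.
  rewrite nseqD -[nseq _ true ++ _]/([::] ++ _ ++ _); apply: wred_infix.
  apply: wred_trans (ones_gword m 0) _; apply: gword_le; lia.
by apply: (gap_gword c); rewrite /fan_bound in sw; nia.
Qed.

Definition fan (T : finType) (e : rel T) (y : T) (p : seq T) := ipath e p && (y \notin p).

(** In a fan, the only neighbours of an inner path vertex are its two path neighbours and possibly
    the hub, so a complementation there changes nothing else. *)
Lemma fan_wred (T : finType) (e : rel T) (y : T) (p : seq T) w : simple_graph e ->
  fan e y p -> wred (map (e y) p) w ->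
  exists e' p', [/\ lequiv e e', fan e' y p' & map (e' y) p' = w].
Proof.
move=> sg fp hw; move eu : (map (e y) p) hw => u hw.
elim: hw e p sg fp eu => {u w} [w|w1 a v b w2 w _ IH|w1 w2 w3 w _ IH] e p sg /andP[ip yp] eu.
- by exists e, p; split; rewrite /fan ?ip //; apply: lequiv_refl.
- have [es ei] := sg.
  have [p1 [pa [pv [pb [p2 [ep e1 e2]]]]]] : exists p1 pa pv pb p2,
    [/\ p = p1 ++ pa :: pv :: pb :: p2, map (e y) p1 = w1 &
     [/\ e y pa = a, e y pv = v, e y pb = b & map (e y) p2 = w2]].
    elim: w1 p {ip yp IH} eu => [|c w1 IHw] [|x p] //=.
      case: p => [|x' [|x'' p]] //= [h1 h2 h3 h4].
      by exists [::], x, x', x'', p.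
    by move=> [h1 /IHw [p1 [pa [pv [pb [p2 [-> <- h]]]]]]]; exists (x :: p1), pa, pv, pb, p2; rewrite /= h1.
  case: e2 => ea ev eb e2; subst p a v b w1 w2.
  have up := ipath_uniq ei ip.
  have np z : z \in p1 ++ p2 -> ~~ e pv z.
    move: ip; rewrite -cat_rcons mem_cat => ip /orP[z1|z2].
      move: ip; rewrite ipath_cat => /and5P[_ _ _ /antiP h _].
      by have /andP[_] := h z pv z1 (mem_head _ _); rewrite es.
    move: ip => /ipath_catr; rewrite ipath_cons2 => /and3P[_ /allP h _].
    by have /andP[] := h _ z2.
  have [eav ebv] : e pv pa /\ e pv pb.
    move: ip => /ipath_catr; rewrite !ipath_cons2 => /and3P[h1 _ /and3P[h2 _ _]].
    by rewrite es.
  have nab : ~~ e pa pb /\ pa != pb.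
    by move: ip => /ipath_catr; rewrite ipath_cons2 /= => /and3P[_ /andP[/andP[-> ->]] _].
  set e' := local_compl e pv.
  have e'E z t : z \in p1 ++ p2 -> e' z t = e z t.
    by move=> zz; rewrite /e' lcE (negbTE (np _ zz)) andbF addbF.
  have e'y z : z != y -> e' y z = e y z (+) (e y pv && e pv z).
    by move=> zy; rewrite /e' lcE es [y == z]eq_sym zy [e pv y]es.
  have [|||e'' [p' [le fp' ew]]] := IH e' (p1 ++ pa :: pb :: p2).
  + exact: lc_sg.
  + apply/andP; split; last by move: yp; rewrite !mem_cat !inE; lia.
    move: ip; rewrite -cat_rcons -[pa :: pb :: _]/([:: pa] ++ _) -[p1 ++ [:: pa] ++ _]cat_rcons.
    rewrite !ipath_cat => /and5P[i1 i2 _ an1 al1].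
    have sg' : simple_graph e' := lc_sg pv sg; have [es' ei'] := sg'.
    have e'ab : e' pa pb by rewrite /e' lcE (negbTE (proj1 nab)) (proj2 nab) eav ebv.
    apply/and5P; split=> //.
    * rewrite -(@eq_ipath _ e) // => z t; rewrite !mem_rcons !inE.
      move=> /orP[/eqP-> /orP[/eqP->|tp]|zp _]; first by rewrite ei ei'.
        by rewrite es' es e'E // mem_cat tp.
      by rewrite e'E // mem_cat zp.
    * move: i2; rewrite ipath_cons2 => /and3P[_ _ i2].
      rewrite -(@eq_ipath _ e) // => z t; rewrite !inE.
      move=> /orP[/eqP-> /orP[/eqP->|tp]|zp _]; first by rewrite ei ei'.
        by rewrite es' es e'E // mem_cat tp orbT.
      by rewrite e'E // mem_cat zp orbT.
    * apply/antiP => z t zp; rewrite inE => tt.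
      have /antiP /(_ z t zp) := an1; rewrite /nadj e'E ?mem_cat ?zp //; apply.
      by rewrite !inE tt !orbT.
    * apply/allP => t tp; have /allP /(_ t) := al1.
      rewrite /nadj es' es [pa == _]eq_sym e'E ?mem_cat ?tp ?orbT //; apply.
      by rewrite inE tp orbT.
  + have ny z : z \in p1 ++ pa :: pv :: pb :: p2 -> z != y by move=> zp; apply: contraNneq yp => <-.
    have mE q : {subset q <= p1 ++ p2} -> map (e' y) q = map (e y) q.
      by move=> sq; apply/eq_in_map => z /sq zq; rewrite (proj1 (lc_sg pv sg : simple_graph e')) es e'E.
    rewrite map_cat /= !mE; try by move=> z zz; rewrite mem_cat zz ?orbT.
    rewrite !e'y ?eav ?ebv ?andbT //; apply: ny; rewrite mem_cat !inE eqxx ?orbT //.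
  by exists e'', p'; split=> //; apply: lequiv_trans le; apply: lequiv_lc; apply: lequiv_refl.
have [p1 [p2 [p3 [ep e2]]]] : exists p1 p2 p3, p = p1 ++ p2 ++ p3 /\ map (e y) p2 = w2.
  exists (take (size w1) p), (take (size w2) (drop (size w1) p)), (drop (size w2) (drop (size w1) p)).
  by rewrite !cat_take_drop map_take map_drop eu drop_size_cat // take_size_cat.
subst p; have [|//|e'' [p' h]] := IH e p2 sg; last by exists e'', p'.
rewrite /fan (ipath_catl (ipath_catr ip)) /=.
by apply: contra yp; rewrite !mem_cat => ->; rewrite orbT.
Qed.

(** By its definition [cycle_graph n] is edgeless for [n <= 1] and a single edge for [n = 2], hence
    an induced subgraph of the triangle. *)
Lemma cycle_graph3 (T : finType) (e : rel T) n : n <= 3 ->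
  vertex_minor (cycle_graph 3) e -> vertex_minor (cycle_graph n) e.
Proof.
move=> n3 [s [f [fi hf]]]; exists s, (fun i => f (widen_ord n3 i)).
split=> [i j /fi /(congr1 val) /= h|i j]; first exact: val_inj.
rewrite -hf; case: n n3 i j => [|[|[|[|]]]] //= n3 [[|[|[|]]]] // hi [[|[|[|]]]] // hj.
Qed.

Lemma fan_cycle (T : finType) (e : rel T) (y : T) (p : seq T) n : simple_graph e -> 2 < n -> fan e y p ->
  map (e y) p = gword (n - 3) -> vertex_minor (cycle_graph n) e.
Proof.
move=> sg n3 /andP[ip yp] ep; have [es ei] := sg.
have sp : size p = n.-1 by have := congr1 size ep; rewrite size_map /= size_cat size_nseq /=; lia.
(* Index 0 is the hub. *)
exists [::], (fun i : 'I_n => nth y (y :: p) i).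
have u : uniq (y :: p) by rewrite /= yp (ipath_uniq ei ip).
split=> [i j /eqP|i j].
  by rewrite nth_uniq //= ?sp ?(leq_trans (ltn_ord _)) //; try lia; move=> /eqP/val_inj.
rewrite /= /cycle_graph.
wlog ij : i j / i <= j.
  move=> h; have [|/ltnW]:= leqP i j; first exact: h.
  by move=> /h; rewrite es eq_sym orbC.
case: (ltngtP i j) ij => // [ij|/val_inj ->] _; last by rewrite eqxx ei.
have -> : (i != j) by apply: contraTneq ij => ->; rewrite ltnn.
rewrite modn_small; last by have := ltn_ord j; lia.
case: i j ij => [[|i] hi] [[|j] hj] //= ij.
  have jp : j < size p by lia.
  rewrite -(nth_map _ false) // ep /=.
  case: j hj ij jp => [|j] hj ij jp //=; rewrite ?eqxx //.
  rewrite nth_cat size_nseq; case: ltnP => h; first by rewrite nth_nseq h modn_small //; lia.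
  have -> : j = n - 3 by lia.
  rewrite subnn /=; have -> : (n - 3).+3 = n by lia. by rewrite modnn.
rewrite ipath_nth //; last by nrm; lia.
have h : (j.+2 %% n == i.+1) = false; last by rewrite -/(j.+2) h orbF.
have [->|h] := eqVneq j.+2 n; first by rewrite modnn.
by rewrite modn_small; lia.
Qed.

Lemma FAN (T : finType) (e : rel T) (y : T) (p : seq T) n : simple_graph e -> 2 < n -> fan e y p ->
  (fan_bound n).+2 <= size p -> e y (head y p) -> e y (last y p) ->
  vertex_minor (cycle_graph n) e.
Proof.
move=> sg n3 fp sp e1 e2.
have : exists w, map (e y) p = true :: w ++ [:: true].
  case: p e1 e2 sp {fp} => // a p; case/lastP: p => // p b /= e1; rewrite last_rcons => e2 _.
  by exists (map (e y) p); rewrite map_rcons e1 e2 cats1.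
move=> [w ew]; have sw : fan_bound n <= size w.
  by have := congr1 size ew; rewrite size_map /= size_cat /= => es1; move: sp; rewrite es1; lia.
have := fan_word sw; rewrite -ew => /wred_trans /(_ (gword_le (leq_subr 3 n))) hw.
have [e' [p' [le fp' ep']]] := fan_wred sg fp hw.
by apply: (vm_lequiv le); have := fan_cycle (lequiv_sg le sg) n3 fp' ep'.
Qed.

(** An induced path through [D] from [b] to the first neighbour of [a] closes the given path to a
    cycle. Taking [a] as the hub of a fan over the remaining vertices lets [FAN] bring the length
    down to [n]. *)
Lemma CYC (T : finType) (e : rel T) (D : pred T) (a : T) (p : seq T) (b : T) n : simple_graph e -> 2 < n ->
  ipath e (a :: rcons p b) -> connd e D ->
  (forall z, z \in a :: rcons p b -> ~~ D z) ->
  (forall z d, z \in p -> D d -> ~~ e z d) ->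
  (exists2 d, D d & e a d) -> (exists2 d, D d & e b d) ->
  (fan_bound n).+2 <= size p -> vertex_minor (cycle_graph n) e.
Proof.
move=> sg n3 ip cD pD nD [d1 d1D ad1] [d2 d2D bd2] sp; have [es ei] := sg.
have ab : ~~ e a b.
  case: p ip sp {pD nD} => // x p; rewrite rcons_cons ipath_cons2 all_rcons /=.
  by move=> /and3P[_ /andP[/andP[_ ->]]].
have cb : connect (rel_on e (fun z => D z || (z == b))) b d1.
  apply: (@connect_trans _ _ d2); first by apply: connect1; rewrite /rel_on eqxx d2D bd2 orbT.
  by apply: connect_on_sub (cD _ _ d2D d1D) => u v -> ->.
have [q [iq Dq lq bq]] := connect_ipath (Q := e a) cb ad1.
case: q iq Dq lq bq => [|q0 q] iq Dq lq bq; first by rewrite /= (negbTE ab) in lq.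
have Dq' z : z \in q0 :: q -> D z.
  move=> zq; have /orP[//|/eqP zb] := allP Dq _ zq.
  by have := ipath_uniq ei iq; rewrite cons_uniq -zb zq.
have up := ipath_uniq ei ip.
apply: (FAN (y := a) (p := p ++ b :: q0 :: q)) => //.
- rewrite /fan; apply/andP; split; last first.
    have aq : a \notin q0 :: q by apply/negP => /Dq'; apply/negP; apply: pD; exact: mem_head.
    rewrite mem_cat in_cons; move: up; rewrite cons_uniq mem_rcons in_cons.
    by move=> /andP[+ _]; rewrite (negbTE aq) orbF orbC.
  rewrite -cat_rcons ipath_cat; move: iq; rewrite ipath_cons2 => /and3P[-> h ->].
  have := ipath_catr (p := [:: a]) ip => -> /=.
  rewrite h andbT; apply/antiP => z t zp tq; rewrite /nadj nD ?Dq' // andbT.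
  apply: contraTneq (Dq' _ tq) => <-; apply: pD.
  by rewrite inE mem_rcons inE zp !orbT.
- by rewrite size_cat /=; lia.
- by case: p ip sp {pD nD up} => //= x p /andP[/andP[]].
- by rewrite last_cat.
Qed.

(** The row of [w] does not change at the first complementation, so [w] stays nonadjacent to the
    other vertices of [s]. *)
Lemma lcs_out (T : finType) (e : rel T) s w u : simple_graph e ->
  all (fun v => ~~ e v w) s -> local_compls e s w u = e w u.
Proof.
elim: s e => //= v s IH e sg /andP[nvw hs].
have nv z : local_compl e v z w = e z w by rewrite lcE (negbTE nvw) !andbF addbF.
rewrite IH; first by rewrite lcE (negbTE nvw) /= andbF addbF.
  exact: lc_sg.
by rewrite -(eq_all (a1 := fun v => ~~ e v w)) // => z; rewrite nv.
Qed.

(** * Ladders *)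

Definition drp (T : Type) (xy : T * T) (b : bool) := if b then xy.1 else xy.2.
Definition step (T : Type) (xy : T * T) (bv : bool * T) :=
  if bv.1 then (bv.2, xy.2) else (xy.1, bv.2).
Definition fin (T : Type) := foldl (@step T).
Fixpoint drops (T : Type) (xy : T * T) (s : seq (bool * T)) :=
  if s is bv :: s' then drp xy bv.1 :: drops (step xy bv) s' else [::].

(* The pair [xy] is the frontier of the ladder: the step [(b, v)] replaces one
   of its two vertices by [v], and the replaced vertex has no later neighbour. *)
Fixpoint fr (T : eqType) (e : rel T) (xy : T * T) (s : seq (bool * T)) : bool :=
  (xy.1 != xy.2) &&
  (if s is bv :: s' then
     [&& e (drp xy bv.1) bv.2, all (nadj e (drp xy bv.1)) (map snd s') & fr e (step xy bv) s']
   else true).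

Lemma fin_cat (T : Type) (xy : T * T) s1 s2 : fin xy (s1 ++ s2) = fin (fin xy s1) s2.
Proof. exact: foldl_cat. Qed.

Lemma fr_neq (T : eqType) (e : rel T) xy s : fr e xy s -> xy.1 != xy.2.
Proof. by case: s => [|bv s] /andP[]. Qed.

Lemma fr_cat (T : eqType) (e : rel T) xy s1 s2 :
  fr e xy (s1 ++ s2) =
  [&& fr e xy s1, fr e (fin xy s1) s2 & anti e (drops xy s1) (map snd s2)].
Proof.
elim: s1 xy => [|bv s1 IH] xy /=.
  by rewrite !andbT; case h : (fr e xy s2); rewrite ?andbF // andbT; apply/esym/(fr_neq h).
by rewrite IH map_cat all_cat; lia.
Qed.

Lemma drops_cat1 (T : Type) (xy : T * T) s bv :
  drops xy (s ++ [:: bv]) = rcons (drops xy s) (drp (fin xy s) bv.1).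
Proof. by elim: s xy => //= a s IH xy; rewrite IH. Qed.

Lemma perm_drops (T : eqType) (xy : T * T) s :
  perm_eq (xy.1 :: xy.2 :: map snd s) ((fin xy s).1 :: (fin xy s).2 :: drops xy s).
Proof.
elim: s xy => [|[b v] s IH] [x y] //=; apply/permP => a.
by have /permP/(_ a) := IH (step (x, y) (b, v)); case: b => /=; lia.
Qed.

Lemma fr_uniq (T : eqType) (e : rel T) xy s : irreflexive e -> fr e xy s ->
  uniq (xy.1 :: xy.2 :: map snd s).
Proof.
move=> ei; elim: s xy => [|[b v] s IH] [x y]; first by rewrite /= !inE !andbT.
move=> /= /andP[xy /and3P[edv /allP nd /IH]] /=.
have dv : drp (x, y) b != v by apply: contraTneq edv => ->; rewrite ei.
have ds : drp (x, y) b \notin map snd s by apply/negP => /nd; rewrite /nadj eqxx.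
by case: b dv ds xy {edv nd} => /=; rewrite !inE; blia.
Qed.

Lemma eq_fr (T : eqType) (e e' : rel T) xy s : symmetric e -> symmetric e' ->
  (forall z t, z \in map snd s -> t \in xy.1 :: xy.2 :: map snd s -> e z t = e' z t) ->
  fr e xy s = fr e' xy s.
Proof.
move=> es es'; elim: s xy => [|[b v] s IH] [x y] //= h.
have dm : drp (x, y) b \in [:: x, y, v & map snd s] by case: b {h}; rewrite !inE eqxx ?orbT.
congr (_ && _); congr [&& _, _ & _].
- by rewrite es es' h // inE eqxx.
- by apply: eq_in_all => z zs; rewrite /nadj es es' h // inE zs orbT.
apply: IH => z t zs ts; apply: h; first by rewrite inE zs orbT.
by case: b ts {dm}; rewrite !inE; blia.
Qed.

(** Each dropped vertex is adjacent to its replacement, so all vertices are connected to the last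
    frontier, and the closing edge joins the two frontier vertices. *)
Lemma fr_conn (T : finType) (e : rel T) xy s : simple_graph e -> fr e xy s ->
  e (fin xy s).1 (fin xy s).2 -> connd e (mem (xy.1 :: xy.2 :: map snd s)).
Proof.
move=> [es ei]; elim: s xy => [|[b v] s IH] [x y] /=.
  move=> _ exy u w; rewrite /= !inE => hu hw.
  have [->|uw] := eqVneq u w; first exact: connect0.
  apply: connect1; rewrite /rel_on /= !inE.
  by case/orP: hu uw => /eqP-> ; case/orP: hw => /eqP-> ; rewrite ?eqxx ?orbT // es exy.
move=> /andP[xy /and3P[edv _ hfr]] hf.
apply: conndU (IH _ hfr hf) _ _ => //.
  by move=> u; case: b {hf hfr edv} => /=; rewrite !inE; blia.
move=> u; rewrite /= => uD uD'; exists v; first by case: b {hf hfr edv uD'}; rewrite !inE eqxx ?orbT.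
have -> : u = drp (x, y) b.
  by case: b uD uD' {hf hfr edv}; rewrite !inE /=; case: (u == x) / eqP; case: (u == y) / eqP => //=; lia.
apply: connect1; rewrite /rel_on edv /= !inE eqxx !orbT.
by case: b {uD uD' hf hfr edv} => /=; rewrite eqxx ?orbT.
Qed.

(** Ladders grown at the end, with an unordered frontier ([ladC]) and the dropped vertices [D]. This
    form suits the construction along a path, where ladders are cut back and prolonged; [lad_fr]
    recovers the sequence of steps. *)
Inductive lad (T : finType) (e : rel T) (x0 y0 : T) : T -> T -> seq T -> Prop :=
| lad0 : x0 != y0 -> lad e x0 y0 x0 y0 [::]
| ladC x y D : lad e x0 y0 x y D -> lad e x0 y0 y x D
| ladS x y D v : lad e x0 y0 x y D -> e x v -> v != y -> all (nadj e v) D ->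
    lad e x0 y0 v y (x :: D).

Lemma lad_fr (T : finType) (e : rel T) x0 y0 x y D : symmetric e -> lad e x0 y0 x y D ->
  exists s, [/\ fr e (x0, y0) s, perm_eq (drops (x0, y0) s) D &
                fin (x0, y0) s = (x, y) \/ fin (x0, y0) s = (y, x)].
Proof.
move=> es; elim=> [xy|{}x {}y {}D _ [s [h1 h2 h3]]|{}x {}y {}D v _ [s [h1 h2 h3]] exv vy nv].
- by exists [::]; rewrite /= xy; split=> //; left.
- by exists s; split=> //; case: h3; [right|left].
have an : anti e (drops (x0, y0) s) [:: v].
  apply/antiP => z t zs; rewrite inE => /eqP->; rewrite nadjC //.
  by apply: (allP nv); rewrite -(perm_mem h2).
have fn : (fin (x0, y0) s).1 != (fin (x0, y0) s).2.
  by have := h1; rewrite -[s in fr _ _ s]cats0 fr_cat => /and3P[_ /fr_neq].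
by case: h3 fn => h3; rewrite h3 /= => fn; [exists (s ++ [:: (true, v)]) | exists (s ++ [:: (false, v)])];
  rewrite fr_cat h1 an fin_cat drops_cat1 h3 /= exv ?[y == v]eq_sym vy fn perm_rcons perm_cons h2;
  split=> //; [left | right].
Qed.

Lemma lad_neq (T : finType) (e : rel T) x0 y0 x y D : lad e x0 y0 x y D -> x != y.
Proof. by elim=> // x1 y1 *; rewrite eq_sym. Qed.

Lemma lad_base (T : finType) (e : rel T) x0 y0 x y D : lad e x0 y0 x y D ->
  x0 \in x :: y :: D /\ y0 \in x :: y :: D.
Proof.
elim=> [_|x1 y1 D1 _ [h1 h2]|x1 y1 D1 v _ [h1 h2] _ _ _]; split; rewrite ?inE ?eqxx ?orbT //;
  by move: h1 h2; rewrite !inE; blia.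
Qed.

Lemma lad_sub (T : finType) (e e' : rel T) x0 y0 x y D : lad e x0 y0 x y D ->
  {in x :: y :: D &, e =2 e'} -> lad e' x0 y0 x y D.
Proof.
elim=> [xy _|x1 y1 D1 _ IH h|x1 y1 D1 v _ IH ev vy nv h]; first exact: lad0.
  by apply: ladC; apply: IH => z t hz ht; apply: h; move: hz ht; rewrite !inE; blia.
apply: ladS => //.
- by apply: IH => z t hz ht; apply: h; move: hz ht; rewrite !inE; blia.
- by rewrite -h // !inE eqxx ?orbT.
apply/allP => z zD; have := allP nv z zD; rewrite /nadj -h // !inE ?eqxx ?zD ?orbT //.
Qed.

Lemma lad_out (T : finType) (e : rel T) x0 y0 x y D : irreflexive e -> lad e x0 y0 x y D ->
  uniq (x :: y :: D).
Proof.
move=> ei; elim=> [xy|x1 y1 D1 _|x1 y1 D1 v _ IH ev vy /allP nv] /=; first by rewrite !inE xy.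
  by rewrite !inE; blia.
have vx : v != x1 by apply: contraTneq ev => ->; rewrite ei.
have vD : v \notin D1 by apply/negP => /nv; rewrite /nadj eqxx.
by move: IH vx vD vy; rewrite /= !inE; blia.
Qed.

(** Induction on the ladder. If [w] sees a vertex dropped before the last step, the shorter ladder
    already gets [w] into its frontier, and the last step is replayed if it concerns the other
    frontier vertex. If [w] sees only the vertex dropped last, it replaces that vertex instead of
    [v]. *)
Lemma lad_attach (T : finType) (e : rel T) x0 y0 x y D w : simple_graph e ->
  lad e x0 y0 x y D -> w \notin x :: y :: D -> has (e w) D ->
  exists g D', [/\ lad e x0 y0 w g D', {subset D' <= D}, g \in [:: x; y] & (x \notin D') && (y \notin D')].
Proof.
move=> [es ei] ld; elim: ld w => [//|x1 y1 D1 _ IH w wD hw|x1 y1 D1 v ld IH ev vy nv w wD].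
  have [|//|g [D' [h1 h2 h3 /andP[h4 h5]]]] := IH w; first by move: wD; rewrite !inE; blia.
  by exists g, D'; rewrite h4 h5; split=> //; move: h3; rewrite !inE orbC.
have /= u := lad_out ei (ladS ld ev vy nv); have u1 := lad_neq ld.
move=> hx; case hw : (has (e w) D1).
  have [||g [D' [h1 h2 h3 /andP[h4 h5]]]] := IH w => //.
    by move: wD; rewrite !inE; blia.
  have vD' : v \notin D' by apply: contraTN u => /h2 h; rewrite !inE h !orbT.
  move: h3; rewrite !inE => /orP[] /eqP eg; subst g; last first.
    exists y1, D'; split; rewrite ?vD' ?h5 ?inE ?eqxx ?orbT //.
    by move=> z /h2 zD; rewrite inE zD orbT.
  exists v, (x1 :: D'); split.
  - apply: ladC; apply: ladS => //; first exact: ladC.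
      by move: wD; rewrite !inE; blia.
    by apply/allP => z /h2 /(allP nv).
  - by move=> z; rewrite !inE => /orP[->//|/h2 ->]; rewrite orbT.
  - by rewrite inE eqxx.
  - by move: u vD' h5 u1; rewrite !inE; blia.
exists y1, (x1 :: D1); split=> //.
- apply: ladS => //.
  + by move: hx; rewrite /= hw orbF es.
  + by move: wD; rewrite !inE; blia.
  apply/allP => z zD; rewrite /nadj; move/negbT/hasPn/(_ z zD): hw => ->; rewrite andbT.
  by apply: contraNneq wD => ->; rewrite !inE zD !orbT.
- by rewrite !inE eqxx orbT.
- by move: u u1; rewrite !inE; blia.
Qed.

(** * Chord patterns of ladders *)

Notation pattern := (seq (bool * bool)).

(** A letter [(b, c)] is a step on side [b] whose new vertex sees the kept frontier vertex iff [c].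
    [prew_contract] complements at the first new vertex, which joins the dropped vertex to the
    second one. [prew_swap] merely reorders two steps, which are independent as the first has no
    chord. [prew_fan] shortens a fan around the kept vertex. *)
Inductive prew : pattern -> pattern -> Prop :=
| prew_refl p : prew p p
| prew_trans p q r : prew p q -> prew q r -> prew p r
| prew_lift a p q : prew p q -> prew (a :: p) (a :: q)
| prew_contract b c p : prew ((b, false) :: (b, c) :: p) ((b, c) :: p)
| prew_swap b c p : prew ((b, false) :: (~~ b, c) :: p) ((~~ b, false) :: (b, c) :: p)
| prew_fan b p : prew (nseq 4 (b, true) ++ p) ((b, true) :: p).

Lemma prew_cat w p q : prew p q -> prew (w ++ p) (w ++ q).
Proof. by elim: w => //= a w IH h; apply: prew_lift; apply: IH. Qed.

(* The letter [Some b] is a triangle, [None] a quadrangle. *)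
Notation letter := (option bool).
Definition raw (t : letter) : pattern :=
  if t is Some b then [:: (b, true)] else [:: (true, false); (false, true)].
Definition raws (w : seq letter) : pattern := flatten (map raw w).

(** Contractions and swaps remove chordless steps until at most one of them precedes the first
    chord: none gives a triangle, one on the other side gives a quadrangle. The bound [B] limits how
    many steps are consumed. *)
Lemma next_letter B p : B < size p -> B <= find (fun a => a.2) p \/
  exists t r, prew p (raw t ++ r) /\ size p <= size r + B.+1.
Proof.
elim: B p => [|B IH] [|[b c] p] //; first by left.
case: c => [_|]; first by right; exists (Some b), p; split; [apply: prew_refl | rewrite /=; lia].
case: p => [|[b2 c2] p] //= sp.
(* Induction applies to any rewritten pattern that is one step shorter and reaches its first chord
   earlier. *)
have lift p' : prew [:: (b, false), (b2, c2) & p] p' -> (size p').+1 = (size p).+2 ->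
    find (fun a => a.2) p' < find (fun a => a.2) [:: (b, false), (b2, c2) & p] ->
    B < find (fun a => a.2) [:: (b, false), (b2, c2) & p] \/
    exists t r, prew [:: (b, false), (b2, c2) & p] (raw t ++ r) /\ (size p).+2 <= size r + B.+2.
  move=> h1 h2 h3; have [|h|[t [r [h4 h5]]]] := IH p'; first by lia.
    by left; apply: leq_ltn_trans h h3.
  by right; exists t, r; split; [apply: prew_trans h1 h4 | lia].
have [eb|nb] := eqVneq b b2.
  subst b2; apply: (lift ((b, c2) :: p)) => //=; exact: prew_contract.
have eb : b2 = ~~ b by case: (b) (b2) nb => -[].
subst b2; case: c2 lift => lift.
  right; exists None; case: b nb lift => nb lift; exists p; (split; last by rewrite /=; lia).
    exact: prew_refl.
  exact: prew_swap.
case: p sp lift => [|[b3 c3] p] sp lift; first by left; move: sp => /=; case: (B) => [|[]].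
have [eb|nb3] := eqVneq b3 b.
  subst b3; apply: (lift [:: (~~ b, false), (b, c3) & p]) => //=.
  by apply: prew_trans (prew_swap _ _ _) _; apply: prew_lift; apply: prew_contract.
have eb : b3 = ~~ b by case: (b) (b3) nb3 => -[].
subst b3; apply: (lift [:: (b, false), (~~ b, c3) & p]) => //=.
by apply: prew_lift; apply: prew_contract.
Qed.

(* The patterns from which a long cycle arises at once. *)
Definition won B F (p : pattern) := exists w r, p = raws w ++ r /\
  ((B <= find (fun a => a.2) r /\ B < size r) \/ exists b r', r = nseq F (b, true) ++ r').

Lemma won_cons B F t p : won B F p -> won B F (raw t ++ p).
Proof.
move=> [w [r [-> h]]]; exists (t :: w), r; split=> //.
by rewrite /raws /= -catA.
Qed.

(** The normal form under [prew_fan]. *)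
Fixpoint no4 (w : seq letter) :=
  if w is t :: w' then ((t == None) || (take 4 w != nseq 4 t)) && no4 w' else true.

(** Each use of [prew_fan] shortens the run by three. *)
Lemma fan_red b k p : exists2 j, 0 < j <= 3 & prew (nseq k.+1 (b, true) ++ p) (nseq j (b, true) ++ p).
Proof.
elim/ltn_ind: k => k IH; have [lk|lk] := leqP k 2.
  by exists k.+1 => //; apply: prew_refl.
have [j hj h] := IH (k - 3) ltac:(lia); exists j => //.
apply: prew_trans h; have -> : k.+1 = 4 + (k - 3) by lia.
rewrite nseqD -catA; exact: prew_fan.
Qed.

Lemma raws_nseq b k : nseq k (b, true) = raws (nseq k (Some b)).
Proof. by elim: k => //= k ->. Qed.

(** Letters are read as long as they repeat the triangle [Some b]; [d] counts the triangles still
    missing for a run of length [F], which wins. *)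
Lemma run_letter B F b k d p : 0 < k -> k + d = F -> d.+1 * B.+2 < size p ->
  (exists p', prew (nseq k (b, true) ++ p) p' /\ won B F p') \/
  exists j t r, [/\ 0 < j, t != Some b, prew (nseq k (b, true) ++ p) (nseq j (b, true) ++ raw t ++ r) &
    size p <= size r + d.+1 * B.+2].
Proof.
elim: d k p => [|d IH] k p k0 kd sp.
  left; exists (nseq k (b, true) ++ p); split; first exact: prew_refl.
  exists [::], (nseq k (b, true) ++ p); split=> //; right; exists b, p.
  by rewrite -kd addn0.
have [|h|[t [r [h1 h2]]]] := @next_letter B p; first by nia.
  left; exists (nseq k (b, true) ++ p); split; first exact: prew_refl.
  by exists (nseq k (Some b)), p; rewrite raws_nseq; split=> //; left; split=> //; nia.
have [et|nt] := eqVneq t (Some b); last first.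
  right; exists k, t, r; split=> //; last by nia.
  exact: prew_cat.
subst t; have pk : prew (nseq k (b, true) ++ p) (nseq k.+1 (b, true) ++ r).
  by rewrite -nseq_catS; apply: prew_cat.
have [|||[p' [h3 h4]]|[j [t [r' [h3 h4 h5 h6]]]]] := IH k.+1 r => //; try by nia.
  by left; exists p'; split=> //; apply: prew_trans pk h3.
right; exists j, t, r'; split=> //; first exact: prew_trans pk h5.
by nia.
Qed.

Lemma won_raws B F w p : won B F p -> won B F (raws w ++ p).
Proof. by elim: w => //= t w IH /IH h; rewrite -catA; apply: won_cons. Qed.

Lemma no4_nseq b j t w : j <= 3 -> t != Some b -> no4 (t :: w) ->
  no4 (nseq j (Some b) ++ t :: w).
Proof.
case: j => [|[|[|[|]]]] // _ tb h; rewrite [nseq _ _ ++ _]/= /= in h *;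
  rewrite !eqseq_cons h (negbTE tb) ?andbF ?andbT //.
Qed.

(** The first letter [t] is prescribed to make the induction work: a run of triangles is read to its
    end, the word after it is parsed with a different first letter, and the run is cut down to at
    most three triangles, which preserves [no4]. *)
Lemma parse_pattern B F L : exists N, forall t p, N <= size p -> 
  exists p', prew (raw t ++ p) p' /\ (won B F.+1 p' \/
    exists w r, [/\ p' = raws w ++ r, size w >= L.+1, head None w = t, no4 w & size p <= size r + N]).
Proof.
elim: L => [|L [N hN]].
  exists 0 => t p _; exists (raw t ++ p); split; first exact: prew_refl.
  by right; exists [:: t], p; split; rewrite /raws /= ?cats0 ?addn0 //; case: (t) => [[]|].
exists (N + F.+1 * B.+2 + B.+2) => -[b|] p sp.
  have [|[p' [h1 h2]]|[j [t [r [j0 tb h1 h2]]]]] := @run_letter B F.+1 b 1 F p isT (add1n F); first by lia.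
    by exists p'; split=> //; left.
  have [|p' [h3 h4]] := hN t r; first by lia.
  case: j j0 h1 => // j _ h1.
  have [i hi h5] := fan_red b j (raw t ++ r).
  exists (nseq i (b, true) ++ p'); split.
    by apply: prew_trans h1 _; apply: prew_trans h5 _; apply: prew_cat.
  case: h4 => [h4|[w [r' [-> sw hw nw sr]]]]; first by left; rewrite raws_nseq; apply: won_raws.
  right; exists (nseq i (Some b) ++ w), r'; split.
  - by rewrite raws_nseq /raws map_cat flatten_cat catA.
  - by rewrite size_cat size_nseq; lia.
  - by case: i hi {h5}.
  - by case: w hw nw sw => // t' w ht nw _; apply: no4_nseq; rewrite -?ht // in tb *; lia.
  - lia.
have [|h|[t [r [h1 h2]]]] := @next_letter B p; first by lia.
  exists (raw None ++ p); split; first exact: prew_refl.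
  left; exists [:: None], p; split=> //; left; split=> //; lia.
have [|p' [h3 h4]] := hN t r; first by lia.
exists (raw None ++ p'); split.
  by apply: prew_cat; apply: prew_trans h1 h3.
case: h4 => [h4|[w [r' [-> sw hw nw sr]]]]; first by left; apply: won_cons.
right; exists (None :: w), r'; split=> //; last by lia.
Qed.

Lemma parse_first B F L : exists N, forall p, N <= size p ->
  exists p', prew p p' /\ (won B F.+1 p' \/
    exists w r, [/\ p' = raws w ++ r, size w >= L, no4 w & size p <= size r + N]).
Proof.
have [N hN] := parse_pattern B F L; exists (N + B.+2) => p sp.
have [|h|[t [r [h1 h2]]]] := @next_letter B p; first by lia.
  by exists p; split; [apply: prew_refl | left; exists [::], p; split=> //; left; split=> //; lia].
have [|p' [h3 h4]] := hN t r; first by lia.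
exists p'; split; first exact: prew_trans h1 h3.
case: h4 => [h4|[w [r' [-> sw hw nw sr]]]]; [by left | right; exists w, r'; split=> //; lia].
Qed.

Fixpoint pat (T : eqType) (e : rel T) (xy : T * T) (s : seq (bool * T)) : pattern :=
  if s is bv :: s' then (bv.1, e (drp xy (~~ bv.1)) bv.2) :: pat e (step xy bv) s' else [::].

Lemma pat_cat (T : eqType) (e : rel T) xy s1 s2 :
  pat e xy (s1 ++ s2) = pat e xy s1 ++ pat e (fin xy s1) s2.
Proof. by elim: s1 xy => //= bv s1 IH xy; rewrite IH. Qed.

Lemma size_pat (T : eqType) (e : rel T) xy s : size (pat e xy s) = size s.
Proof. by elim: s xy => //= bv s IH xy; rewrite IH. Qed.

Lemma unzip1_pat (T : eqType) (e : rel T) xy s : unzip1 (pat e xy s) = unzip1 s.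
Proof. by elim: s xy => //= bv s IH xy; rewrite IH. Qed.

Lemma eq_pat (T : eqType) (e e' : rel T) xy s : symmetric e -> symmetric e' ->
  (forall z t, z \in map snd s -> t \in xy.1 :: xy.2 :: map snd s -> e z t = e' z t) ->
  pat e xy s = pat e' xy s.
Proof.
move=> es es'; elim: s xy => [|[b v] s IH] [x y] //= h; congr ((_, _) :: _).
  rewrite es es'; apply: h; first by rewrite inE eqxx.
  by case: b; rewrite !inE eqxx ?orbT.
apply: IH => z t zs ts; apply: h; first by rewrite inE zs orbT.
by case: b ts; rewrite !inE; blia.
Qed.

(** * Simulating local complementations on index sets *)

(** Complementation on a graph whose vertices are numbers, so that concrete instances can be
    evaluated. *)
Definition lcn (A : rel nat) v : rel nat :=
  fun i j => A i j (+) [&& i != j, A v i & A v j].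

Lemma sim (T : finType) (e : rel T) (f : nat -> T) n A l : simple_graph e ->
  {in [pred i | i < n] &, injective f} ->
  (forall i j, i < n -> j < n -> e (f i) (f j) = A i j) -> all (fun i => i < n) l ->
  forall i j, i < n -> j < n -> local_compls e (map f l) (f i) (f j) = foldl lcn A l i j.
Proof.
move=> sg fi; elim: l e A sg => [|v l IH] e A sg hA; first by move=> _; exact: hA.
move=> /= /andP[vn ln]; apply: IH => //; first exact: lc_sg.
by move=> i j hi hj; rewrite lcE /lcn !hA // (inj_in_eq fi).
Qed.

(** The edges that a ladder with pattern [p] adds to the frontier [(a, b)] when its new vertices are
    numbered from [k]. The smaller number comes first. *)
Fixpoint pedges a b k (p : pattern) : seq (nat * nat) :=
  if p is (s, c) :: p' then
    (if s then a else b, k) :: (if c then [:: (if s then b else a, k)] else [::]) ++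
    pedges (if s then k else a) (if s then b else k) k.+1 p'
  else [::].

Lemma pedges_bound a b k p i j : a < k -> b < k -> (i, j) \in pedges a b k p ->
  [&& (i == a) || (i == b) || (k <= i), k <= j & i < j].
Proof.
elim: p a b k => //= -[s c] p IH a b k ak bk.
rewrite inE mem_cat => /or3P[/eqP[-> ->]|h|h].
- by case: s; rewrite eqxx ?orbT leqnn.
- by case: c h => //; rewrite inE => /eqP[-> ->]; case: s; rewrite eqxx ?orbT leqnn.
by have := IH _ _ _ _ _ h; case: s {h} => h; have := h ltac:(lia) ltac:(lia); lia.
Qed.

Lemma pedgesP (T : finType) (e : rel T) (f : nat -> T) a b k s : a < k -> b < k -> a != b ->
  fr e (f a, f b) s -> (forall i, i < size s -> f (k + i) = nth (f a) (map snd s) i) ->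
  forall i j, (i == a) || (i == b) || (k <= i) -> i < j -> k <= j < k + size s ->
  e (f i) (f j) = ((i, j) \in pedges a b k (pat e (f a, f b) s)).
Proof.
elim: s a b k => [|[sd v] s IH] a b k ak bk ab; first by move=> _ _ i j _ _ /=; lia.
rewrite [fr _ _ _]/= => /andP[_ /and3P[edv /allP nd hfr]] hf i j hi ij hj.
have fk : f k = v by have := hf 0 isT; rewrite addn0.
set d := if sd then a else b; set kp := if sd then b else a.
have ed : drp (f a, f b) sd = f d by rewrite /d; case: (sd).
have ek : drp (f a, f b) (~~ sd) = f kp by rewrite /kp; case: (sd).
have st : step (f a, f b) (sd, v) = (f (if sd then k else a), f (if sd then b else k)).
  by rewrite /step /=; case: (sd); rewrite -fk.
have dk : d != kp by rewrite /d /kp; case: (sd) ab; rewrite // eq_sym.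
have hik : [|| i == d, i == kp | k <= i] by rewrite /d /kp; case: (sd) hi; lia.
have dkk : d < k /\ kp < k by rewrite /d /kp; case: (sd).
rewrite [pat _ _ _]/= [pedges _ _ _ _]/= -/d -/kp ek inE mem_cat st.
set rest := pedges _ _ _ _.
have rb u w : (u, w) \in rest -> ((u == k) || (u == kp) || (k < u)) && (k < w).
  by move=> /pedges_bound h; have := h ltac:(case: (sd); lia) ltac:(case: (sd); lia); rewrite /kp; case: (sd); lia.
have emk u w : ((u, w) \in (if e (f kp) v then [:: (kp, k)] else [::])) = [&& e (f kp) v, u == kp & w == k].
  by case: (e (f kp) v); rewrite ?inE ?xpair_eqE.
rewrite emk xpair_eqE.
have [ejk|jk] := eqVneq j k.
  subst j; have -> : (i, k) \in rest = false by apply/negP => /rb; rewrite ltnn andbF.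
  rewrite fk orbF !andbT; move: hik; have -> : (k <= i) = false by lia.
  rewrite orbF => /orP[/eqP->|/eqP->]; first by rewrite eqxx -ed edv.
  by rewrite eq_sym (negbTE dk) eqxx andbT.
rewrite !andbF /=.
have kj : k < j by lia.
have [eid|nid] := eqVneq i d.
  subst i; have -> : (d, j) \in rest = false by apply/negP => /rb; lia.
  have -> : f j = nth (f a) (map snd ((sd, v) :: s)) (j - k).
    have hs : j - k < size ((sd, v) :: s) by move: hj; rewrite /=; lia.
    by rewrite -(hf _ hs) subnKC // ltnW.
  apply/negbTE.
  have : nth (f a) (map snd ((sd, v) :: s)) (j - k) \in map snd s.
    have -> : j - k = (j - k.+1).+1 by lia.
    by rewrite /=; apply: mem_nth; rewrite size_map; rewrite /= in hj; lia.
  by rewrite -ed => /nd /andP[].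
rewrite /rest; apply: IH => //.
- by case: (sd); lia.
- by case: (sd); lia.
- by case: (sd); lia.
- by move: hfr; rewrite st.
- move=> i' hi'; rewrite addSnnS hf //= ; apply: set_nth_default; by rewrite size_map.
- by move: hik nid; rewrite /d /kp; case: (sd); lia.
- by rewrite kj addSnnS; case/andP: hj.
Qed.

Definition mat r (p : pattern) : rel nat :=
  let E := (if r then [:: (0, 1)] else [::]) ++ pedges 0 1 2 p in
  fun i j => ((i, j) \in E) || ((j, i) \in E).

Lemma fr_adj (T : finType) (e : rel T) xy s i j : simple_graph e -> fr e xy s ->
  let us := xy.1 :: xy.2 :: map snd s in i < size us -> j < size us ->
  e (nth xy.1 us i) (nth xy.1 us j) = mat (e xy.1 xy.2) (pat e xy s) i j.
Proof.
move=> sg hfr us hi hj; have [es ei] := sg.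
have szu : size us = (size s).+2 by rewrite /= size_map.
rewrite szu in hi hj.
have ij_case u w : u < w -> w < (size s).+2 ->
    e (nth xy.1 us u) (nth xy.1 us w) = mat (e xy.1 xy.2) (pat e xy s) u w.
  move=> uw hw; rewrite /mat !mem_cat.
  have bd i' j' : (i', j') \in pedges 0 1 2 (pat e xy s) -> 1 < j' /\ i' < j'.
    by move=> /pedges_bound h; have /and3P[] := h isT isT.
  have -> : (w, u) \in pedges 0 1 2 (pat e xy s) = false by apply/negP => /bd; lia.
  have -> : (w, u) \in (if e xy.1 xy.2 then [:: (0, 1)] else [::]) = false.
    by case: (e _ _); rewrite // inE xpair_eqE; lia.
  rewrite !orbF; case: w uw hw => [|[|w]] // uw hw.
    have -> : u = 0 by lia.
    have -> : (0, 1) \in pedges 0 1 2 (pat e xy s) = false by apply/negP => /bd [].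
    by rewrite orbF /us /=; case: (e _ _).
  have -> : (u, w.+2) \in (if e xy.1 xy.2 then [:: (0, 1)] else [::]) = false.
    by case: (e _ _); rewrite // inE xpair_eqE andbF.
  have -> : xy = (nth xy.1 us 0, nth xy.1 us 1) by rewrite /us /=; case: (xy).
  rewrite /= -(@pedgesP _ _ (fun i => nth xy.1 us i)) //.
  - by rewrite /us /=; case: (xy) hfr.
  - by lia.
case: (ltngtP i j) => [lt|lt|->]; first exact: ij_case.
  by rewrite es ij_case // /mat orbC.
rewrite ei; apply/esym/negbTE; rewrite /mat orbb mem_cat negb_or; apply/andP; split.
  by case: (e _ _); rewrite // inE xpair_eqE; case: (j).
by apply/negP => /pedges_bound h; have /and3P[_ _] := h isT isT; rewrite ltnn.
Qed.

Lemma fr_map (T : eqType) (e : rel T) (f : nat -> T) n (A : rel nat) a b t :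
  {in [pred i | i < n] &, injective f} ->
  (forall i j, i < n -> j < n -> e (f i) (f j) = A i j) ->
  a < n -> b < n -> all (fun bv => bv.2 < n) t ->
  let t' := [seq (bv.1, f bv.2) | bv <- t] in
  [/\ fr e (f a, f b) t' = fr A (a, b) t, pat e (f a, f b) t' = pat A (a, b) t,
      fin (f a, f b) t' = (f (fin (a, b) t).1, f (fin (a, b) t).2),
      drops (f a, f b) t' = map f (drops (a, b) t) & map snd t' = map f (map snd t)].
Proof.
move=> fi hA; elim: t a b => [|[sd v] t IH] a b an bn /=.
  by rewrite (inj_in_eq fi).
move=> /andP[vn tn].
have [dn kn] : drp (a, b) sd < n /\ drp (a, b) (~~ sd) < n by case: (sd).
have ed c : drp (f a, f b) c = f (drp (a, b) c) by case: c.
have es : step (f a, f b) (sd, f v) = (f (step (a, b) (sd, v)).1, f (step (a, b) (sd, v)).2).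
  by case: (sd).
have [||//|h1 h2 h3 h4 h5] := IH (step (a, b) (sd, v)).1 (step (a, b) (sd, v)).2; try by case: (sd).
rewrite -surjective_pairing in h1 h2 h3 h4.
rewrite es !ed h1 h2 h3 h4 h5 !hA // (inj_in_eq fi) //; split=> //.
congr [&& _, _, _ & _]; rewrite all_map; apply: eq_in_all => w wt.
have wn : w < n by move/mapP: wt => [bv bt ->]; apply: (allP tn).
by rewrite /= /nadj (inj_in_eq fi) // hA.
Qed.

(** What a rewriting must preserve to be usable in context. Fixed last frontier and closing edge let
    the ladder be continued and closed. Fixed rows of the vertices that see no step vertex allow
    rewriting after earlier steps ([lred_lift]) and protect a path already built ([ust_lred]). *)
Record lred (T : finType) (e : rel T) (xy : T * T) (s : seq (bool * T))
    (e' : rel T) (s' : seq (bool * T)) : Prop := Lred {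
  lred_eq : lequiv e e';
  lred_fr : fr e' xy s';
  lred_sub : {subset map snd s' <= map snd s};
  lred_fin : fin xy s' = fin xy s;
  lred_xy : e' xy.1 xy.2 = e xy.1 xy.2;
  lred_row : forall z, z \notin xy.1 :: xy.2 :: map snd s ->
    (forall v, v \in map snd s -> ~~ e v z) -> forall t, e' z t = e z t;
  lred_closed : e' (fin xy s).1 (fin xy s).2 = e (fin xy s).1 (fin xy s).2 }.

Lemma lred_refl (T : finType) (e : rel T) xy s : fr e xy s -> lred e xy s e s.
Proof. by move=> h; split=> //; apply: lequiv_refl. Qed.

Lemma lred_trans (T : finType) (e e' e'' : rel T) xy s s' s'' : simple_graph e ->
  lred e xy s e' s' -> lred e' xy s' e'' s'' -> lred e xy s e'' s''.
Proof.
move=> sg [q1 q2 q3 q4 q5 q6 q7] [r1 r2 r3 r4 r5 r6 r7]; have [es _] := sg.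
have [es' _] := lequiv_sg q1 sg; split.
- exact: lequiv_trans q1 r1.
- by [].
- by move=> z /r3 /q3.
- by rewrite r4.
- by rewrite r5.
- move=> z zn zs t; rewrite r6 ?q6 // => [|v vs].
    apply: contra zn; rewrite !inE => /or3P[->|->|/q3 ->]; by rewrite ?orbT.
  by rewrite es' q6 // es zs // q3.
- by rewrite -q4 r7 q4.
Qed.

(** The vertex dropped by the first step sees no later step vertex, so [lred_row] keeps its row. *)
Lemma lred_lift (T : finType) (e e' : rel T) xy bv s s' : simple_graph e ->
  fr e xy (bv :: s) -> lred e (step xy bv) s e' s' ->
  lred e xy (bv :: s) e' (bv :: s') /\
  head (true, true) (pat e' xy (bv :: s')) = head (true, true) (pat e xy (bv :: s)).
Proof.
move=> sg hfr [q1 q2 q3 q4 q5 q6 q7]; have [es ei] := sg.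
have [es' ei'] := lequiv_sg q1 sg.
have /= u := fr_uniq ei hfr.
case: bv hfr q2 q4 q5 q6 q7 u => b v.
rewrite [fr _ _ _]/= => /andP[xyn /and3P[edv /allP nd hfr]] q2 q4 q5 q6 q7 u.
have dn : drp xy b \notin [:: (step xy (b, v)).1, (step xy (b, v)).2 & map snd s].
  by case: (b) u; rewrite /= !inE; blia.
have rd t : e' (drp xy b) t = e (drp xy b) t.
  by apply: q6 => // w /nd /andP[_]; rewrite es.
have ek : e' (drp xy (~~ b)) v = e (drp xy (~~ b)) v.
  by move: q5; case: (b) => //=; rewrite [e' v _]es' [e v _]es.
split; last by rewrite /= ek.
split=> //=.
- rewrite xyn rd edv q2 andbT /=; apply/allP => z /q3 /nd; by rewrite /nadj rd.
- by move=> z; rewrite !inE => /orP[->//|/q3 ->]; rewrite orbT.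
- by move: rd; case: (b) => /= rd; rewrite ?rd // es' rd es.
- move=> z zn zs t; apply: q6 => [|w ws]; last by apply: zs; rewrite inE ws orbT.
  by move: zn; case: (b); rewrite !inE /=; blia.
Qed.

(** The vertices in [l] are complemented at, and [t] is the new ladder. The base vertices 0 and 1
    and the last frontier [F] are excluded from [l]: the former may see earlier parts of the graph,
    the latter may see later steps. *)
Definition scheck r p1 l (t : seq (bool * nat)) p1' :=
  let n := (size p1).+2 in
  let A := mat r p1 in let A' := foldl lcn A l in
  let F := fin (0, 1) (zip (unzip1 p1) (iota 2 (size p1))) in
  [&& all (fun v => (1 < v < n) && (v != F.1) && (v != F.2)) l, all (fun bv => 1 < bv.2 < n) t,
      fin (0, 1) t == F, fr A' (0, 1) t, pat A' (0, 1) t == p1',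
      A' 0 1 == A 0 1 & A' F.1 F.2 == A F.1 F.2].

(* The local structure common to all surgeries: the first [size s1] steps of a
   ladder, with their vertices numbered from 2, are simulated by [mat]. *)
Lemma fr_numbered (T : finType) (e : rel T) xy s1 s2 (n := (size s1).+2)
    (f := nth xy.1 (xy.1 :: xy.2 :: map snd s1)) (ix := zip (unzip1 s1) (iota 2 (size s1))) :
  simple_graph e -> fr e xy (s1 ++ s2) ->
  [/\ {in [pred i | i < n] &, injective f}, xy = (f 0, f 1),
      forall i j, i < n -> j < n -> e (f i) (f j) = mat (e xy.1 xy.2) (pat e xy s1) i j,
      fin xy s1 = (f (fin (0, 1) ix).1, f (fin (0, 1) ix).2) &
      [/\ (fin (0, 1) ix).1 < n, (fin (0, 1) ix).2 < n &
      forall i, i < n -> i != (fin (0, 1) ix).1 -> i != (fin (0, 1) ix).2 ->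
        (f i \in drops xy s1) /\ forall z, z \in map snd s2 -> nadj e (f i) z]].
Proof.
move=> sg hfr; have [es ei] := sg.
have : fr e xy s1 by move: hfr; rewrite fr_cat => /and3P[].
move=> hfr1; have u := fr_uniq ei hfr1.
have su : size (xy.1 :: xy.2 :: map snd s1) = n by rewrite /= size_map.
have fi : {in [pred i | i < n] &, injective f}.
  by move=> i j; rewrite !inE => hi hj /eqP; rewrite /f nth_uniq ?su // => /eqP.
have exy : xy = (f 0, f 1) by rewrite /f /=; case: (xy).
have sz : size (unzip1 s1) = size (iota 2 (size s1)) by rewrite size_iota size_map.
have es1 : s1 = [seq (bv.1, f bv.2) | bv <- ix].
  apply: (@eq_from_nth _ (true, xy.1)); first by rewrite size_map size_zip -sz minnn size_map.
  move=> i hi; rewrite (nth_map (true, 0)) ?size_zip -?sz ?minnn ?size_map //.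
  rewrite /ix nth_zip // nth_iota // /f /= (nth_map (true, xy.1)) // (nth_map (true, xy.1)) //.
  by case: (nth _ _ _).
have aix : all (fun bv => bv.2 < n) ix.
  apply/allP => bv /(nthP (true, 0)) [i]; rewrite size_zip -sz minnn size_map => hi <-.
  by rewrite /ix nth_zip // nth_iota //= /n; lia.
have hA i j : i < n -> j < n -> e (f i) (f j) = e (f i) (f j) by [].
have [_ _ h3 h4 _] := @fr_map _ e f n (fun i j => e (f i) (f j)) 0 1 ix fi hA isT isT aix.
rewrite -es1 -exy in h3 h4.
have pd := @perm_drops _ (0, 1) ix.
have msix : map snd ix = iota 2 (size s1) by apply: unzip2_zip; rewrite sz.
have mem0 (i : nat) : (i < n) = (i \in [:: (fin (0, 1) ix).1, (fin (0, 1) ix).2 & drops (0, 1) ix]).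
  rewrite -(perm_mem pd) msix !inE mem_iota /= /n add2n; case: i => [|[|i]] //.
split=> //.
- move=> i j hi hj; apply: (fr_adj sg hfr1); by rewrite su.
split; first by rewrite mem0; apply: mem_head.
  by rewrite mem0 in_cons mem_head orbT.
move=> i; rewrite mem0 !inE => hi n1 n2.
have id : i \in drops (0, 1) ix by move: hi; rewrite (negbTE n1) (negbTE n2).
have fd : f i \in drops xy s1 by rewrite h4 map_f.
by split=> // z zs; move: hfr; rewrite fr_cat => /and3P[_ _ /antiP]; apply.
Qed.

Lemma fin_last (T : eqType) (xy : T * T) s : s != [::] ->
  ((fin xy s).1 \in map snd s) || ((fin xy s).2 \in map snd s).
Proof.
case/lastP: s => // s [b v] _; rewrite -cats1 fin_cat map_cat !mem_cat /=.
by case: b; rewrite /= mem_head !orbT.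
Qed.

Lemma mat_irr r p : irreflexive (mat r p).
Proof.
move=> i; rewrite /mat orbb mem_cat; apply/norP; split.
  by case: r; rewrite // inE xpair_eqE; case: i.
by apply/negP => /pedges_bound h; have /and3P[_ _] := h isT isT; rewrite ltnn.
Qed.

Lemma lcn_irr A l : irreflexive A -> irreflexive (foldl lcn A l).
Proof. by elim: l A => //= v l IH A h; apply: IH => i; rewrite /lcn h eqxx. Qed.

(** All complementations are at vertices dropped within [s1], so the rows of the vertices of [s2] do
    not change; what happens among the numbered vertices is decided by [scheck]. *)
Lemma surgery (T : finType) (e : rel T) xy s1 s2 l t p1' : simple_graph e ->
  fr e xy (s1 ++ s2) -> scheck (e xy.1 xy.2) (pat e xy s1) l t p1' ->
  exists e' s1', lred e xy (s1 ++ s2) e' (s1' ++ s2) /\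
    pat e' xy (s1' ++ s2) = p1' ++ pat e (fin xy s1) s2.
Proof.
move=> sg hfr; have [es ei] := sg.
have [fi exy hA hF [F1 F2 hD]] := fr_numbered sg hfr.
rewrite /scheck size_pat unzip1_pat.
set n := (size s1).+2 in fi hA F1 F2 hD *; set f := nth _ _ in fi exy hA hF hD.
set F := fin (0, 1) _ in hF F1 F2 hD *; set A' := foldl _ _ l.
move=> /and5P[/allP hl ht /eqP hft hfrt /and3P[/eqP hp /eqP h01 /eqP hFF]].
pose e' := local_compls e (map f l); have sg' : simple_graph e' := lcs_sg (map f l) sg.
have [es' ei'] := sg'.
have hA' i j : i < n -> j < n -> e' (f i) (f j) = A' i j.
  apply: (sim sg fi hA); by apply/allP => v /hl /andP[/andP[/andP[]]].
have ht' : all (fun bv : bool * nat => bv.2 < n) t by apply: sub_all ht => bv /andP[].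
have [r1 r2 r3 r4 r5] := fr_map fi hA' (isT : 0 < n) (isT : 1 < n) ht'.
rewrite -exy in r1 r2 r3 r4.
set t' := [seq _ | bv <- t] in r1 r2 r3 r4 r5; exists e', t'.
have rowz z : (forall i, i \in l -> ~~ e (f i) z) -> forall w, e' z w = e z w.
  by move=> h w; apply: lcs_out => //; apply/allP => _ /mapP[i il ->]; apply: h.
have row2 z w : z \in map snd s2 -> e' z w = e z w.
  move=> zs; apply: rowz => i /hl /andP[/andP[/andP[_ h1] h2] h3].
  by have [_ /(_ z zs) /andP[]] := hD i h1 h2 h3.
have hfr2 : fr e (fin xy s1) s2 by move: hfr; rewrite fr_cat => /and3P[].
have eft : fin xy t' = fin xy s1 by rewrite r3 hF hft.
have finl : fin xy (s1 ++ s2) = fin (fin xy s1) s2 by rewrite fin_cat.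
split.
  split.
  - by apply: lequiv_lcs; apply: lequiv_refl.
  - rewrite fr_cat r1 hfrt eft -(@eq_fr _ e) ?hfr2 //=; last by move=> z w zs _; rewrite row2.
    rewrite r4; apply/antiP => _ z /mapP[i id ->] zs.
    have in_n : i < n /\ i != F.1 /\ i != F.2.
      have pd := @perm_drops _ (0, 1) t; rewrite hft in pd.
      have un : uniq [:: F.1, F.2 & drops (0, 1) t].
        rewrite -(perm_uniq pd); by apply: fr_uniq hfrt; apply/lcn_irr/mat_irr.
      have mi : i \in [:: 0, 1 & map snd t] by rewrite (perm_mem pd) !inE id !orbT.
      split; last by move: un; rewrite /= !inE negb_or => /and3P[/andP[_ d1] d2 _]; split; apply: contraTneq id => ->.
      by move: mi; rewrite !inE => /or3P[/eqP->|/eqP->|/mapP[bv /(allP ht') h ->]].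
    have [h1 [h2 h3]] := in_n; have [_ /(_ z zs)] := hD i h1 h2 h3.
    by rewrite /nadj es' row2 // es.
  - move=> z; rewrite !map_cat !mem_cat => /orP[|->]; last by rewrite orbT.
    rewrite r5 => /mapP[i /mapP[bv /(allP ht) /andP[h1 h2] ->] ->].
    case: bv h1 h2 => b [|[|i']] //= _ h2; apply/orP; left; apply: mem_nth; rewrite size_map.
    by move: h2; rewrite /n !ltnS.
  - by rewrite !fin_cat eft.
  - by rewrite {1 2}exy /= hA' // h01 -hA // exy.
  - move=> z zn zs w; apply: rowz => i /hl /andP[/andP[/andP[]]].
    case: i => [|[|i]] //= _ hi _ _; apply: zs; rewrite map_cat mem_cat /f /= mem_nth // size_map.
    by move: hi; rewrite /n !ltnS.
  - rewrite finl; have [->|s2n] := eqVneq s2 [::]; first by rewrite /= hF /= !hA' // hFF -!hA.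
    case/orP: (fin_last (fin xy s1) s2n) => h; first by rewrite row2.
    by rewrite es' row2 // es.
rewrite pat_cat eft r2 hp; congr (_ ++ _); apply/esym/eq_pat => // z w zs _; by rewrite row2.
Qed.

(** The three proper rules are instances of [surgery]. The check depends only on the base edge, the
    side and at most one chord, so all cases can be evaluated. *)
Lemma prew_sound (T : finType) p p' : prew p p' -> forall (e : rel T) xy s,
  simple_graph e -> fr e xy s -> pat e xy s = p ->
  exists e' s', lred e xy s e' s' /\ pat e' xy s' = p'.
Proof.
elim=> {p p'} [p|p q r _ IH1 _ IH2|[b c] p q _ IH|b c p|b c p|b p] e xy s sg hfr hp.
- by exists e, s; split=> //; apply: lred_refl.
- have [e1 [s1 [h1 p1]]] := IH1 _ _ _ sg hfr hp.
  have [e2 [s2 [h2 p2]]] := IH2 _ _ _ (lequiv_sg (lred_eq h1) sg) (lred_fr h1) p1.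
  by exists e2, s2; split=> //; apply: lred_trans h1 h2.
- case: s hfr hp => // bv s hfr /= [eb ec ep].
  have hfr' : fr e (step xy bv) s by case/andP: hfr => _ /and3P[].
  have [e' [s' [h ph]]] := IH _ _ _ sg hfr' ep.
  have [h1 /= h2] := lred_lift sg hfr h.
  by exists e', (bv :: s'); split; rewrite //= ph h2 ec eb.
- case: s hfr hp => [|a1 [|a2 s]] // hfr hp.
  have [|e' [s' [h ph]]] := @surgery _ e xy [:: a1; a2] s [:: 2] [:: (b, 3)] [:: (b, c)] sg hfr.
    move: hp => /= [-> -> -> -> _]; by case: (e _ _) (b) (c) => -[] [].
  exists e', (s' ++ s); split=> //; rewrite ph /=; congr (_ :: _).
  by move: hp => /= [].
- case: s hfr hp => [|a1 [|a2 s]] // hfr hp.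
  have [|e' [s' [h ph]]] := @surgery _ e xy [:: a1; a2] s [::] [:: (~~ b, 3); (b, 2)]
      [:: (~~ b, false); (b, c)] sg hfr.
    move: hp => /= [-> -> -> -> _]; by case: (e _ _) (b) (c) => -[] [].
  exists e', (s' ++ s); split=> //; rewrite ph /=; congr [:: _, _ & _].
  by move: hp => /= [].
case: s hfr hp => [|a1 [|a2 [|a3 [|a4 s]]]] // hfr hp.
(* Complementing at 3 joins 2 to 4 and detaches both from the kept vertex; complementing at 2 and 4
   then joins the dropped vertex to 5. *)
have [|e' [s' [h ph]]] := @surgery _ e xy [:: a1; a2; a3; a4] s [:: 3; 2; 4] [:: (b, 5)]
    [:: (b, true)] sg hfr.
  move: hp => /= [-> -> -> -> -> -> -> -> _]; by case: (e _ _) (b) => -[].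
exists e', (s' ++ s); split=> //; rewrite ph /=; congr (_ :: _).
by move: hp => /= [].
Qed.

(** * Long ladders contain long cycles *)

(** The state of the walk along a ladder: an induced path [Z] whose ends are attached to the two
    frontier vertices and which sees no later step. The frontier vertices may be adjacent to each
    other. *)
Definition ust (T : eqType) (e : rel T) (Z : seq T) (xy : T * T) (s : seq (bool * T)) : bool :=
  [&& Z != [::], ipath e (xy.1 :: Z), ipath e (rcons Z xy.2), anti e Z (map snd s) & fr e xy s].

Lemma ipath_glue (T : eqType) (e : rel T) p a q : ipath e (rcons p a) -> ipath e (a :: q) ->
  anti e p q -> ipath e (p ++ a :: q).
Proof.
case/lastP: p => [//|p b]; rewrite -(cats1 (rcons p b)) ipath_cat.
move=> /and5P[h1 _ h2 h3 _] h4 h5; rewrite ipath_cat h1 h4 h2 /=.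
move: h3 h5; rewrite /anti all_rcons => /allP h3 /andP[-> /allP h5]; rewrite andbT.
by apply/allP => z zp /=; have /= /andP[-> _] := h3 z zp; rewrite (h5 z zp).
Qed.

(** The ends of the path are regarded as the base of a longer ladder whose first steps replace them
    by the frontier; these are the steps put before [raws w]. If [c] holds, the ends are distinct
    and numbered 0 and 1; otherwise the base consists of the only path vertex and the second
    frontier vertex. The test says that [pre], the path (reversed if [rv]) and [post] form the path
    of a new state with nonadjacent frontier. *)
Definition rchk c r w (l pre : seq nat) (rv : bool) (post : seq nat) :=
  let p := (if c then [:: (true, false); (false, true)] else [:: (true, true)]) ++ raws w in
  let n := (size p).+2 in
  let F := fin (0, 1) (zip (unzip1 p) (iota 2 (size p))) in
  let A := mat r p in
  let A' := foldl lcn A l in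
  let z1 := if c then 1 else 0 in
  let za := if rv then z1 else 0 in
  let zb := if rv then 0 else z1 in
  let ok v := [&& v < n, v != F.1, v != F.2, 0 < v & v != z1] in
  [&& all ok l, all ok pre, all ok post, ~~ A' F.1 F.2 & A' 0 z1 == A 0 z1] &&
  [&& 0 != F.1, 0 != F.2, z1 != F.1 & z1 != F.2] &&
  [&& ipath A' (F.1 :: rcons pre za), ipath A' (zb :: rcons post F.2),
    anti A' (F.1 :: pre) post, anti A' pre (rcons post F.2) &
    c ==> (anti A' (F.1 :: pre) [:: zb] && anti A' [:: za] (rcons post F.2))].

Lemma ipath_map (T U : eqType) (e : rel T) (A : rel U) (f : U -> T) (q : seq U) :
  {in q &, injective f} -> {in q &, forall i j, e (f i) (f j) = A i j} ->
  ipath e (map f q) = ipath A q.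
Proof.
elim: q => //= x q IH fi hA; congr andb; last first.
  by apply: IH => i j iq jq; [apply: fi | apply: hA]; rewrite inE ?iq ?jq orbT.
case: q fi hA {IH} => //= y q fi hA; rewrite hA ?inE ?eqxx ?orbT //; congr andb.
rewrite all_map; apply: eq_in_all => z zq.
by rewrite /= /nadj hA ?(inj_in_eq fi) // !inE ?eqxx ?zq ?orbT.
Qed.

Lemma anti_map (T U : eqType) (e : rel T) (A : rel U) (f : U -> T) (q1 q2 : seq U) :
  {in q1 ++ q2 &, injective f} -> {in q1 & q2, forall i j, e (f i) (f j) = A i j} ->
  anti e (map f q1) (map f q2) = anti A q1 q2.
Proof.
move=> fi hA; rewrite /anti all_map; apply: eq_in_all => i iq /=.
rewrite all_map; apply: eq_in_all => j jq /=.
by rewrite /nadj hA // (inj_in_eq fi) // mem_cat ?iq ?jq ?orbT.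
Qed.

(** The inner vertices of the path see none of the vertices complemented at, so their rows are fixed
    and just the ends of the path need to be simulated. *)
Lemma rchk_step (T : finType) (e : rel T) ab s1 s2 M c w l pre rv post :
  simple_graph e -> fr e ab (s1 ++ s2) ->
  pat e ab s1 = (if c then [:: (true, false); (false, true)] else [:: (true, true)]) ++ raws w ->
  rchk c (e ab.1 ab.2) w l pre rv post ->
  ipath e (ab.1 :: M) -> last ab.1 M = (if c then ab.2 else ab.1) -> (~~ c -> M = [::]) ->
  (forall z, z \in ab.1 :: M -> z != ab.1 -> z != last ab.1 M -> all (nadj e z) (map snd (s1 ++ s2))) ->
  s2 != [::] ->
  exists e' Z', [/\ lequiv e e', ust e' Z' (fin ab s1) s2, ~~ e' (fin ab s1).1 (fin ab s1).2,
    (size M).+1 <= size Z' &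
    e' (fin ab (s1 ++ s2)).1 (fin ab (s1 ++ s2)).2 = e (fin ab (s1 ++ s2)).1 (fin ab (s1 ++ s2)).2].
Proof.
move=> sg hfr hp + iZ lZ cM iM s2n; have [es ei] := sg.
have [fi eab hA hF [F1 F2 hD]] := fr_numbered sg hfr.
rewrite /rchk -hp size_pat unzip1_pat.
set n := (size s1).+2 in fi hA F1 F2 hD *; set f := nth _ _ in fi eab hA hF hD.
set F := fin (0, 1) _ in hF F1 F2 hD *; set A' := foldl _ _ l.
set z1 := if c then 1 else 0; set za := if rv then z1 else 0; set zb := if rv then 0 else z1.
move=> /andP[/andP[/and5P[/allP hl /allP hpre /allP hpost nF /eqP h01] /and4P[z0F1 z0F2 z1F1 z1F2]]].
move=> /and5P[ip1 ip2 an1 an2 anc].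
pose e' := local_compls e (map f l); have sg' : simple_graph e' := lcs_sg (map f l) sg.
have [es' ei'] := sg'.
have hA' i j : i < n -> j < n -> e' (f i) (f j) = A' i j.
  by apply: (sim sg fi hA); apply/allP => v /hl /and5P[].
have rowz z : (forall i, i \in l -> ~~ e (f i) z) -> forall w, e' z w = e z w.
  by move=> h u; apply: lcs_out => //; apply/allP => _ /mapP[i il ->]; apply: h.
have row2 z u : z \in map snd s2 -> e' z u = e z u.
  move=> zs; apply: rowz => i /hl /and5P[h1 h2 h3 _ _].
  by have [_ /(_ z zs) /andP[]] := hD i h1 h2 h3.
have z1n : z1 < n by rewrite /z1; case: (c).
have f0 : f 0 = ab.1 by [].
have fz1 : f z1 = last ab.1 M by rewrite lZ /z1; case: (c).
have zab : (za < n) && (zb < n) by rewrite /za /zb; case: (rv); rewrite z1n.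
have [zan zbn] := andP zab.
have fsn i : 0 < i < n -> i != z1 -> c || (i != 1) -> f i \in map snd s1.
  move=> /andP[i0 hi] iz ci; case: i i0 hi iz ci => [|[|i]] // _; last first.
    by rewrite /n !ltnS => hi _ _; rewrite /f /=; apply: mem_nth; rewrite size_map.
  by rewrite /z1; case: (c).
pose mid z := [&& z \in ab.1 :: M, z != ab.1 & z != last ab.1 M].
have cmid z : mid z -> c.
  by apply: contraTT => /cM eM; rewrite /mid eM inE; case: (z == _).
have midn z i : mid z -> i < n -> 0 < i -> i != z1 -> nadj e z (f i).
  move=> hz hi i0 iz; have hc := cmid z hz; case/and3P: hz => h1 h2 h3.
  apply: (allP (iM z h1 h2 h3)); rewrite map_cat mem_cat fsn ?hc ?i0 //.
have midrow z u : mid z -> e' z u = e z u.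
  move=> hz; apply: rowz => i /hl /and5P[h1 _ _ h2 h3].
  by have /andP[_] := midn z i hz h1 h2 h3; rewrite es.
have eZ : {in ab.1 :: M &, e =2 e'}.
  move=> u v uM vM; have [mu|nu] := boolP (mid u); first by rewrite midrow.
  have [mv|nv] := boolP (mid v); first by rewrite es' midrow // es.
  have ends t : t \in ab.1 :: M -> ~~ mid t -> exists2 i, i \in [:: 0; z1] & t = f i.
    rewrite /mid => -> /=; rewrite negb_and !negbK => /orP[] /eqP ->.
      by exists 0; rewrite ?inE ?eqxx ?f0.
    by exists z1; rewrite ?inE ?eqxx ?orbT ?fz1.
  have [i hi ->] := ends u uM nu; have [j hj ->] := ends v vM nv.
  rewrite !inE in hi hj.
  have h01' : e (f 0) (f z1) = e' (f 0) (f z1) by rewrite hA' // h01 -hA.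
  by case/orP: hi => /eqP->; case/orP: hj => /eqP->; rewrite ?ei ?ei' // es es'.
have iZ' : ipath e' (ab.1 :: M) by rewrite -(eq_ipath eZ).
have midn' z i : mid z -> i < n -> 0 < i -> i != z1 -> nadj e' z (f i).
  by move=> hz h1 h2 h3; rewrite /nadj midrow //; apply: midn.
pose Z := if rv then rev (ab.1 :: M) else ab.1 :: M.
have iZr : ipath e' Z by rewrite /Z; case: (rv); rewrite ?ipath_rev.
have [MA eMA] : exists MA, Z = f za :: MA.
  rewrite /Z /za; case: (rv); last by exists M; rewrite f0.
  by rewrite fz1; case/lastP: (M) => [|M' m]; [exists [::] | exists (rev (ab.1 :: M')); rewrite -rcons_cons rev_rcons last_rcons].
have [MB eMB] : exists MB, Z = rcons MB (f zb).
  rewrite /Z /zb; case: (rv); first by exists (rev M); rewrite rev_cons f0.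
  by exists (belast ab.1 M); rewrite fz1 lastI.
have uZ : uniq Z := ipath_uniq ei' iZr.
have inZ z : z \in Z -> z \in ab.1 :: M by rewrite /Z; case: (rv); rewrite ?mem_rev.
have fab : (f za == ab.1) && (f zb == last ab.1 M) || (f zb == ab.1) && (f za == last ab.1 M).
  by rewrite /za /zb; case: (rv); rewrite -f0 -fz1 !eqxx ?orbT.
have midA z : z \in MA -> (z == f zb) && c || mid z.
  move=> zM; have zZ : z \in Z by rewrite eMA inE zM orbT.
  have zna : z != f za by move: uZ; rewrite eMA /= => /andP[h _]; apply: contraNneq h => <-.
  have hc : c.
    apply/negPn/negP => /cM eM; move: eMA zM; rewrite /Z eM.
    by case: (rv) => -[_ <-].
  rewrite hc andbT /mid inZ //=; move: fab zna.
  by case/orP => /andP[/eqP-> /eqP->]; case: (z == _); case: (z == _).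
have midB z : z \in MB -> (z == f za) && c || mid z.
  move=> zM; have zZ : z \in Z by rewrite eMB mem_rcons inE zM orbT.
  have znb : z != f zb.
    by move: uZ; rewrite eMB rcons_uniq => /andP[h _]; apply: contraNneq h => <-.
  have hc : c.
    apply/negPn/negP => /cM eM; move: eMB zM; rewrite /Z eM.
    by case: (rv); rewrite -[rcons MB _]cats1; case: (MB) => [|? []].
  rewrite hc andbT /mid inZ //=; move: fab znb.
  by case/orP => /andP[/eqP-> /eqP->]; case: (z == _); case: (z == _).
have okF1 : [&& F.1 < n, 0 < F.1 & F.1 != z1] by rewrite F1 lt0n eq_sym z0F1 eq_sym z1F1.
have okF2 : [&& F.2 < n, 0 < F.2 & F.2 != z1] by rewrite F2 lt0n eq_sym z0F2 eq_sym z1F2.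
have okpre i : i \in pre -> [&& i < n, 0 < i & i != z1] by move=> /hpre /and5P[-> _ _ -> ->].
have okpost i : i \in post -> [&& i < n, 0 < i & i != z1] by move=> /hpost /and5P[-> _ _ -> ->].
have hfF : fin ab s1 = (f F.1, f F.2) by rewrite hF.
(* Used twice: with the first frontier vertex in front, and with the second one behind. *)
have glue L1 L2 : all (fun i => [&& i < n, 0 < i & i != z1]) (L1 ++ L2) ->
    ipath A' (rcons L1 za) -> ipath A' (zb :: L2) -> anti A' L1 L2 ->
    (c ==> anti A' L1 [:: zb] && anti A' [:: za] L2) ->
    ipath e' (map f L1 ++ Z ++ map f L2).
  move=> ok i1 i2 a12 ac.
  have lt i : i \in L1 ++ L2 -> i < n by move=> /(allP ok) /and3P[].
  have lt1 i : i \in rcons L1 za -> i < n.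
    by rewrite mem_rcons inE => /orP[/eqP->//|h]; apply: lt; rewrite mem_cat h.
  have lt2 i : i \in zb :: L2 -> i < n.
    by rewrite inE => /orP[/eqP->//|h]; apply: lt; rewrite mem_cat h orbT.
  have J1 : ipath e' (rcons (map f L1) (f za)).
    rewrite -map_rcons (@ipath_map _ _ _ A') // => [i j hi hj|i j hi hj]; last by rewrite hA' ?lt1.
    by apply: fi; rewrite inE lt1.
  have J2 : ipath e' (f zb :: map f L2).
    rewrite -map_cons (@ipath_map _ _ _ A') // => [i j hi hj|i j hi hj]; last by rewrite hA' ?lt2.
    by apply: fi; rewrite inE lt2.
  have J12 : anti e' (map f L1) (map f L2).
    rewrite (@anti_map _ _ _ A') // => [i j hi hj|i j hi hj].
      by apply: fi; rewrite inE lt.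
    by rewrite hA' // lt // mem_cat ?hi ?hj ?orbT.
  have K1 : ipath e' (map f L1 ++ Z).
    rewrite eMA; apply: ipath_glue => //; first by rewrite -eMA.
    apply/antiP => _ z /mapP[i iL ->] /midA /orP[/andP[/eqP-> hc]|hz].
      rewrite hc implyTb in ac; have /andP[/antiP /(_ i zb iL (mem_head _ _)) + _] := ac.
      have hi : i < n by apply: lt; rewrite mem_cat iL.
      by rewrite /nadj hA' // (inj_in_eq fi).
    have /and3P[h1 h2 h3] := allP ok i ltac:(by rewrite mem_cat iL).
    by rewrite nadjC // midn'.
  move: K1; rewrite eMB -rcons_cat => K1; rewrite cat_rcons catA; apply: ipath_glue => //.
  rewrite /anti all_cat [all _ (map f L1)]J12 /=.
  apply/antiP => z _ + /mapP[i iL ->] => /midB /orP[/andP[/eqP-> hc]|hz].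
    rewrite hc implyTb in ac; have /andP[_ /antiP /(_ za i (mem_head _ _) iL)] := ac.
    have hi : i < n by apply: lt; rewrite mem_cat iL orbT.
    by rewrite /nadj hA' // (inj_in_eq fi).
  have /and3P[h1 h2 h3] := allP ok i ltac:(by rewrite mem_cat iL orbT).
  by rewrite midn'.
have hfr2 : fr e (fin ab s1) s2 by move: hfr; rewrite fr_cat => /and3P[].
exists e', (map f pre ++ Z ++ map f post); split.
- by apply: lequiv_lcs; apply: lequiv_refl.
- rewrite /ust; apply/and5P; split.
  + by rewrite eMA; case: (map f pre).
  + rewrite hfF; apply: (glue (F.1 :: pre) post) => //.
    * apply/allP => i; rewrite mem_cat inE => /orP[/orP[/eqP->//|/okpre //]|/okpost //].
    * by apply: ipath_catl (zb :: post) [:: F.2] _; rewrite cats1.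
    * apply/implyP => hc; rewrite hc implyTb in anc; case/andP: anc => -> /=.
      by rewrite /anti /= all_rcons => /andP[/andP[_ ->]].
  + rewrite hfF !rcons_cat -map_rcons; apply: glue => //.
    * apply/allP => i; rewrite mem_cat mem_rcons inE => /orP[/okpre //|/orP[/eqP->//|/okpost //]].
    * exact: ipath_catr [:: F.1] _ ip1.
    * apply/implyP => hc; rewrite hc implyTb in anc; case/andP: anc => /andP[_ h] ->.
      by rewrite andbT.
  + apply/antiP => z t; rewrite !mem_cat => hz ts.
    have idx i : i < n -> i != F.1 -> i != F.2 -> nadj e (f i) t.
      by move=> h1 h2 h3; have [_] := hD i h1 h2 h3; apply.
    rewrite nadjC // /nadj row2 // -/(nadj e t z) nadjC //.
    case/or3P: hz => [/mapP[i /hpre /and5P[h1 h2 h3 _ _] ->]|/inZ hz|/mapP[i /hpost /and5P[h1 h2 h3 _ _] ->]]; try exact: idx.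
    have [->|n0] := eqVneq z ab.1; first by rewrite -f0; apply: idx.
    have [->|nl] := eqVneq z (last ab.1 M); first by rewrite -fz1; apply: idx.
    by apply: (allP (iM z hz n0 nl)); rewrite map_cat mem_cat ts orbT.
  + by rewrite -(@eq_fr _ e) //; move=> z u zs _; rewrite row2.
- by rewrite hfF /= hA'.
- have sZ : size Z = (size M).+1 by rewrite /Z; case: (rv); rewrite ?size_rev.
  by rewrite !size_cat sZ; apply: leq_trans (leq_addl _ _); apply: leq_addr.
by rewrite fin_cat; case/orP: (fin_last (fin ab s1) s2n) => h; [|rewrite es' es]; rewrite row2.
Qed.

Definition recipe : Type := seq letter * seq nat * seq nat * bool * seq nat.

(* How to enlarge the path of a state with adjacent frontier, found by computer
   search. For a word of letters, an entry lists the vertices to complement at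
   and the pieces put before and after the (possibly reversed) path. The ends of
   the path are 0 and 1, the frontier is (2, 3), the new vertices are 4, 5, ... *)
Definition recipes : seq recipe :=
  let Q := None in let X := Some true in let Y := Some false in
  [:: ([:: Q; Q], [:: 2; 4; 5], [:: 3], true, [::]);
    ([:: X; X], [:: 4], [:: 2], false, [::]);
    ([:: Q; X; Q], [:: 2; 6; 4; 5], [::], false, [:: 3]);
    ([:: Q; X; Y], [:: 5; 4], [:: 3], true, [:: 2]);
    ([:: X; Q; Q], [:: 2; 5; 6; 4], [:: 3], true, [::]);
    ([:: X; Q; Y], [:: 4; 6], [:: 2], false, [:: 3]);
    ([:: X; Y; Q], [:: 4; 5], [:: 3], true, [:: 2]);
    ([:: Q; X; X; Q], [:: 2; 5; 7; 4], [::], false, [:: 3; 6]);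
    ([:: Q; X; X; Y], [:: 2; 3; 6; 5; 4], [::], false, [::]);
    ([:: X; Q; X; Q], [:: 4; 6; 7], [:: 3], true, [:: 2; 5]);
    ([:: X; Q; X; Y], [:: 5; 4; 6], [:: 3], true, [:: 2]);
    ([:: X; Y; X; Q], [:: 6; 4; 5], [:: 2], false, [:: 3]);
    ([:: X; Y; X; Y], [:: 2; 5; 4], [:: 3], true, [::]);
    ([:: X; Y; Y; Q], [:: 2; 3; 6; 4; 5], [::], false, [::]);
    ([:: X; Y; Y; X], [:: 2; 4; 5], [:: 3], true, [::]);
    ([:: Q; X; X; X; Q], [:: 2; 5; 8; 6; 4], [:: 3], true, [:: 7]);
    ([:: Q; X; X; X; Y], [:: 2; 4; 5; 7], [::], false, [:: 3; 6]);
    ([:: X; Q; X; X; Q], [:: 5; 4; 6; 8], [:: 2], false, [:: 3; 7]);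
    ([:: X; Q; X; X; Y], [:: 4; 3; 6; 7], [::], true, [:: 2; 5]);
    ([:: X; Y; X; X; Q], [:: 5; 7; 4], [:: 2], false, [:: 3; 6]);
    ([:: X; Y; X; X; Y], [:: 3; 6; 5; 4], [:: 2], false, [::]);
    ([:: X; Y; Y; Y; Q], [:: 3; 4; 5; 7], [:: 6; 2], false, [::]);
    ([:: X; Y; Y; Y; X], [:: 3; 6; 5; 4], [:: 2], false, [::]);
    ([:: X; Q; X; X; X; Q], [:: 4; 5; 6; 7; 9], [:: 2], false, [:: 3; 8]);
    ([:: X; Q; X; X; X; Y], [:: 5; 6; 8; 4], [:: 2], false, [:: 3; 7]);
    ([:: X; Y; X; X; X; Q], [:: 5; 8; 6; 4], [:: 3], true, [:: 2; 7]);
    ([:: X; Y; X; X; X; Y], [:: 4; 5; 7], [:: 2], false, [:: 3; 6])].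

(** Exchanging the sides reverses the order of the two steps of a quadrangle, so their numbers are
    swapped. *)
Fixpoint mirror_index n (w : seq letter) : seq nat :=
  match w with
  | [::] => [::]
  | Some _ :: w' => n :: mirror_index n.+1 w'
  | None :: w' => [:: n.+1, n & mirror_index n.+2 w']
  end.

(** Exchanging the sides of the ladder also reverses the path, so [pre] and [post] trade places. *)
Definition mirror (g : recipe) : recipe :=
  let: (w, l, pre, rv, post) := g in
  let m := map (nth 0 ([:: 1; 0; 3; 2] ++ mirror_index 4 w)) in
  (map (omap negb) w, m l, m (rev post), rv, m (rev pre)).

Definition all_recipes := recipes ++ map mirror recipes.

(* If the path has one vertex, its two ends coincide and are numbered 0. *)
Definition renum (c : bool) v := if c then v else if v == 3 then 1 else if v <= 2 then v else v.-1.

Definition recipe_ok c r (g : recipe) :=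
  let: (w, l, pre, rv, post) := g in
  let m := map (renum c) in rchk c r w (m l) (m pre) rv (m post).

(** The three cases are a path with two distinct ends, adjacent or not, and a path with a single
    vertex, which always sees the second frontier vertex. *)
Lemma recipesP : all (fun g => [&& recipe_ok true true g, recipe_ok true false g & recipe_ok false true g]) all_recipes.
Proof. by vm_compute. Qed.

Fixpoint words L : seq (seq letter) :=
  if L is L'.+1 then flatten [seq [seq a :: w | a <- [:: None; Some true; Some false]] | w <- words L']
  else [:: [::]].

Lemma mem_words w : w \in words (size w).
Proof.
elim: w => //= a w IH; apply/flattenP; exists [seq b :: w | b <- [:: None; Some true; Some false]].
  by apply: map_f.
by apply: map_f; case: a => [[]|].
Qed.

Lemma no4_catl w1 w2 : no4 (w1 ++ w2) -> no4 w1.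
Proof.
elim: w1 => // t w IH; rewrite cat_cons => /andP[h /IH nw]; apply/andP; split=> //.
case/orP: h => [->//|h]; apply/orP; right; apply: contra h => /eqP h.
rewrite -cat_cons takel_cat ?h //; move: (congr1 size h); rewrite size_nseq size_take.
by case: ltnP => [/ltnW //|_ ->].
Qed.

(** Seven letters are few enough to try all [3 ^ 7] words. *)
Lemma recipes_cover w : 7 <= size w -> no4 w ->
  exists2 g : recipe, g \in all_recipes & prefix g.1.1.1.1 w.
Proof.
move=> sw nw; set w7 := take 7 w.
have s7 : size w7 = 7 by rewrite size_takel.
have n7 : no4 w7 by move: nw; rewrite -(cat_take_drop 7 w); apply: no4_catl.
have : all (fun w => no4 w ==> has (fun g : recipe => prefix g.1.1.1.1 w) all_recipes) (words 7).
  by vm_compute.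
move=> /allP /(_ w7); rewrite -{1}s7 mem_words n7 => /(_ isT) /hasP[g gr pg].
by exists g => //; rewrite -(cat_take_drop 7 w); apply: prefix_catl.
Qed.

Notation fin_edge e xy s := (e (fin xy s).1 (fin xy s).2).

(** Through its closing edge the rest of the ladder is connected. It sees the two ends of [Z] and no
    inner vertex of it, so [CYC] applies. *)
Lemma ust_win (T : finType) (e : rel T) Z xy s n : simple_graph e -> 2 < n -> ust e Z xy s ->
  fin_edge e xy s -> (fan_bound n).+4 <= size Z -> vertex_minor (cycle_graph n) e.
Proof.
move=> sg n3 /and5P[_ i1 i2 /antiP aZ hfr] hc sZ; have [es ei] := sg.
case: Z i1 i2 aZ sZ => // a Z; case/lastP: Z => // p b i1 i2 aZ sZ.
have uZ1 := ipath_uniq ei i1; have uZ2 := ipath_uniq ei i2.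
apply: (@CYC _ e (mem (xy.1 :: xy.2 :: map snd s)) a p b n) => //.
- exact: ipath_catr [:: xy.1] _ i1.
- exact: fr_conn.
- move=> z zZ; rewrite /= !inE !negb_or; apply/and3P; split.
  + by move: uZ1; rewrite cons_uniq => /andP[h _]; apply: contraNneq h => <-.
  + by move: uZ2; rewrite rcons_uniq => /andP[h _]; apply: contraNneq h => <-.
  by apply/negP => zs; have /andP[] := aZ z z zZ zs; rewrite eqxx.
- move=> z d zp; have zZ : z \in a :: rcons p b by rewrite inE mem_rcons inE zp !orbT.
  rewrite /= !inE => /or3P[/eqP->|/eqP->|/(aZ z d zZ)/andP[] //].
    move: i1; rewrite ipath_cons2 => /and3P[_ /allP /(_ z) h _].
    by rewrite es; have /andP[] := h ltac:(by rewrite mem_rcons inE zp orbT).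
  move: i2; rewrite -[rcons _ xy.2]cats1 -rcons_cons ipath_cat => /and5P[_ _ _ /antiP h _].
  by have /andP[] := h z xy.2 ltac:(by rewrite inE zp orbT) (mem_head _ _).
- exists xy.1; first by rewrite /= inE eqxx.
  by rewrite es; move: i1; rewrite ipath_cons2 => /andP[].
- exists xy.2; first by rewrite /= !inE eqxx orbT.
  by move: i2; rewrite -[rcons _ xy.2]cats1 -rcons_cons ipath_cat => /and4P[_ _ ->].
by move: sZ; rewrite /= size_rcons; lia.
Qed.

(** If the frontier is adjacent, the dropped vertex alone is a path between the kept vertex and the
    new one. *)
Lemma ust_start (T : finType) (e : rel T) xy bv s : simple_graph e ->
  fr e xy (bv :: s) -> e xy.1 xy.2 -> ust e [:: drp xy bv.1] (step xy bv) s.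
Proof.
move=> [es ei] /= /andP[_ /and3P[edv nd hfr]] exy; rewrite /ust /= hfr /anti /= nd !andbT.
by case: bv edv {nd hfr} => [[] v] /=; rewrite ?[e v _]es => ->; rewrite ?exy // es exy.
Qed.

(** A dropped vertex that does not see the other frontier vertex prolongs the path at its own
    end. *)
Lemma ust_grow (T : finType) (e : rel T) Z xy bv s : simple_graph e ->
  ust e Z xy (bv :: s) -> ~~ e xy.1 xy.2 ->
  exists2 Z', ust e Z' (step xy bv) s & size Z' = (size Z).+1.
Proof.
move=> sg /and5P[Z0 i1 i2 aZ] + nxy; have [es ei] := sg.
case: bv aZ => b v aZ; have {aZ} /allP aZ : all (fun z => all (nadj e z) (v :: map snd s)) Z by [].
move=> /= /andP[xn /and3P[edv nd hfr]].
have nv z : z \in Z -> nadj e v z by move=> /aZ /= /andP[h _]; rewrite nadjC.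
have as_ : anti e Z (map snd s) by apply/allP => z /aZ /= /andP[].
case: b edv nd hfr => /= edv nd hfr.
  exists (xy.1 :: Z) => //; rewrite /ust hfr /anti /= nd -/(anti e Z _) as_ -/(ipath e (xy.1 :: Z)) i1 -/(ipath e (rcons Z xy.2)) i2 es edv.
  rewrite !andbT; apply/andP; split; first by apply/allP.
  case: Z i1 Z0 {i2 aZ nv as_} => // z Z /andP[/andP[exz h] _] _ /=.
  by rewrite exz all_rcons /nadj xn nxy h.
exists (rcons Z xy.2); last by rewrite size_rcons.
rewrite /ust hfr /anti all_rcons nd -/(anti e Z _) as_ !andbT; apply/and3P; split.
- by case: (Z).
- case: Z i1 i2 Z0 {aZ nv as_} => // z Z i1 i2 _.
  have /and3P[h1 h2 _] : [&& e xy.1 z, all (nadj e xy.1) Z & ipath e (z :: Z)] by rewrite -ipath_cons2.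
  have {}i2 : ipath e (z :: rcons Z xy.2) by [].
  rewrite -[_ :: rcons _ _]/[:: xy.1, z & rcons Z xy.2] ipath_cons2.
  by rewrite h1 i2 all_rcons h2 /nadj xn nxy.
rewrite -cats1 ipath_cat i2 edv andbT /=.
by apply/allP => z /nv h /=; rewrite nadjC // h.
Qed.

(** The path may shrink to one vertex here; it serves to reach a later part of the ladder in some
    state. *)
Lemma ust_advance (T : finType) (e : rel T) xy bv s : simple_graph e ->
  fr e xy (bv :: s) -> (exists Z, ust e Z xy (bv :: s)) -> exists Z, ust e Z (step xy bv) s.
Proof.
move=> sg hfr [Z uZ]; have [h|h] := boolP (e xy.1 xy.2).
  by exists [:: drp xy bv.1]; apply: ust_start.
by have [Z' h' _] := ust_grow sg uZ h; exists Z'.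
Qed.

Lemma ust_skip (T : finType) (e : rel T) xy s1 s2 : simple_graph e ->
  (exists Z, ust e Z xy (s1 ++ s2)) -> exists Z, ust e Z (fin xy s1) s2.
Proof.
move=> sg; elim: s1 xy => //= bv s1 IH xy hZ; apply: IH; apply: ust_advance => //.
by case: hZ => Z /and5P[].
Qed.

Lemma ust_chordless (T : finType) (e : rel T) Z xy s k : simple_graph e ->
  ust e Z xy s -> ~~ e xy.1 xy.2 -> k <= find (fun a => a.2) (pat e xy s) -> k <= size s ->
  exists2 Z', ust e Z' (fin xy (take k s)) (drop k s) & size Z + k <= size Z'.
Proof.
move=> sg; have [es _] := sg; elim: k Z xy s => [|k IH] Z xy s uZ nxy.
  by rewrite take0 drop0 addn0 => _ _; exists Z.
case: s uZ => // bv s uZ; rewrite [pat _ _ _]/= [find _ _]/=.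
case: ifP => // /negbT nb fk sk.
have [Z' uZ' sZ'] := ust_grow sg uZ nxy.
have [|Z'' u2 s2] := IH Z' _ _ uZ' _ fk sk; first by case: bv nb {uZ fk uZ' sk} => -[] v //=; rewrite es.
by exists Z'' => //; lia.
Qed.

Lemma ipath_run (T : finType) (e : rel T) b xy s : fr e xy s -> all (fun bv => bv.1 == b) s ->
  ipath e (drp xy b :: map snd s).
Proof.
elim: s xy => // -[b' v] s IH xy; rewrite [fr _ _ _]/= => /andP[_ /and3P[edv nd hfr]].
move=> /= /andP[/eqP eb hs]; subst b'.
have := IH _ hfr hs; rewrite edv nd.
by case: (b).
Qed.

(** All steps of the run keep the same frontier vertex, which is the hub of a fan over the new
    vertices. *)
Lemma run_cycle (T : finType) (e : rel T) xy s b n F r : simple_graph e -> 2 < n ->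
  fr e xy s -> pat e xy s = nseq F.+1 (b, true) ++ r -> (fan_bound n).+2 <= F ->
  vertex_minor (cycle_graph n) e.
Proof.
move=> sg n3 hfr hp sF; have [es ei] := sg.
have sk : F.+1 <= size s by rewrite -(size_pat e xy) hp size_cat size_nseq leq_addr.
set s1 := take F.+1 s; have ss1 : size s1 = F.+1 by rewrite size_takel.
have hfr1 : fr e xy s1 by move: hfr; rewrite -(cat_take_drop F.+1 s) fr_cat => /and3P[].
have hp1 : pat e xy s1 = nseq F.+1 (b, true).
  have := congr1 (take F.+1) hp; rewrite -[s in LHS](cat_take_drop F.+1 s) pat_cat.
  by rewrite !take_size_cat ?size_pat ?size_nseq.
have hb : all (fun bv => bv.1 == b) s1.
  have : all (pred1 b) (unzip1 (pat e xy s1)).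
    by rewrite hp1 /unzip1 map_nseq all_nseq /= eqxx.
  by rewrite unzip1_pat all_map.
have ip := ipath_run hfr1 hb.
set y := drp xy (~~ b).
have yadj v : v \in map snd s1 -> e y v.
  move: {hfr1 ss1 ip} hb hp1; rewrite -/(unzip2 _) => hb hp1.
  have : all (fun a => a.2) (pat e xy s1) by rewrite hp1 all_nseq orbT.
  rewrite /y; elim: (s1) xy hb {hp1 hp hfr y} => // -[b' w] s' IH xy /= /andP[/eqP-> hb] /andP[h1 h2].
  rewrite inE => /orP[/eqP->//|vs]; have := IH _ hb h2 vs.
  by case: (b).
apply: (@FAN _ e y (map snd s1)) => //.
- rewrite /fan (ipath_catr (p := [:: _]) ip) /=.
  by apply/negP => /yadj; rewrite ei.
- by rewrite size_map ss1; lia.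
- by apply: yadj; case: (s1) ss1 => //= a ? _; rewrite mem_head.
- by apply: yadj; case: (s1) ss1 => //= a ? _; apply: mem_last.
Qed.

Lemma ust_recipe (T : finType) (e : rel T) Z xy s1 s2 (g : recipe) : simple_graph e ->
  ust e Z xy (s1 ++ s2) -> e xy.1 xy.2 -> g \in all_recipes -> pat e xy s1 = raws g.1.1.1.1 ->
  s2 != [::] ->
  exists e' Z', [/\ lequiv e e', ust e' Z' (fin xy s1) s2, ~~ e' (fin xy s1).1 (fin xy s1).2,
    size Z <= size Z' & fin_edge e' xy (s1 ++ s2) = fin_edge e xy (s1 ++ s2)].
Proof.
move=> sg + exy gr hp s2n; have [es ei] := sg.
have := allP recipesP g gr; case: g hp {gr} => [[[[w l] pre] rv] post] /= hp /and3P[g1 g2 g3].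
case: xy exy hp => x y /= exy hp /and5P[Z0 i1 i2 /antiP aZ hfr].
have uZ1 := ipath_uniq ei i1; have uZ2 := ipath_uniq ei i2.
case: Z Z0 i1 i2 aZ uZ1 uZ2 => // z M _ i1 i2 aZ uZ1 uZ2.
have ezx : e z x by move: i1; rewrite ipath_cons2 /= es => /andP[].
have iZ : ipath e (z :: M) by apply: ipath_catr [:: x] _ i1.
have az : all (nadj e z) (map snd (s1 ++ s2)) by apply/allP => v; apply: aZ; rewrite mem_head.
case/lastP: M i1 i2 aZ uZ1 uZ2 iZ => [|M zc] i1 i2 aZ uZ1 uZ2 iZ.
  have ezy : e z y by move: i2; rewrite /= !andbT.
  (* A path with one vertex [z]: a step that replaces [z] by [x] and keeps [y], with the chord
     [x y]. *)
  have hfr' : fr e (z, y) (((true, x) :: s1) ++ s2).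
    rewrite /= ezx az hfr !andbT; by move: uZ2; rewrite /= inE andbT.
  apply: (rchk_step sg hfr' (c := false) _ _ iZ _ _ _ s2n) => //.
  - by rewrite /= es exy hp.
  - by rewrite /= ezy; apply: g3.
  - by move=> t; rewrite inE => ->.
have ezcy : e zc y.
  by move: i2; rewrite -[rcons _ y]cats1 -rcons_cons ipath_cat => /and4P[_ _ ->].
have hzc : forall v, v \in x :: map snd (s1 ++ s2) -> nadj e zc v.
  move=> v; rewrite inE => /orP[/eqP->|]; last by apply: aZ; rewrite inE mem_rcons mem_head orbT.
  move: i1; rewrite ipath_cons2 all_rcons => /and3P[_ /andP[h _] _]; by rewrite nadjC.
have hz : nadj e z y.
  move: i2; rewrite -[rcons _ y]cats1 -rcons_cons ipath_cat => /and5P[_ _ _ /antiP h _].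
  by apply: h; rewrite mem_head.
have uz : z != zc.
  by have := ipath_uniq ei iZ; rewrite cons_uniq mem_rcons inE negb_or => /andP[/andP[]].
(* Two steps replace the ends [z] and [zc] by [x] and [y]; the first has no chord, the second has
   the chord [x y]. *)
have hfr' : fr e (z, zc) ([:: (true, x), (false, y) & s1] ++ s2).
  rewrite /= uz ezx hz az ezcy hfr /=.
  have /andP[nx _] : nadj e zc x by apply: hzc; rewrite mem_head.
  rewrite eq_sym nx ?andbT /= ?andbT.
  by apply/allP => v vs; apply: hzc; rewrite inE vs orbT.
have ein : e zc x = false by apply/negbTE; have /andP[] := hzc x (mem_head _ _).
have [e' [Z' hh]] : exists e' Z', [/\ lequiv e e', ust e' Z' (fin (z, zc) [:: (true, x), (false, y) & s1]) s2,
   ~~ e' (fin (z, zc) [:: (true, x), (false, y) & s1]).1 (fin (z, zc) [:: (true, x), (false, y) & s1]).2,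
   (size (rcons M zc)).+1 <= size Z' &
   fin_edge e' (z, zc) ([:: (true, x), (false, y) & s1] ++ s2) = fin_edge e (z, zc) ([:: (true, x), (false, y) & s1] ++ s2)].
  apply: (rchk_step sg hfr' (c := true) _ _ iZ _ _ _ s2n) => //.
  - by rewrite /= ein exy hp.
  - by rewrite /=; case: (e z zc); [apply: g1|apply: g2].
  - by rewrite last_rcons.
  move=> t tZ tz; rewrite last_rcons => tzc; apply/allP => v.
  rewrite inE => /orP[/eqP->|]; last rewrite inE => /orP[/eqP->|]; last exact: aZ.
  - move: i1; rewrite ipath_cons2 => /and3P[_ /allP /(_ t) h _]; rewrite nadjC // h //.
    by move: tZ; rewrite inE (negbTE tz).
  - move: i2; rewrite -[rcons _ y]cats1 -rcons_cons ipath_cat => /and5P[_ _ _ /antiP h _].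
    by apply: h; rewrite ?mem_head //; move: tZ; rewrite !inE mem_rcons inE (negbTE tzc).
by exists e', Z'.
Qed.

(** [Z] sees no step vertex, so [lred_row] fixes all its rows. *)
Lemma ust_lred (T : finType) (e e' : rel T) Z xy s s' : simple_graph e ->
  ust e Z xy s -> lred e xy s e' s' -> ust e' Z xy s'.
Proof.
move=> sg /and5P[Z0 i1 i2 /antiP aZ hfr] [q1 q2 q3 q4 q5 q6 q7]; have [es ei] := sg.
have [es' ei'] := lequiv_sg q1 sg.
have uZ1 := ipath_uniq ei i1; have uZ2 := ipath_uniq ei i2.
have row z t : z \in Z -> e' z t = e z t.
  move=> zZ; apply: q6 => [|v vs]; last by have /andP[] := aZ z v zZ vs; rewrite es.
  rewrite !inE !negb_or; apply/and3P; split.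
  - by move: uZ1; rewrite cons_uniq => /andP[h _]; apply: contraNneq h => <-.
  - by move: uZ2; rewrite rcons_uniq => /andP[h _]; apply: contraNneq h => <-.
  by apply/negP => zs; have /andP[] := aZ z z zZ zs; rewrite eqxx.
have ext x : ipath e (x :: Z) -> ipath e' (x :: Z).
  rewrite (eq_ipath (e' := e')) // => u v; rewrite !inE => /orP[/eqP->|uZ]; last by rewrite row.
  by move=> /orP[/eqP->|vZ]; rewrite ?ei ?ei' // es es' row.
rewrite /ust Z0 q2 ext //= andbT; apply/andP; split.
  rewrite -(eq_ipath (e := e)) // => u v; rewrite !mem_rcons !inE => /orP[/eqP->|uZ]; last by rewrite row.
  by move=> /orP[/eqP->|vZ]; rewrite ?ei ?ei' // es es' row.
by apply/antiP => u v uZ /q3 vs; rewrite /nadj row //; apply: aZ.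
Qed.

Lemma pat_split (T : eqType) (e : rel T) xy s p r : pat e xy s = p ++ r ->
  exists s1 s2, [/\ s = s1 ++ s2, pat e xy s1 = p & pat e (fin xy s1) s2 = r].
Proof.
move=> h; exists (take (size p) s), (drop (size p) s); rewrite cat_take_drop.
have sp : size p <= size s by rewrite -(size_pat e xy) h size_cat leq_addr.
move: h; rewrite -{1}(cat_take_drop (size p) s) pat_cat => /eqP.
by rewrite eqseq_cat ?size_pat ?size_takel // => /andP[/eqP-> /eqP->].
Qed.

Lemma won_cycle (T : finType) (e : rel T) Z xy s n B F : simple_graph e -> 2 < n ->
  (fan_bound n).+4 <= B -> (fan_bound n).+2 <= F ->
  ust e Z xy s -> fin_edge e xy s -> won B.+1 F.+1 (pat e xy s) -> vertex_minor (cycle_graph n) e.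
Proof.
move=> sg n3 hB hF uZ hc [w [r [/pat_split [s2 [s3 [es1 hp2 hp3]]] hw]]]; have [es ei] := sg.
have hfr : fr e xy s by case/and5P: uZ.
have sz3 : size s3 = size r by rewrite -hp3 size_pat.
have hfr3 : fr e (fin xy s2) s3 by move: hfr; rewrite es1 fr_cat => /and3P[].
case: hw => [[hf hs]|[b [r' er]]]; last first.
  by apply: (run_cycle sg n3 hfr3 (b := b) (r := r') (F := F)); rewrite ?hp3.
have uZ3 : exists Z', ust e Z' (fin xy s2) s3.
  by apply: ust_skip => //; exists Z; rewrite -es1.
rewrite es1 fin_cat in hc.
case: s3 hfr3 uZ3 hp3 sz3 hc {es1} => [|bv s3] hfr3 uZ3 hp3 sz3 hc; first by rewrite -sz3 in hs.
(* One chordless step is spent on making the frontier nonadjacent, whence [B.+1]; the next [B] steps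
   all lengthen the path. *)
have [Z' uZ'] := ust_advance sg hfr3 uZ3.
move: hf hs; rewrite -sz3 -hp3 [pat _ _ _]/= [find _ _]/=; case: ifP => // /negbT nb hf hs.
have [||Z'' u2 s2'] := @ust_chordless _ _ _ _ _ B sg uZ' _ hf.
- by case: bv nb {uZ' hf hs hfr3 uZ3 hp3 sz3 hc} => -[] v //=; rewrite es.
- by move: hs; rewrite [size (_ :: _)]/= ltnS; apply: ltnW.
apply: (ust_win sg n3 u2); last by apply: leq_trans hB _; apply: leq_trans s2'; apply: leq_addl.
by rewrite -fin_cat cat_take_drop.
Qed.

(** With a nonadjacent frontier, one step lengthens the path. Otherwise a recipe for the normal form
    of the ladder does not shorten the path and makes the frontier nonadjacent, and then one more
    step lengthens it. *)
Lemma ust_round n R : 2 < n -> exists N, forall (T : finType) (e : rel T) Z xy s, simple_graph e ->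
  ust e Z xy s -> fin_edge e xy s -> N <= size s ->
  vertex_minor (cycle_graph n) e \/ exists e' Z' xy' s',
    [/\ lequiv e e', ust e' Z' xy' s', fin_edge e' xy' s', size Z < size Z' & R <= size s'].
Proof.
move=> n3; have [N hN] := parse_first (fan_bound n).+4.+1 (fan_bound n).+2 7.
exists (N + R.+1) => T e Z xy s sg uZ hc sN; have [es ei] := sg.
have [exy|nxy] := boolP (e xy.1 xy.2); last first.
  case: s uZ hc sN => [|bv s] uZ hc; rewrite [size _]/= => sN; first by rewrite addnS in sN.
  have [Z' uZ' sZ'] := ust_grow sg uZ nxy.
  right; exists e, Z', (step xy bv), s; split=> //; first exact: lequiv_refl.
    by rewrite sZ'.
  by move: sN; rewrite addnS ltnS; apply: leq_trans; apply: leq_addl.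
have [|p' [hp' hw]] := hN (pat e xy s); first by rewrite size_pat; apply: leq_trans sN; apply: leq_addr.
have hfr : fr e xy s by case/and5P: uZ.
have [e1 [s1 [lr ep']]] := prew_sound hp' sg hfr erefl.
have le1 := lred_eq lr; have sg1 := lequiv_sg le1 sg.
have uZ1 := ust_lred sg uZ lr.
have exy1 : e1 xy.1 xy.2 by rewrite (lred_xy lr).
have hc1 : fin_edge e1 xy s1 by rewrite (lred_fin lr) (lred_closed lr).
have hfr1 := lred_fr lr.
case: hw => [hw|[w [r [eqp sw nw sr]]]].
  left; apply: (vm_lequiv le1); apply: (won_cycle sg1 n3 (leqnn _) (leqnn _) uZ1 hc1).
  by rewrite ep'.
have [g gr /prefixP[w' ew]] := recipes_cover sw nw.
rewrite eqp ew /raws map_cat flatten_cat -catA in ep'.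
have [s2 [s3 [es1 hp2 hp3]]] := pat_split ep'.
have sz3 : size r <= size s3 by rewrite -(size_pat e1 (fin xy s2)) hp3 size_cat leq_addl.
rewrite size_pat in sr.
rewrite es1 in uZ1 hc1.
case: s3 uZ1 hc1 sz3 {es1 hp3} => [|bv s3] uZ1 hc1 sz3; rewrite /= in sz3; first by move: sz3 sr sN; clear; lia.
have [e2 [Z2 [le2 u2 nr sZ2 hc2]]] := ust_recipe sg1 uZ1 exy1 gr hp2 isT.
have sg2 := lequiv_sg le2 sg1.
have [Z3 u3 sZ3] := ust_grow sg2 u2 nr.
right; exists e2, Z3, (step (fin xy s2) bv), s3; split=> //.
- exact: lequiv_trans le1 le2.
- by move: hc2; rewrite hc1 fin_cat => ->.
- by rewrite sZ3 ltnS.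
- by rewrite -ltnS; apply: leq_trans sz3; rewrite -(leq_add2r N); apply: leq_trans sr; rewrite addnC.
Qed.

Lemma ust_long n m R : 2 < n -> exists N, forall (T : finType) (e : rel T) Z xy s, simple_graph e ->
  ust e Z xy s -> fin_edge e xy s -> N <= size s ->
  vertex_minor (cycle_graph n) e \/ exists e' Z' xy' s',
    [/\ lequiv e e', ust e' Z' xy' s', fin_edge e' xy' s', m <= size Z' & R <= size s'].
Proof.
move=> n3; elim: m R => [|m IH] R.
  by exists R => T e Z xy s sg uZ hc sR; right; exists e, Z, xy, s; split=> //; apply: lequiv_refl.
have [N1 h1] := @ust_round n R n3; have [N2 h2] := IH N1; exists N2 => T e Z xy s sg uZ hc sN.
have [|[e1 [Z1 [xy1 [s1 [le1 u1 c1 m1 r1]]]]]] := h2 _ _ _ _ _ sg uZ hc sN; first by left.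
have [vm|[e2 [Z2 [xy2 [s2 [le2 u2 c2 m2 r2]]]]]] := h1 _ _ _ _ _ (lequiv_sg le1 sg) u1 c1 r1.
  by left; apply: vm_lequiv le1 vm.
right; exists e2, Z2, xy2, s2; split=> //; first exact: lequiv_trans le1 le2.
exact: leq_ltn_trans m1 m2.
Qed.

Lemma ladder_cycle n : 2 < n -> exists N, forall (T : finType) (e : rel T) xy s, simple_graph e ->
  fr e xy s -> e xy.1 xy.2 -> fin_edge e xy s -> N <= size s -> vertex_minor (cycle_graph n) e.
Proof.
move=> n3; have [N hN] := @ust_long n (fan_bound n).+4 0 n3; exists N.+1 => T e xy [//|bv s] sg hfr exy hc sN.
have [//|[e' [Z' [xy' [s' [le u c sZ _]]]]]] := hN _ _ _ _ _ sg (ust_start sg hfr exy) hc sN.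
by apply: (vm_lequiv le); apply: ust_win u c sZ => //; apply: lequiv_sg le sg.
Qed.

(** * Long induced paths in prime graphs *)

(** All edges between [A] and [r :: R] join [A0] to [r], so the two lists form a split of the graph
    they induce. Primality forces vertices outside both to break it. *)
Record cut (T : finType) (e : rel T) (A A0 : seq T) a0 r (R : seq T) : Prop := Cut {
  cut_a0 : a0 \in A0;
  cut_sub : {subset A0 <= A};
  cut_dis : forall v, v \in A -> v \notin r :: R;
  cut_e : forall v w, v \in A -> w \in r :: R -> e v w = (v \in A0) && (w == r) }.

(* The neighbourhood of [u] in [A] is neither empty nor [A0]. *)
Definition ant (T : finType) (e : rel T) (A A0 : seq T) a0 u :=
  ~~ all (fun v => e u v == e u a0 && (v \in A0)) A.

(** If [u] joins the side of [A] and [w] the side of [R], the cut keeps rank one only if [e u w]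
    equals [e w a0 && e u r]. A link is a violation of this equation. *)
Definition lnk (T : finType) (e : rel T) a0 r : rel T :=
  fun u w => e u w (+) (e w a0 && e u r).

(** Otherwise [A] together with all outside vertices reachable by links from the vertices satisfying
    [ant] would be one side of a split. *)
Lemma chain_exists (T : finType) (e : rel T) A A0 a0 a1 r R : simple_graph e -> prime_graph e ->
  cut e A A0 a0 r R -> a1 \in A -> a1 != a0 -> R != [::] -> uniq (r :: R) ->
  exists u c, [/\ uniq (u :: c), path (lnk e a0 r) u c, ant e A A0 a0 u, has (e (last u c)) R &
    all (fun v => (v \notin A) && (v \notin r :: R)) (u :: c)].
Proof.
move=> [es ei] pr [a0A A0A dis he] a1A a10 R0 uR.
pose out v := (v \notin A) && (v \notin r :: R).
pose lk u w := [&& out u, out w & lnk e a0 r u w].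
pose rch w := [exists u, [&& out u, ant e A A0 a0 u & connect lk u w]].
have outr w : rch w -> out w.
  move=> /existsP[u /and3P[ou _ /connectP[p pp ->]]].
  case/lastP: p pp => // p v; rewrite last_rcons -cats1 cat_path => /andP[_].
  by rewrite /= andbT => /and3P[].
have [/existsP[w /andP[rw hw]]|none] := boolP [exists w, rch w && has (e w) R].
  case/existsP: rw => u /and3P[ou au /connectP[p pp ew]]; move: hw; rewrite ew.
  case/shortenP: pp => q pq uq _ hw; exists u, q; split=> //.
    by apply: sub_path pq => x y /and3P[].
  rewrite /= -/(out u) ou /=; elim: q u pq {uq hw ou au ew} => //= v q IH u.
  by move=> /andP[/and3P[_ ov _] /IH ->]; rewrite andbT.
case: (pr [set v | (v \in A) || rch v]).
have rR w v : rch w -> v \in R -> e w v = false.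
  move=> rw vR; apply/negbTE/negP => ewv; case/negP: none; apply/existsP; exists w.
  by rewrite rw; apply/hasP; exists v.
(* A reachable vertex is represented by its edge to [r], and an outside vertex on the other side by
   its edge to [a0]. *)
apply/is_splitP; split; last exists (fun v => if v \in A then v \in A0 else e v r),
  (fun w => if w \in r :: R then w == r else e w a0).
- rewrite -(_ : #|[set a0; a1]| = 2); last by rewrite cards2 eq_sym a10.
  by apply/subset_leq_card/subsetP => v; rewrite !inE => /orP[] /eqP->; rewrite ?a1A // A0A.
- have [r2 [R' eR]] : exists r2 R', R = r2 :: R' by case: (R) R0 => // r2 R' _; exists r2, R'.
  rewrite -(_ : #|[set r; r2]| = 2); last first.
    by move: uR; rewrite eR cards2 cons_uniq inE negb_or => /andP[/andP[->]].
  apply/subset_leq_card/subsetP => v; rewrite !inE => hv.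
  have vR : v \in r :: R by rewrite eR !inE; case/orP: hv => ->; rewrite ?orbT.
  rewrite negb_or; apply/andP; split; first by apply: contraL vR => /dis.
  by apply: contraL vR => /outr /andP[].
move=> x y; rewrite !in_set => hx /norP[yA yr].
case: (boolP (x \in A)) hx => [xA _|xA /= rx].
  have [yR|yR] := boolP (y \in r :: R); first by rewrite he.
  have [ay|] := boolP (ant e A A0 a0 y).
    case/negP: yr; apply/existsP; exists y; rewrite /out yA yR ay; exact: connect0.
  by rewrite negbK => /allP /(_ x xA) /eqP; rewrite es andbC => ->.
have [yR|yR] := boolP (y \in r :: R).
  move: yR; rewrite inE; have [->|_] := eqVneq y r; first by rewrite andbT.
  by move=> /= yR; rewrite rR // andbF.
have : ~~ lnk e a0 r x y.
  apply: contraNN yr => l; case/existsP: (rx) => u /and3P[ou au cu]; apply/existsP; exists u.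
  rewrite ou au; apply: connect_trans cu (connect1 _).
  by rewrite /lk outr // /out yA yR.
by rewrite /lnk; case: (e x y); case: (e y a0); case: (e x r).
Qed.

Definition chain2 (T : finType) (e : rel T) A A0 a0 r R := exists u,
  [/\ u \notin A, u \notin r :: R, ant e A A0 a0 u &
    has (e u) R \/ (~~ has (e u) R /\ exists u2, [/\ u2 \notin A, u2 \notin r :: R,
      ~~ ant e A A0 a0 u2, has (e u2) R & lnk e a0 r u u2])].

(** After all possible shortcuts, the second vertex [u2] of a long chain sees nothing in [R], and in
    [A] either nothing or just [A0]. Complementing at [u2] creates the link from [u] to [u3], so
    [u2] can be skipped. The exception is a [u2] that sees both [A0] and [r]: then the edges between
    these disappear and [u2] becomes the first vertex of the tail. Edges inside [A] change only
    within [A0]. *)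
Lemma chain_short (T : finType) A A0 a0 k : forall (e : rel T) r R u c, simple_graph e ->
  cut e A A0 a0 r R -> ipath e (r :: R) ->
  uniq (u :: c) -> path (lnk e a0 r) u c -> ant e A A0 a0 u -> has (e (last u c)) R ->
  all (fun v => (v \notin A) && (v \notin r :: R)) (u :: c) -> size c <= k ->
  exists e' r' R', [/\ lequiv e e', cut e' A A0 a0 r' R', ipath e' (r' :: R'), size R <= size R' &
    (forall v w, v \in A -> w \in A -> ~~ ((v \in A0) && (w \in A0)) -> e' v w = e v w) /\
    chain2 e' A A0 a0 r' R'].
Proof.
elim: k => [|k IH] e r R u c sg ct ip uq pq au hl out sk; have [es ei] := sg.
  case: c uq pq hl out sk => // _ _ hl out _; exists e, r, R; split=> //; first exact: lequiv_refl.
  by split=> //; exists u; move: out; rewrite /= andbT => /andP[-> ->]; split=> //; left.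
have [hu|nu] := boolP (has (e u) R).
  apply: (IH e r R u [::]) => //=; move: out => /andP[-> _] //.
case: c uq pq hl out sk => [|u2 c] uq pq hl out sk; first by rewrite hl in nu.
have uq' : uniq (u2 :: c) by case/andP: uq.
have /andP[l12 pq'] : lnk e a0 r u u2 && path (lnk e a0 r) u2 c by [].
have /andP[ou out'] := out; have /andP[ou2 _] := out'.
have [au2|nau2] := boolP (ant e A A0 a0 u2); first by apply: (IH e r R u2 c).
have [hu2|nu2] := boolP (has (e u2) R).
  exists e, r, R; split=> //; first exact: lequiv_refl.
  split=> //; exists u; case/andP: ou => ? ?; split=> //; right; split=> //.
  by case/andP: ou2 => ? ?; exists u2.
case: c uq pq hl out sk uq' pq' out' => [|u3 c] uq pq hl out sk uq' pq' out'; first by rewrite hl in nu2.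
have /andP[l23 pq3] : lnk e a0 r u2 u3 && path (lnk e a0 r) u3 c by [].
have /andP[ou3 out3] : ((u3 \notin A) && (u3 \notin r :: R)) && all (fun v => (v \notin A) && (v \notin r :: R)) c.
  by case/andP: out'.
have uq3 : uniq (u3 :: c) by case/andP: uq'.
have un3 : uniq [:: u, u3 & c].
  by move: uq; rewrite /= !inE !negb_or => /andP[/and3P[_ -> ->] /andP[_ ->]].
have out13 : all (fun v => (v \notin A) && (v \notin r :: R)) [:: u, u3 & c] by rewrite /= ou ou3.
have [l13|nl13] := boolP (lnk e a0 r u u3).
  by apply: (IH e r R u (u3 :: c)) => //=; rewrite l13.
have [/hasP[x xc l2x]|/hasPn nl2] := boolP (has (lnk e a0 r u2) c).
  case/splitPr: xc uq pq3 hl out3 sk => c1 c2 uq pq3 hl out3 sk.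
  apply: (IH e r R u [:: u2, x & c2]) => //.
  - apply: subseq_uniq uq; apply: (@cat_subseq _ [:: u; u2] (x :: c2) [:: u; u2]) => //.
    exact: (suffix_subseq (u3 :: c1)).
  - by rewrite /= l12 l2x; move: pq3; rewrite cat_path => /andP[_ /andP[_]].
  - by move: hl; rewrite /= last_cat.
  - by rewrite /= ou ou2; move: out3; rewrite all_cat => /andP[_].
  - by move: sk; rewrite /= size_cat /=; clear; lia.
have [a0A A0A dis he] := ct.
have a0' := A0A _ a0A.
have u2n v : v \in A -> v != u2 by move=> vA; apply: contraTneq vA => ->; case/andP: ou2.
have e2A v : v \in A -> e u2 v = e u2 a0 && (v \in A0).
  by move=> vA; move: nau2; rewrite negbK => /allP /(_ v vA) /eqP.
have e2R w : w \in R -> e u2 w = false.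
  by move=> wR; apply/negbTE; move/hasPn: nu2; apply.
pose e' := local_compl e u2; have sg' : simple_graph e' := lc_sg u2 sg.
have e'E x y : e' x y = e x y (+) [&& x != y, e u2 x & e u2 y] by rewrite /e' lcE.
have lq : lequiv e e' by apply: lequiv_lc; apply: lequiv_refl.
have e'A v w : v \in A -> w \in A -> ~~ ((v \in A0) && (w \in A0)) -> e' v w = e v w.
  move=> vA wA h; rewrite e'E (e2A v vA) (e2A w wA); move: h.
  by case: (v \in A0); case: (w \in A0) => // _; rewrite ?andbF addbF.
have e'R : {in r :: R &, e =2 e'}.
  move=> v w; rewrite !inE e'E => /orP[/eqP->|vR]; last by rewrite (e2R v) //= andbF addbF.
  by move=> /orP[/eqP->|wR]; rewrite ?eqxx ?addbF // (e2R w) ?andbF ?addbF.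
have ip' : ipath e' (r :: R) by rewrite -(eq_ipath e'R).
have e'O x v : x \notin A -> v \in A -> e' x v = e x v (+) (e u2 x && (e u2 a0 && (v \in A0))).
  move=> xA vA; have xv : x != v by apply: contraNneq xA => ->.
  by rewrite e'E (e2A v vA) xv.
have ant' x : x \notin A -> ant e' A A0 a0 x = ant e A A0 a0 x.
  move=> xA; congr (~~ _); apply: eq_in_all => v vA; rewrite !e'O // a0A andbT.
  by case: (e x v); case: (e x a0); case: (e u2 x); case: (e u2 a0); case: (v \in A0).
have ru2 : r != u2 by case/andP: ou2 => _; rewrite inE negb_or eq_sym => /andP[].
(* In the first case [u2] replaces [r], and the link from [u] to [u2] means that [u] now sees the
   old [r]: a chain of one vertex. *)
have [t11|t] := boolP (e u2 a0 && e u2 r).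
  have /andP[t1 t2] := t11.
  exists e', u2, (r :: R); split=> //.
  - split=> // v; first by move=> vA; rewrite inE negb_or u2n // dis.
    move=> w vA; rewrite inE e'E (e2A v vA) t1 /=; have [->|wn] := eqVneq w u2.
      by rewrite ei !andbF addbF es (e2A v vA) t1 andbT.
    move=> /= wR; have vw : v != w by apply: contraNneq (dis v vA) => ->.
    rewrite vw andbF he //; move: wR; rewrite inE; have [->|_ /= wR] := eqVneq w r; first by rewrite t2 andbT addbb.
    by rewrite e2R // !andbF.
  - rewrite ipath_cons2 ip' /e' !lc_nbr // t2 /= andbT.
    apply/allP => w wR; rewrite /nadj lc_nbr // e2R // andbT.
    by case/andP: ou2 => _; apply: contraNneq => ->; rewrite inE wR orbT.
  split=> //; exists u; have [uA uR] := andP ou.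
  have uu2 : u != u2 by move: uq; rewrite /= inE negb_or => /andP[/andP[]].
  rewrite uA ant' // au inE negb_or uu2 uR; split=> //; left => /=; apply/orP; left.
  have ur : u != r by apply: contraNneq uR => ->; rewrite inE eqxx.
  rewrite e'E t2 ur es; move: l12; rewrite /lnk t1 (es u u2) (es r u) andbT /=.
  by case: (e u2 u); case: (e u r).
have ct' : cut e' A A0 a0 r R.
  split=> // v w vA wR; have vw : v != w by apply: contraNneq (dis v vA) => ->.
  rewrite e'E (e2A v vA) vw he //=.
  move: wR; rewrite inE; have [->|_ /= wR] := eqVneq w r.
    by rewrite andbT; move: t; case: (e u2 a0); case: (e u2 r) => //= _; rewrite ?andbF ?addbF ?andbT.
  by rewrite (e2R w wR); case: (e u2 a0); case: (v \in A0).
(* Links change under the complementation at [u2] in the same way as edges do. *)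
have lnk' x y : x \notin A -> y \notin A -> x \notin r :: R -> x != y ->
    lnk e' a0 r x y = lnk e a0 r x y (+) (lnk e a0 r x u2 && lnk e a0 r u2 y).
  move=> xA yA xR xy; rewrite /lnk (e'O y a0 yA a0') a0A !e'E xy.
  have xr : x != r by apply: contraNneq xR => ->; rewrite inE eqxx.
  rewrite xr; move: t; rewrite (es x u2); case: (e u2 a0); case: (e u2 r) => //=;
  by case: (e x y); case: (e x r); case: (e y a0); case: (e u2 x); case: (e u2 y).
(* [u2] has no link to the vertices after [u3], so the links along the rest of the chain survive. *)
have path' x q : uniq (x :: q) -> path (lnk e a0 r) x q -> {subset q <= c} -> x \notin A -> x \notin r :: R -> path (lnk e' a0 r) x q.
  elim: q x => //= y q IHq x /andP[xq uyq] /andP[lxy pyq] sq xA xR.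
  have yc : y \in c by apply: sq; rewrite mem_head.
  have /andP[yA yR] := allP out3 y yc.
  rewrite IHq //; last by move=> z zq; apply: sq; rewrite inE zq orbT.
  rewrite lnk' // ?lxy ?(negbTE (nl2 y yc)) ?andbF //.
  by move: xq; rewrite inE negb_or => /andP[].
have [e2 [r2 [R2 [h1 h2 h3 h4 [h5 h6]]]]] : exists e2 r' R', [/\ lequiv e' e2, cut e2 A A0 a0 r' R', ipath e2 (r' :: R'), size R <= size R' &
    (forall v w, v \in A -> w \in A -> ~~ ((v \in A0) && (w \in A0)) -> e2 v w = e' v w) /\
    chain2 e2 A A0 a0 r' R'].
  apply: (IH e' r R u (u3 :: c)) => //.
  - have [uA uR] := andP ou; have [u3A u3R] := andP ou3.
    rewrite /= path' // andbT lnk' // ?(negbTE nl13) ?l12 ?l23 //.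
    by move: un3; rewrite /= inE negb_or => /andP[/andP[]].
  - by rewrite ant' //; case/andP: ou.
  case/hasP: hl => w wR ew; apply/hasP; exists w; rewrite // e'E (e2R w) // !andbF addbF.
  exact: ew.
exists e2, r2, R2; split=> //; first exact: lequiv_trans lq h1.
by split=> // v w vA wA h; rewrite h5 // e'A.
Qed.

(** * Ladders along an induced path *)

(** A ladder does not depend on the edge between its two frontier vertices, which the shortening of
    a chain may toggle. *)
Lemma lad_toggle (T : finType) (e e' : rel T) x0 y0 x y D : symmetric e -> symmetric e' ->
  lad e x0 y0 x y D ->
  (forall z t, z \in D -> t \in x :: y :: D -> e z t = e' z t) -> lad e' x0 y0 x y D.
Proof.
move=> es es'; elim=> [xy _|x1 y1 D1 _ IH h|x1 y1 D1 v _ IH ev vy nv h]; first exact: lad0.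
  by apply: ladC; apply: IH => z t hz ht; apply: h => //; move: ht; rewrite !inE; blia.
apply: ladS => //.
- by apply: IH => z t hz ht; apply: h; move: hz ht; rewrite !inE; blia.
- by rewrite -h // !inE eqxx ?orbT.
apply/allP => z zD; have := allP nv z zD; rewrite /nadj es es' -h // !inE ?eqxx ?zD ?orbT //.
Qed.

(** The frontier vertex at the end of the path moves back along it to [u]; only that end may see
    dropped vertices. *)
Lemma lad_back (T : finType) (e : rel T) x0 y0 q u g D : simple_graph e ->
  ipath e (u :: q) -> lad e x0 y0 (last u q) g D -> all (fun z => ~~ has (e z) D) (belast u q) ->
  (forall z, z \in u :: q -> (z != g) && (z \notin D)) ->
  exists2 D', lad e x0 y0 u g D' & {subset D' <= D ++ q}.
Proof.
move=> [es ei]; elim: q u => [|v q IH] u.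
  by move=> _ ld _ _; exists D => // z zD; rewrite mem_cat zD.
rewrite ipath_cons2 [belast _ _]/= => /and3P[euv nq ip] ld /andP[nu nb] hD.
have [|D1 l1 s1] := IH v ip ld nb; first by move=> z zq; apply: hD; rewrite inE zq orbT.
have /andP[ug uD] := hD u (mem_head _ _).
exists (v :: D1); last first.
  move=> z; rewrite inE => /orP[/eqP->|/s1]; rewrite !mem_cat ?mem_head ?orbT //.
  by rewrite inE => /orP[->|->]; rewrite ?orbT.
apply: ladS => //; first by rewrite es.
apply/allP => z /s1; rewrite mem_cat => /orP[zD|zq]; last exact: (allP nq).
by rewrite /nadj (hasPn nu z zD) andbT; apply: contraNneq uD => ->.
Qed.

(** From a neighbour of [u] on [P], descend towards [p0], which belongs to the ladder, until a
    vertex sees [D]. [lad_attach] puts this vertex into a frontier, and [lad_back] leads from there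
    to [u]. *)
Lemma attach (T : finType) (e : rel T) p0 p1 P0 b D u (a := last p1 P0) (P := [:: p0, p1 & P0]) :
  simple_graph e -> lad e p0 p1 a b D -> ipath e P -> b \notin P -> u \notin P ++ b :: D ->
  has (e u) (D ++ belast p0 (p1 :: P0)) ->
  exists g D', [/\ lad e p0 p1 u g D', g \in [:: a; b] &
    forall z, z \in D' -> (z \in P ++ b :: D) && (z \notin [:: a; b])].
Proof.
move=> sg ld ip bP uA hu; have [es ei] := sg.
have eP : P = rcons (belast p0 (p1 :: P0)) a by rewrite /P lastI.
have [n0 p0P] : nth p0 P 0 = p0 /\ p0 \in P by rewrite mem_head.
have uP : uniq P by apply: ipath_uniq ei ip.
clearbody P a.
have aP : a \in P by rewrite eP mem_rcons mem_head.
(* The search may use [u] and the vertices of [P] outside the ladder. *)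
pose Dm z := ((z \in P) && (z \notin [:: a, b & D])) || (z == u).
have [uP' ubD] : u \notin P /\ u \notin b :: D by move: uA; rewrite mem_cat negb_or => /andP[].
have un : u \notin [:: a, b & D] by rewrite inE negb_or ubD andbT; apply: contraNneq uP' => ->.
have [z cz qz] : exists2 z, connect (rel_on e Dm) u z & has (e z) D.
  have [hD|nD] := boolP (has (e u) D); first by exists u; rewrite ?connect0.
  have back i : i < size (belast p0 (p1 :: P0)) -> nth p0 P i \notin D ->
      exists2 z, connect (rel_on e Dm) (nth p0 P i) z & has (e z) D.
    have out i' : i' < size (belast p0 (p1 :: P0)) -> nth p0 P i' \notin D -> Dm (nth p0 P i').
      move=> hi nDi; have iP : nth p0 P i' \in P by rewrite mem_nth // eP size_rcons ltnW.
      rewrite /Dm iP !inE !negb_or nDi andbT /=; apply/orP; left; apply/andP; split.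
        rewrite eP nth_rcons hi; move: uP; rewrite eP rcons_uniq => /andP[h _].
        by apply: contraNneq h => <-; apply: mem_nth.
      by apply: contraNneq bP => <-.
    elim: i => [|i IH] hi nDi.
      have [h0 _] := lad_base ld; have := out 0 hi nDi.
      by rewrite /Dm n0 h0 andbF /= => /eqP e0; move: uP'; rewrite -e0 p0P.
    have ii : e (nth p0 P i) (nth p0 P i.+1).
      by rewrite (ipath_nth p0 ip) ?eqxx // leqnn /= eP size_rcons ltnW.
    have [iD|niD] := boolP (nth p0 P i \in D).
      by exists (nth p0 P i.+1); rewrite ?connect0 //; apply/hasP; exists (nth p0 P i); rewrite // es.
    have [z cz qz] := IH (ltnW hi) niD; exists z => //; apply: connect_trans cz; apply: connect1.
    by rewrite /rel_on (out _ hi nDi) (out _ (ltnW hi) niD) es ii.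
  move: hu; rewrite has_cat (negbTE nD) orFb => /hasP[p pB eup].
  have pD : p \notin D by apply: contra nD => pD; apply/hasP; exists p.
  have ip' : index p (belast p0 (p1 :: P0)) < size (belast p0 (p1 :: P0)) by rewrite index_mem.
  have pn : nth p0 P (index p (belast p0 (p1 :: P0))) = p by rewrite eP nth_rcons ip' nth_index.
  have [|z cz qz] := back _ ip'; first by rewrite pn.
  rewrite pn in cz; exists z => //; apply: connect_trans cz; apply: connect1.
  rewrite /rel_on eup andbT /Dm eqxx orbT /=; apply/orP; left.
  have pP : p \in P by rewrite eP mem_rcons inE pB orbT.
  rewrite pP !inE !negb_or pD andbT /=; apply/andP; split.
    by move: uP; rewrite eP rcons_uniq => /andP[h _]; apply: contraNneq h => <-.
  by apply: contraNneq bP => <-.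
have [q [iq Dq lq bq]] := connect_ipath (Q := fun z => has (e z) D) cz qz.
have Dq' t : t \in u :: q -> t \notin [:: a, b & D].
  by rewrite inE => /orP[/eqP->//|/(allP Dq) /orP[/andP[]|/eqP->]].
have [g [D' [l1 s1 g1 /andP[a1 b1]]]] := lad_attach sg ld (Dq' _ (mem_last _ _)) lq.
have [|t tq|D2 l2 s2] := lad_back sg iq l1.
- apply: sub_all bq => t /= h; apply: contra h => /hasP[v /s1 vD etv]; by apply/hasP; exists v.
- have := Dq' t tq; rewrite !inE !negb_or => /and3P[ta tb tD]; apply/andP; split.
    by move: g1; rewrite !inE => /orP[] /eqP->.
  by apply: contra tD => /s1.
exists g, D2; split=> // t /s2; rewrite mem_cat => /orP[tD'|tq].
  rewrite mem_cat inE (s1 t tD') !orbT !inE negb_or /=; apply/andP; split.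
    by apply: contraNneq a1 => <-.
  by apply: contraNneq b1 => <-.
have uq := ipath_uniq ei iq; have tu : t != u by apply: contraTneq uq => <-; rewrite /= tq.
have := allP Dq t tq; rewrite /Dm (negbTE tu) orbF => /andP[tP].
by rewrite mem_cat tP !inE !negb_or => /and3P[-> ->].
Qed.

Definition tail_free (T : finType) (e : rel T) (R D : seq T) :=
  forall z, z \in D -> (z \notin R) && ~~ has (e z) R.

(** [r], and [u2] if the chain has two vertices, are added to the ladder. Whether [r] replaces [g]
    or [u], and in which order the steps come, is dictated by the edges from [u2] to [a0] and from
    [u] to [r]. *)
Lemma finish (T : finType) (e : rel T) A A0 a0 r R p0 p1 u g D : simple_graph e ->
  cut e A A0 a0 r R -> uniq (r :: R) -> lad e p0 p1 u g D -> g \in A0 ->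
  (forall z, z \in D -> (z \in A) && (z \notin A0)) ->
  u \notin A -> u \notin r :: R ->
  has (e u) R \/ (~~ has (e u) R /\ exists u2, [/\ u2 \notin A, u2 \notin r :: R,
      ~~ ant e A A0 a0 u2, has (e u2) R & lnk e a0 r u u2]) ->
  exists w D2, [/\ lad e p0 p1 w r D2, has (e w) R, w \notin A, w \notin r :: R & tail_free e R D2].
Proof.
move=> sg [a0A A0A dis he] uR ld gA hD uA ur hc; have [es ei] := sg.
have rn v : v \in A -> r != v by move=> vA; apply: contraNneq (dis v vA) => <-; rewrite mem_head.
have er v : v \in A -> e r v = (v \in A0) by move=> vA; rewrite es he ?mem_head // eqxx andbT.
have gA' := A0A g gA.
have fA z : z \in A -> (z \notin R) && ~~ has (e z) R.
  move=> zA; have := dis z zA; rewrite inE negb_or => /andP[_ ->] /=.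
  apply/hasPn => w wR; rewrite he // ?inE ?wR ?orbT //.
  have [ew|] := eqVneq w r; last by rewrite andbF.
  by move: uR; rewrite /= -ew wR.
have nD v : v \notin A -> (forall z, z \in A -> z \notin A0 -> ~~ e v z) -> all (nadj e v) D.
  move=> vA h; apply/allP => z /hD /andP[zA zn]; rewrite /nadj h // andbT.
  by apply: contraNneq vA => ->.
have rA : r \notin A by apply/negP => /dis; rewrite mem_head.
have rD : all (nadj e r) D by apply: nD => // z zA zn; rewrite er.
have ru : r != u by apply: contraNneq ur => <-; rewrite mem_head.
have egr : e g r by rewrite es er.
have ug : u != g by apply: contraNneq uA => ->.
have fD : tail_free e R D by move=> z /hD /andP[/fA].
have cons_free z D' : (z \notin R) && ~~ has (e z) R -> tail_free e R D' -> tail_free e R (z :: D').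
  by move=> hz hD' t; rewrite inE => /orP[/eqP->|/hD'].
have lur : lad e p0 p1 u r (g :: D) by apply: ladC; apply: ladS => //; apply: ladC.
case: hc => [hu|[nu [u2 [u2A u2r na h2 l12]]]].
  by exists u, (g :: D); split=> //; apply: (@cons_free) => //; apply: fA.
have uR' : (u \notin R) && ~~ has (e u) R by rewrite nu andbT; move: ur; rewrite inE negb_or => /andP[].
have u2n : u2 != r by apply: contraNneq u2r => ->; rewrite mem_head.
have e2 v : v \in A -> e u2 v = e u2 a0 && (v \in A0).
  by move=> vA; move: na; rewrite negbK => /allP /(_ v vA) /eqP.
have u2u : u2 != u by apply: contraNneq nu => <-.
have u2g : u2 != g by apply: contraNneq u2A => ->.
have u2D : all (nadj e u2) D by apply: nD => // z zA zn; rewrite e2 // (negbTE zn) andbF.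
exists u2; have [a2|na2] := boolP (e u2 a0); last first.
  exists [:: u, g & D]; split=> //; last by apply: (@cons_free) => //; apply: (@cons_free) => //; apply: fA.
  apply: ladS => //; first by move: l12; rewrite /lnk (negbTE na2) addbF.
  by rewrite /= u2D /nadj u2g e2 // (negbTE na2).
have eg2 : e g u2 by rewrite es e2 // a2 gA.
exists [:: g, u & D]; split=> //; last by apply: (@cons_free) => //; [apply: fA | apply: (@cons_free)].
have [b1|nb1] := boolP (e u r).
  have n12 : ~~ e u u2 by move: l12; rewrite /lnk a2 b1; case: (e u u2).
  apply: ladS => //; first by apply: ladC; apply: ladS => //; apply: rn.
  by rewrite /= u2D /nadj u2u es n12.
have e12 : e u u2 by move: l12; rewrite /lnk (negbTE nb1) andbF addbF.
apply: ladC; apply: ladS => //; first by apply: ladC; apply: ladS.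
- by rewrite eq_sym.
- by rewrite /= rD /nadj ru es nb1.
Qed.

(** Here [u] sees only the frontier vertex [f] in [A]. In general [r] replaces [h] and [u] replaces
    [f]. If a second chain vertex sees all of [A0], a complementation at [u] separates the cases; it
    can delete the edge [f r], which may belong to the path, and the last alternative then offers
    the detour through [u]. *)
Lemma finish_single (T : finType) (e : rel T) A A0 a0 r R p0 p1 u f h D : simple_graph e ->
  cut e A A0 a0 r R -> uniq (r :: R) -> lad e p0 p1 f h D -> f \in A0 -> h \in A0 ->
  (forall z, z \in A0 -> (z == f) || (z == h)) ->
  (forall z, z \in D -> z \in A) -> {in A, forall z, e u z = (z == f)} ->
  u \notin A -> u \notin r :: R ->
  has (e u) R \/ (~~ has (e u) R /\ exists u2, [/\ u2 \notin A, u2 \notin r :: R,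
      ~~ ant e A A0 a0 u2, has (e u2) R & lnk e a0 r u u2]) ->
  exists e' w D2, [/\ lequiv e e' , e' = e \/ e' = local_compl e u /\ ~~ has (e u) R,
    [/\ lad e' p0 p1 w r D2, has (e' w) R, w \notin A, w \notin r :: R & tail_free e' R D2] &
    (e' f r \/ [/\ e' u r, ~~ e' f r & w != u])].
Proof.
move=> sg [a0A A0A dis he] uR ld fA0 hA0 A0fh hD euA uA ur hc; have [es ei] := sg.
have rn v : v \in A -> r != v by move=> vA; apply: contraNneq (dis v vA) => <-; rewrite mem_head.
have er v : v \in A -> e r v = (v \in A0) by move=> vA; rewrite es he ?mem_head // eqxx andbT.
have [fA hA] := (A0A f fA0, A0A h hA0).
have fR z : z \in A -> (z \notin R) && ~~ has (e z) R.
  move=> zA; have := dis z zA; rewrite inE negb_or => /andP[_ ->] /=.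
  apply/hasPn => w wR; rewrite he // ?inE ?wR ?orbT //.
  have [ew|] := eqVneq w r; last by rewrite andbF.
  by move: uR; rewrite /= -ew wR.
have := lad_out ei ld; rewrite /= !inE negb_or => /and3P[/andP[fh fD] hnD _].
have DA0 z : z \in D -> z \notin A0.
  by move=> zD; apply/negP => /A0fh /orP[] /eqP ez; move: fD hnD; rewrite -ez zD.
have nD v : v \notin A -> (forall z, z \in A -> z \notin A0 -> ~~ e v z) -> all (nadj e v) D.
  move=> vA hh; apply/allP => z zD; rewrite /nadj hh ?hD ?DA0 // andbT.
  by apply: contraNneq vA => ->; apply: hD.
have rA : r \notin A by apply/negP => /dis; rewrite mem_head.
have rD : all (nadj e r) D by apply: nD => // z zA zn; rewrite er.
have ru : r != u by apply: contraNneq ur => <-; rewrite mem_head.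
have ef : e f r by rewrite es er.
have eh : e h r by rewrite es er.
have uh : u != h by apply: contraNneq uA => ->.
have uf : u != f by apply: contraNneq uA => ->.
have euf : e u f by rewrite euA.
have neuh : ~~ e u h by rewrite euA // eq_sym.
have uD : all (nadj e u) D.
  apply: nD => // z zA zn; rewrite euA //; by apply: contraNneq zn => ->.
have fD' : tail_free e R D by move=> z /hD /fR.
have cons_free e1 z D' : (z \notin R) && ~~ has (e1 z) R -> tail_free e1 R D' -> tail_free e1 R (z :: D').
  by move=> hz hD' t; rewrite inE => /orP[/eqP->|/hD'].
have l1 : lad e p0 p1 u r [:: f, h & D].
  apply: ladS; rewrite 1?es // 1?eq_sym //; last by rewrite /= uD /nadj uh neuh.
  by apply: ladC; apply: ladS => //; [apply: ladC | rewrite rn].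
have free1 : tail_free e R [:: f, h & D] by apply: (cons_free _ _ _ (fR _ fA)); apply: (cons_free _ _ _ (fR _ hA)).
case: hc => [hu|[nu [u2 [u2A u2r na h2 l12]]]].
  by exists e, u, [:: f, h & D]; split; [apply: lequiv_refl | left | | left].
have uR' : (u \notin R) && ~~ has (e u) R by rewrite nu andbT; move: ur; rewrite inE negb_or => /andP[].
have u2n : u2 != r by apply: contraNneq u2r => ->; rewrite mem_head.
have e2 v : v \in A -> e u2 v = e u2 a0 && (v \in A0).
  by move=> vA; move: na; rewrite negbK => /allP /(_ v vA) /eqP.
have u2u : u2 != u by apply: contraNneq nu => <-.
have u2f : u2 != f by apply: contraNneq u2A => ->.
have u2h : u2 != h by apply: contraNneq u2A => ->.
have u2D : all (nadj e u2) D by apply: nD => // z zA zn; rewrite e2 // (negbTE zn) andbF.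
have [a2|na2] := boolP (e u2 a0); last first.
  exists e, u2, [:: u, f, h & D]; split; [exact: lequiv_refl | by left | split=> // | by left].
    apply: ladS => //; first by move: l12; rewrite /lnk (negbTE na2) addbF.
    by rewrite /= u2D /nadj u2f u2h (e2 f fA) (e2 h hA) (negbTE na2).
  exact: cons_free.
pose e' := local_compl e u; have sg' : simple_graph e' := lc_sg u sg; have [es' ei'] := sg'.
have e'E x y : e' x y = e x y (+) [&& x != y, e u x & e u y] by rewrite /e' lcE.
have lq : lequiv e e' by apply: lequiv_lc; apply: lequiv_refl.
have rowA z t : z \in A -> z != f -> e' z t = e z t.
  by move=> zA zf; rewrite e'E euA // (negbTE zf) andbF addbF.
have e'R z x : x \in R -> e' z x = e z x.
  by move=> xR; rewrite e'E (negbTE (hasPn nu x xR)) !andbF addbF.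
have ld' : lad e' p0 p1 f h D.
  apply: lad_sub ld _ => z t hz ht; have inA s : s \in [:: f, h & D] -> s \in A.
    by rewrite !inE => /or3P[/eqP->|/eqP->|/hD].
  have [ez|zf] := eqVneq z f; last by rewrite rowA // inA.
  have [et|tf] := eqVneq t f; last by rewrite es' es rowA // inA.
  by rewrite ez et ei ei'.
have free2 : tail_free e' R [:: h, f & D].
  have fe z : (z \notin R) && ~~ has (e z) R -> (z \notin R) && ~~ has (e' z) R.
    by case/andP=> -> h'; rewrite -(eq_in_has (a1 := e z)) // => x xR; rewrite e'R.
  by apply: (cons_free _ _ _ (fe _ (fR _ hA))); apply: (cons_free _ _ _ (fe _ (fR _ fA))) => z zD; apply: fe; apply: fR; apply: hD.
have h2' : has (e' u2) R by rewrite -(eq_in_has (a1 := e u2)) // => x xR; rewrite e'R.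
have hf : h != f by rewrite eq_sym.
have all' v : all (nadj e v) D -> all (nadj e' v) D.
  move=> /allP hh; apply/allP => z zD; have := hh z zD; rewrite /nadj es es' rowA ?hD //.
  by apply: contraNneq fD => <-.
have eh' : e' h r by rewrite rowA.
have eh2 : e' h u2 by rewrite rowA // es e2 // a2.
exists e', u2, [:: h, f & D]; split=> //; first by right.
  split=> //; have [b1|nb1] := boolP (e u r).
    have n12 : ~~ e u u2 by move: l12; rewrite /lnk a2 b1; case: (e u u2).
    have ef2 : e' f u2 by rewrite e'E (negbTE n12) !andbF addbF es e2 // a2.
    have nef : ~~ e' r f by rewrite es' e'E ef euf b1 eq_sym rn.
    apply: ladC; apply: ladS => //; first by apply: ladC; apply: ladS => //; apply: all'.
      by rewrite eq_sym.
    by rewrite /= all' // andbT /nadj rn.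
  have e12 : e u u2 by move: l12; rewrite /lnk (negbTE nb1) andbF addbF.
  have ef' : e' f r by rewrite e'E (negbTE nb1) !andbF addbF.
  have nef2 : ~~ e' u2 f by rewrite e'E u2f e12 euf e2 // a2 fA0.
  apply: ladS => //; first by apply: ladC; apply: ladS => //; [rewrite rn | apply: all'].
  by rewrite /= all' // andbT /nadj u2f.
have [b1|nb1] := boolP (e u r); last by left; rewrite e'E (negbTE nb1) !andbF addbF.
right; split=> //; first by rewrite /e' lc_nbr.
by rewrite e'E ef euf b1 eq_sym rn.
Qed.

(** * Following the path to its end *)

(** The invariant of the exploration: of the explored part and its ladder, only the frontier
    vertices [last p1 P0] and [b] see the rest of the path, and they see just [r]. *)
Record stage (T : finType) (e : rel T) p0 p1 (P0 : seq T) r (R : seq T) b D : Prop := Stage {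
  st_lad : lad e p0 p1 (last p1 P0) b D;
  st_path : ipath e ((p0 :: p1 :: P0) ++ r :: R);
  st_b : b \notin p0 :: p1 :: P0;
  st_cut : cut e ((p0 :: p1 :: P0) ++ b :: D) [:: last p1 P0; b] (last p1 P0) r R }.

Lemma lad_walk (T : finType) (e : rel T) p0 p1 w q r D : simple_graph e ->
  lad e p0 p1 w r D -> ipath e (r :: q) -> w \notin q -> tail_free e q D ->
  exists2 D', lad e p0 p1 w (last r q) D' & {subset D' <= D ++ belast r q}.
Proof.
move=> [es ei]; elim: q r D => [|r2 q IH] r D ld; first by move=> _ _ _; exists D; rewrite ?cats0.
move=> ipr; move: (ipr); rewrite ipath_cons2 => /and3P[err nq ip] wq fD.
have [||||D' l' s'] := IH r2 (r :: D) => //.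
- apply: ladC; apply: ladS; rewrite ?ladC //; first exact: ladC.
    by apply: contraNneq wq => <-; rewrite mem_head.
  apply/allP => z zD; have /andP[h1 h2] := fD z zD; rewrite nadjC // /nadj.
  move: h1 h2; rewrite inE negb_or => /andP[-> _] /=; by rewrite negb_or => /andP[].
- by move: wq; rewrite inE negb_or => /andP[].
- move=> z; rewrite inE => /orP[/eqP->|zD].
    have := ipath_uniq ei ipr; rewrite cons_uniq inE negb_or => /andP[/andP[_ ->] _] /=.
    by apply/hasPn => x /(allP nq) /andP[].
  have /andP[] := fD z zD; rewrite inE negb_or /= negb_or => /andP[_ ->] /andP[_ ->] //.
exists D' => // z /s'; rewrite [belast r _]/= !mem_cat !inE.
by case/orP=> [/orP[->|->]|->]; rewrite ?orbT.
Qed.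

(** The last neighbour [r'] of [w] on the tail becomes the new first unexplored vertex: beyond it
    nothing is seen by [w], and the other frontier vertex is walked along the path up to the
    predecessor of [r']. *)
Lemma assemble (T : finType) (e : rel T) p0 p1 PP r R w D2 : simple_graph e ->
  ipath e ((p0 :: p1 :: PP) ++ r :: R) -> lad e p0 p1 w r D2 -> has (e w) R ->
  w \notin p0 :: p1 :: PP -> w \notin r :: R -> tail_free e R D2 ->
  exists P' r' R' b D, [/\ stage e p0 p1 P' r' R' b D, size PP < size P' &
    size P' + size R' = size PP + size R].
Proof.
move=> sg ip ld /split_last [q [r' [R' [eR wr' nw]]]] wP wR fD; have [es ei] := sg; subst R.
have ip2 : ipath e (r :: q ++ r' :: R') by apply: ipath_catr _ _ ip.
have ipq : ipath e (r :: q) by apply: ipath_catl _ (r' :: R') _; rewrite cat_cons.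
have wq : w \notin q by move: wR; rewrite inE mem_cat !negb_or => /and3P[].
have fq : tail_free e q D2.
  move=> z zD; have /andP[] := fD z zD; rewrite mem_cat has_cat !negb_or => /andP[-> _] /andP[-> _] //.
have [D3 l3 s3] := lad_walk sg ld ipq wq fq.
exists (PP ++ r :: q), r', R', w, D3.
have eP : (p0 :: p1 :: PP ++ r :: q) = rcons ((p0 :: p1 :: PP) ++ belast r q) (last r q).
  by rewrite -cats1 -catA cats1 -lastI.
have lst : last p1 (PP ++ r :: q) = last r q by rewrite last_cat.
have ipn : ipath e ((p0 :: p1 :: PP ++ r :: q) ++ r' :: R').
  by move: ip; rewrite -[(r :: q ++ _)]/((r :: q) ++ r' :: R') catA.
have wP' : w \notin p0 :: p1 :: PP ++ r :: q.
  rewrite -!cat_cons mem_cat negb_or wP /=.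
  by move: wR; rewrite !inE mem_cat !negb_or => /and3P[-> ->].
have uP := ipath_uniq ei ipn.
have l3' := ladC l3.
split; [split=> //; rewrite ?lst // | by rewrite size_cat /= addnS ltnS leq_addr |].
  have := ipn; rewrite {1}eP ipath_cat => /and5P[_ ir' elr /antiP an /allP na].
  have u3 := lad_out ei l3.
  split; first by rewrite mem_head.
  - move=> z hz; rewrite mem_cat; move: hz; rewrite inE => /orP[/eqP->|].
      by rewrite eP mem_rcons mem_head.
    by rewrite inE => /eqP->; rewrite mem_head orbT.
  - move=> v; rewrite mem_cat => /orP[vP|].
      by move: uP; rewrite cat_uniq => /and3P[_ /hasPn h _]; apply: contraL vP => /h.
    rewrite inE => /orP[/eqP->|/s3].
      by move: wR; rewrite inE mem_cat !negb_or => /and3P[].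
    rewrite mem_cat => /orP[vD|vB].
      have /andP[] := fD v vD; by rewrite mem_cat negb_or => /andP[].
    have : v \in p0 :: p1 :: PP ++ r :: q by rewrite eP mem_rcons inE mem_cat vB !orbT.
    by move: uP; rewrite cat_uniq => /and3P[_ /hasPn h _]; apply: contraL => /h.
  have nlw : last r q != w.
    by apply: contraNneq wP' => <-; rewrite eP mem_rcons mem_head.
  have eR' v : ~~ has (e v) R' -> forall x, x \in R' -> e v x = false.
    by move=> /hasPn h x /h /negbTE.
  have rR' : r' \notin R' by move: ir' => /(ipath_uniq ei) /andP[].
  have fin' v x : x \in r' :: R' -> e v r' -> ~~ has (e v) R' -> e v x = (x == r').
    rewrite inE => /orP[/eqP->|xR] evr nv; first by rewrite eqxx.
    by rewrite (eR' v nv x xR); apply/esym/negbTE; apply: contraNneq rR' => <-.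
  have zer v x : x \in r' :: R' -> v != last r q -> v != w -> ~~ e v r' -> ~~ has (e v) R' ->
      e v x = (v \in [:: last r q; w]) && (x == r').
    move=> hx n1 n2 n3 n4; rewrite !inE (negbTE n1) (negbTE n2) /=; apply/negbTE.
    by move: hx; rewrite inE => /orP[/eqP->//|xR]; rewrite eR'.
  move=> v x hv hx; have [ev|nvl] := eqVneq v (last r q).
    rewrite ev mem_head /=; apply: fin' => //; by apply/hasPn => y /na /andP[].
  have [ev|nvw] := eqVneq v w; first by rewrite ev !inE eqxx orbT; apply: fin'.
  have [hn1 hn2] : ~~ e v r' /\ ~~ has (e v) R'; last exact: zer.
  have dB : v \in belast r q \/ v \in p0 :: p1 :: PP -> ~~ e v r' /\ ~~ has (e v) R'.
    move=> hB; have vB : v \in (p0 :: p1 :: PP) ++ belast r q by rewrite mem_cat; case: hB => ->; rewrite ?orbT.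
    split; first by have /andP[] := an v r' vB (mem_head _ _).
    by apply/hasPn => y yR; have /andP[] : nadj e v y by apply: an; rewrite // inE yR orbT.
  move: hv; rewrite mem_cat [v \in w :: _]in_cons (negbTE nvw) orFb => /orP[|/s3].
    by rewrite eP mem_rcons in_cons (negbTE nvl) orFb mem_cat => /orP[h|h]; apply: dB; [right | left].
  rewrite mem_cat => /orP[vD|h]; last by apply: dB; left.
  have /andP[_] := fD v vD; rewrite has_cat /= !negb_or => /andP[_ /andP[-> ->]] //.
rewrite !size_cat /=; lia.
Qed.

(** If [u] sees a vertex of [A] other than [a] and [b], it is attached to the ladder there.
    Otherwise [ant] forces it to see exactly one of the two, which is the case of
    [finish_single]. *)
Lemma stage_step (T : finType) (e : rel T) p0 p1 P0 r R b D : simple_graph e -> prime_graph e ->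
  stage e p0 p1 P0 r R b D -> R != [::] ->
  exists e' P' r' R' b' D', [/\ lequiv e e', stage e' p0 p1 P' r' R' b' D', size P0 < size P' &
    size P0 + size R <= size P' + size R'].
Proof.
move=> sg pr [ld ip bP ct] R0; have [es ei] := sg.
set a := last p1 P0 in ld ct; set P := p0 :: p1 :: P0 in ip bP ct.
have eP : P = rcons (belast p0 (p1 :: P0)) a by rewrite /P lastI.
have uRR : uniq (r :: R) by apply: ipath_uniq ei (ipath_catr ip).
have ab : b != a by have := lad_neq ld; rewrite eq_sym.
have uld := lad_out ei ld.
have bA : b \in P ++ b :: D by rewrite mem_cat mem_head orbT.
have [u [c [uq pq au hl out]]] := chain_exists sg pr ct bA ab R0 uRR.
have [e1 [r1 [R1 [le1 ct1 ip1 sR1 [hA ch]]]]] := chain_short sg ct (ipath_catr ip) uq pq au hl out (leqnn _).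
have sg1 := lequiv_sg le1 sg; have [es1 ei1] := sg1.
have uRR1 : uniq (r1 :: R1) by apply: ipath_uniq ei1 ip1.
have DA z : z \in D -> z \in P ++ b :: D by move=> zD; rewrite mem_cat [z \in b :: D]in_cons zD !orbT.
have aA : a \in P ++ b :: D by rewrite mem_cat eP mem_rcons mem_head.
have DA0 z : z \in D -> z \notin [:: a; b].
  move=> zD; apply/negP; rewrite !inE => /orP[] /eqP ez; move: uld; rewrite -ez /= !inE zD ?orbT //.
  by rewrite andbF.
have ld1 : lad e1 p0 p1 a b D.
  apply: lad_toggle ld _ => // z t zD tD; apply/esym/hA; rewrite ?(negbTE (DA0 z zD)) //.
    exact: DA.
  by move: tD; rewrite inE => /orP[/eqP->//|]; rewrite inE => /orP[/eqP->//|/DA].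
have [a0A A0A dis he] := ct1.
have BA z : z \in belast p0 (p1 :: P0) -> z \in P by move=> zB; rewrite eP mem_rcons inE zB orbT.
have uP : uniq P by apply: ipath_uniq ei (ipath_catl ip).
have BA0 z : z \in belast p0 (p1 :: P0) -> z \notin [:: a; b].
  move=> zB; rewrite !inE negb_or; apply/andP; split.
    by move: uP; rewrite eP rcons_uniq => /andP[h _]; apply: contraNneq h => <-.
  by apply: contraNneq bP => <-; apply: BA.
have PA z : z \in P -> z \in P ++ b :: D by move=> zP; rewrite mem_cat zP.
have ipP1 : ipath e1 P.
  rewrite -(@eq_ipath _ e) ?(ipath_catl ip) // => z t zP tP.
  have [-> | zt] := eqVneq z t; first by rewrite ei ei1.
  rewrite hA ?PA //; apply: contra zt; rewrite !inE => /andP[].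
  have [ez et] : z != b /\ t != b by split; apply: contraNneq bP => <-.
  by rewrite (negbTE ez) (negbTE et) !orbF => /eqP-> /eqP->.
have ipn : ipath e1 (P ++ r1 :: R1).
  rewrite eP ipath_cat -eP; apply/and5P; split=> //; first by rewrite he ?mem_head // eqxx.
    2: { apply/allP => x xR; have xR' : x \in r1 :: R1 by rewrite inE xR orbT.
    rewrite /nadj he //; apply/andP; split; first by apply: contraNneq (dis a aA) => ->.
    by rewrite negb_and; apply/orP; right; apply: contraTneq uRR1 => <-; rewrite /= xR. }
  apply/antiP => z x zB xR; rewrite /nadj he ?PA ?BA // (negbTE (BA0 z zB)) andbT.
  by apply: contraNneq (dis z (PA z (BA z zB))) => ->.
have conc e' PP w D2 : lequiv e1 e' -> ipath e' ((p0 :: p1 :: PP) ++ r1 :: R1) ->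
   lad e' p0 p1 w r1 D2 -> has (e' w) R1 -> w \notin p0 :: p1 :: PP -> w \notin r1 :: R1 -> tail_free e' R1 D2 ->
   size P0 <= size PP ->
  exists e' P' r' R' b' D', [/\ lequiv e e', stage e' p0 p1 P' r' R' b' D', size P0 < size P' &
    size P0 + size R <= size P' + size R'].
  move=> le' h1 h2 h3 h4 h5 h6 h7; have sg' := lequiv_sg le' sg1.
  have [P' [r' [R' [b' [D' [hs s1 s2]]]]]] := assemble sg' h1 h2 h3 h4 h5 h6.
  exists e', P', r', R', b', D'; split=> //; first exact: lequiv_trans le1 le'.
    exact: leq_ltn_trans h7 s1.
  by rewrite s2; apply: leq_add.
move: ch => {u c uq pq au hl out} [u [uA uR1 au ch]].
have [hu|nu] := boolP (has (e1 u) (D ++ belast p0 (p1 :: P0))).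
  have [g [D' [l2 g2 hD']]] := attach sg1 ld1 ipP1 bP uA hu.
  have [w [D2 [h1 h2 h3 h4 h5]]] := finish sg1 ct1 uRR1 l2 g2 hD' uA uR1 ch.
  apply: (conc e1 P0 w D2) => //; first exact: lequiv_refl.
  by move: h3; rewrite mem_cat negb_or => /andP[].
have nuA z : z \in P ++ b :: D -> z \notin [:: a; b] -> e1 u z = false.
  move=> zA zn; apply/negbTE; apply: (hasPn nu); move: zA zn.
  rewrite !mem_cat eP mem_rcons !inE !negb_or => /orP[/orP[/eqP->|->]|/orP[/eqP->|->]]; rewrite ?eqxx ?orbT ?andbF //.
have [f [h [hfh fh euf neuh]]] : exists f h, [/\ (f, h) = (a, b) \/ (f, h) = (b, a), f != h, e1 u f & ~~ e1 u h].
  case ua : (e1 u a); case ub : (e1 u b); last 1 first.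
  - case/negP: au; apply/allP => v vA; rewrite ua /=.
    have [|/nuA -> //] := boolP (v \in [:: a; b]).
    by rewrite !inE => /orP[]/eqP->; rewrite ?ua ?ub.
  - case/negP: au; apply/allP => v vA; rewrite ua /=.
    have [|/nuA -> //] := boolP (v \in [:: a; b]).
    by rewrite !inE => /orP[]/eqP->; rewrite ?ua ?ub.
  - by exists a, b; rewrite ua ub eq_sym ab; split=> //; left.
  - by exists b, a; rewrite ua ub ab; split=> //; right.
have A0fh z : (z \in [:: a; b]) = (z == f) || (z == h).
  by rewrite !inE; case: hfh => -[-> ->] //; rewrite orbC.
have euA : {in P ++ b :: D, forall z, e1 u z = (z == f)}.
  move=> z zA; have [->//|zf] := eqVneq z f; have [->|zh] := eqVneq z h; first exact: negbTE.
  by apply: nuA; rewrite // A0fh negb_or zf.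
have ldf : lad e1 p0 p1 f h D by case: hfh => -[-> ->] //; apply: ladC.
have [|||e2 [w [D2 [le2 he2 [h1 h2 h3 h4 h5] hc]]]] := finish_single sg1 ct1 uRR1 ldf _ _ _ DA euA uA uR1 ch.
- by rewrite A0fh eqxx.
- by rewrite A0fh eqxx orbT.
- by move=> z; rewrite A0fh.
have sg2 := lequiv_sg le2 sg1; have [es2 ei2] := sg2.
have wP : w \notin P by move: h3; rewrite mem_cat negb_or => /andP[].
have fA : f \in P ++ b :: D by apply: A0A; rewrite A0fh eqxx.
have efr : e1 f r1 by rewrite he ?mem_head // A0fh !eqxx.
(* Complementing at [u] can only change the edge between [f] and [r1]. *)
have same x y : x \in P ++ r1 :: R1 -> y \in P ++ r1 :: R1 -> ~~ ((x == f) && (y == r1)) ->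
    ~~ ((x == r1) && (y == f)) -> e2 x y = e1 x y.
  case: he2 => [->//|[-> nuR]] hx hy n1 n2; rewrite lcE.
  have [xy|xy] := boolP [&& x != y, e1 u x & e1 u y]; last by rewrite addbF.
  have nb z : z \in P ++ r1 :: R1 -> e1 u z -> (z == f) || (z == r1).
    rewrite mem_cat => /orP[/PA /euA ->->//|]; rewrite inE => /orP[->|zR]; rewrite ?orbT //.
    by rewrite (negbTE (hasPn nuR z zR)).
  case/and3P: xy => xy /(nb x hx) /orP[]/eqP ex /(nb y hy) /orP[]/eqP ey; move: xy n1 n2;
    by rewrite ex ey !eqxx.
case: hc => [ef2|[eur nef wu]].
  apply: (conc e2 P0 w D2) => //; rewrite -(eq_ipath (e := e1)) // => x y hx hy.
  have [/andP[/eqP-> /eqP->]|n1] := boolP ((x == f) && (y == r1)); first by rewrite ef2.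
  have [/andP[/eqP-> /eqP->]|n2] := boolP ((x == r1) && (y == f)); first by rewrite es2 ef2 es1.
  by rewrite same.
case: he2 => [e21|[e21 nuR]]; first by rewrite e21 efr in nef.
have r1P : r1 \notin P by apply/negP => /PA /dis; rewrite mem_head.
case: hfh => -[ef eh]; last first.
  apply: (conc e2 P0 w D2) => //; rewrite -(eq_ipath (e := e1)) // => x y hx hy.
  have fnx z : z \in P ++ r1 :: R1 -> z == f = false.
    move=> hz; apply/negbTE; apply: contraTneq hz => ->; rewrite ef mem_cat negb_or bP.
    exact: dis b bA.
  by rewrite same // ?(fnx x) // ?(fnx y) // andbF.
(* The edge from [a] to [r1] is lost, so the path takes the detour through [u]. *)
apply: (conc e2 (rcons P0 u) w D2) => //; last by rewrite size_rcons.
  have e2u z : e2 u z = e1 u z by rewrite e21 lc_nbr.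
  have uP' : u \notin P by move: uA; rewrite mem_cat negb_or => /andP[].
  have inP x : x \in P -> x \in P ++ r1 :: R1 by rewrite mem_cat => ->.
  have inR x : x \in r1 :: R1 -> x \in P ++ r1 :: R1 by rewrite mem_cat => ->; rewrite orbT.
  have fP x : x \in r1 :: R1 -> x == f = false.
    by move=> xR; apply/negbTE; apply: contraTneq xR => ->; apply: dis.
  have rP x : x \in P -> x == r1 = false.
    by move=> xR; apply/negbTE; apply: contraTneq xR => ->.
  rewrite -!rcons_cons cat_rcons -/P eP ipath_cat -eP.
  apply/and5P; split.
  - rewrite -(eq_ipath (e := e1)) // => x y hx hy; rewrite same ?inP // ?rP // andbF //.
  - rewrite ipath_cons2 eur /=; apply/andP; split.
      apply/allP => x xR; rewrite /nadj e2u (hasPn nuR x xR) andbT.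
      by apply: contraNneq uR1 => ->; rewrite inE xR orbT.
    rewrite -/(ipath e2 (r1 :: R1)) -(eq_ipath (e := e1)) // => x y hx hy; rewrite same ?inR // ?fP // andbF //.
  - by rewrite -ef es2 e2u.
  - apply/antiP => z x zB; have zf : z == f = false.
      by apply/negbTE; have := BA0 z zB; rewrite A0fh negb_or => /andP[].
    have zP := BA z zB.
    rewrite inE => /orP[/eqP->|xR].
      rewrite /nadj es2 e2u euA ?PA // zf andbT; by apply: contraNneq uP' => <-.
    have e21z : e2 z x = e1 z x.
      by apply: same; rewrite ?zf ?(rP z zP) //; [apply: inP | apply: inR].
    rewrite /nadj e21z he ?PA // (negbTE (BA0 z zB)) andbT.
    by apply: contraNneq (dis z (PA z zP)) => ->.
  apply/allP => x xR; rewrite /nadj; apply/andP; split; first by apply: contraNneq (dis a aA) => ->.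
  have [->|xr] := eqVneq x r1; first by rewrite -ef.
  have aP : a \in P by rewrite eP mem_rcons mem_head.
  have -> : e2 a x = e1 a x.
    by apply: same; rewrite ?(negbTE xr) ?andbF ?(rP a aP) //; [apply: inP | apply: inR].
  by rewrite he // (negbTE xr) andbF.
rewrite -!rcons_cons mem_rcons inE negb_or wu; exact: wP.
Qed.

(** The initial cut has [A0 = [:: p1]], so a vertex satisfying [ant] must see [p0] and provides the
    first step of the ladder. *)
Lemma stage_init (T : finType) (e : rel T) p0 p1 r R : simple_graph e -> prime_graph e ->
  ipath e [:: p0, p1, r & R] -> R != [::] ->
  exists e' P' r' R' b D, [/\ lequiv e e', stage e' p0 p1 P' r' R' b D &
    size R <= size P' + size R'].
Proof.
move=> sg pr ip R0; have [es ei] := sg.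
have := ip; rewrite ipath_cons2 => /and3P[e01 /allP n0 ip1].
have := ip1; rewrite ipath_cons2 => /and3P[e1r /allP n1 ipr].
have u := ipath_uniq ei ip; have uR : uniq (r :: R) by apply: ipath_uniq ei ipr.
have n01 : p0 != p1 by move: u; rewrite /= inE negb_or => /andP[/andP[]].
have rR : r \notin R by move: uR => /andP[].
have ct : cut e [:: p0; p1] [:: p1] p1 r R.
  split; first by rewrite mem_head.
  - by move=> z; rewrite !inE => ->; rewrite orbT.
  - move=> v; rewrite inE => /orP[/eqP->|]; last rewrite inE => /eqP->.
      by move: u => /andP[+ _]; rewrite inE negb_or => /andP[].
    by move: u => /andP[_ /andP[]].
  move=> v w; rewrite inE => /orP[/eqP->|].
    by move=> wR; have /andP[_ /negbTE ->] := n0 w wR; rewrite inE (negbTE n01).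
  rewrite inE => /eqP->; rewrite [w \in _]inE eqxx => /orP[/eqP->|wR]; first by rewrite e1r eqxx.
  have /andP[_ /negbTE ->] := n1 w wR; apply/esym/negbTE; by apply: contraNneq rR => <-.
have [c0 [c [uq pq au hl out]]] := chain_exists sg pr ct (mem_head _ _) n01 R0 uR.
have [e1 [r1 [R1 [le1 ct1 ip1' sR1 [hA ch]]]]] := chain_short sg ct ipr uq pq au hl out (leqnn _).
move: ch => {c0 c uq pq au hl out} [c [cA cR1 ac ch]].
have sg1 := lequiv_sg le1 sg; have [es1 ei1] := sg1.
have [a0A A0A dis he] := ct1.
have e01' : e1 p0 p1 by rewrite hA ?mem_head ?inE ?eqxx ?orbT // (negbTE n01).
have ec0 : e1 c p0.
  move: ac; apply: contraNT => h; apply/allP => v; rewrite inE => /orP[/eqP->|].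
    by rewrite (negbTE h) inE (negbTE n01) andbF.
  by rewrite inE => /eqP->; rewrite eqxx andbT.
have cp1 : c != p1 by apply: contraNneq cA => ->; rewrite !inE eqxx orbT.
have ld : lad e1 p0 p1 c p1 [:: p0] by apply: ladS => //; [apply: lad0 | rewrite es1].
have uR1 : uniq (r1 :: R1) by apply: ipath_uniq ei1 ip1'.
have [|w [D2 [h1 h2 h3 h4 h5]]] := finish sg1 ct1 uR1 ld (mem_head _ _) _ cA cR1 ch.
  by move=> z; rewrite !inE => /eqP->; rewrite eqxx.
have ipn : ipath e1 ([:: p0; p1] ++ r1 :: R1).
  have p1A : p1 \in [:: p0; p1] by rewrite !inE eqxx orbT.
  rewrite [_ ++ _]/= ipath_cons2; apply/and3P; split=> //.
    apply/allP => x xR; rewrite /nadj he ?mem_head // inE (negbTE n01) andbT.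
    by apply: contraNneq (dis p0 (mem_head _ _)) => ->.
  rewrite ipath_cons2; apply/and3P; split=> //; first by rewrite he ?mem_head // eqxx.
  apply/allP => x xR; have xR' : x \in r1 :: R1 by rewrite inE xR orbT.
  rewrite /nadj he //; apply/andP; split; first by apply: contraNneq (dis p1 p1A) => ->.
  by rewrite negb_and; apply/orP; right; apply: contraTneq uR1 => <-; rewrite /= xR.
have [P' [r' [R' [b' [D' [hs s1 s2]]]]]] := assemble sg1 ipn h1 h2 h3 h4 h5.
by exists e1, P', r', R', b', D'; rewrite s2.
Qed.

Lemma stage_long (T : finType) K k : forall (e : rel T) p0 p1 P0 r R b D, simple_graph e -> prime_graph e ->
  stage e p0 p1 P0 r R b D -> K < size P0 + size R -> K <= size P0 + k ->
  exists e' P' r' R' b' D', [/\ lequiv e e', stage e' p0 p1 P' r' R' b' D' & K <= size P'].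
Proof.
elim: k => [|k IH] e p0 p1 P0 r R b D sg pr st hK hk.
  by exists e, P0, r, R, b, D; split=> //; [apply: lequiv_refl | rewrite addn0 in hk].
have [h|h] := leqP K (size P0); first by exists e, P0, r, R, b, D; split=> //; apply: lequiv_refl.
have R0 : R != [::] by case: R hK {st} => //; rewrite addn0 => hK; have := ltn_trans hK h; rewrite ltnn.
have [e1 [P1 [r1 [R1 [b1 [D1 [le1 st1 s1 s2]]]]]]] := stage_step sg pr st R0.
have [||||e2 [P2 [r2 [R2 [b2 [D2 [le2 st2 s3]]]]]]] := IH e1 _ _ _ _ _ _ _ _ _ st1.
- exact: lequiv_sg le1 sg.
- exact: prime_lequiv le1 sg pr.
- exact: leq_trans hK s2.
- by apply: leq_trans hk _; rewrite addnS -addSn leq_add2r.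
by exists e2, P2, r2, R2, b2, D2; split=> //; apply: lequiv_trans le1 le2.
Qed.

(** * Closing a long cycle *)

(** Pigeonhole: the marked entries are too few for all the intervals between consecutive ones to be
    shorter than [B]. *)
Lemma gap (T : Type) (t : pred T) B x s : t x -> t (last x s) -> (count t s) * B.+1 < size s ->
  exists s1 y g z s2, [/\ x :: s = s1 ++ y :: g ++ z :: s2, t y, t z, ~~ has t g & B <= size g].
Proof.
have [m] := ubnP (size s); elim: m x s => // m IH x s; rewrite ltnS => sm tx tl hs.
have hts : has t s by case/lastP: s tl hs {sm} => // s y; rewrite last_rcons has_rcons => ->.
have [g [z [s2 [es tz ng]]]] := split_first hts; subst s.
have [hB|hB] := leqP B (size g); first by exists [::], x, g, z, s2.
have cg : count t g = 0 by apply/eqP; rewrite -leqn0 leqNgt -has_count.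
move: hs; rewrite count_cat /= tz cg size_cat /= => hs.
have [|||s1 [y [g' [z' [s3 [es ty tz' ng' hg']]]]]] := IH z s2 _ tz.
- by move: sm; rewrite size_cat /=; move: (size g) (size s2); clear; lia.
- by move: tl; rewrite last_cat.
- by move: hs hB; clear; nia.
by exists ((x :: g) ++ s1), y, g', z', s3; split=> //; rewrite -catA -es.
Qed.

Lemma count_has_le (T U : Type) (r : T -> pred U) S s W : (forall z, count (r z) s <= W) ->
  count (fun v => has (r^~ v) S) s <= size S * W.
Proof.
move=> h; elim: S => [|z S IH] /=; first by rewrite count_pred0.
have : count (fun v => r z v || has (r^~ v) S) s <= count (r z) s + count (fun v => has (r^~ v) S) s.
  by rewrite -count_predUI; apply: leq_addr.
by move=> /leq_trans; apply; rewrite mulSn; apply: leq_add.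
Qed.

Lemma count_nbr_path (T : finType) (e : rel T) z q : ipath e (z :: q) -> count (e z) q <= 1.
Proof.
case: q => // y q; rewrite ipath_cons2 /= => /and3P[-> /allP nq _].
rewrite [count _ _](_ : _ = 0) //; apply/eqP; rewrite -leqn0 leqNgt -has_count.
by apply/hasPn => x /nq /andP[].
Qed.

(** A vertex of the path touches at most itself and its two neighbours. For any other vertex, the
    stretch from its first to its last neighbour is a fan. *)
Lemma touch_bound (T : finType) (e : rel T) P z n : simple_graph e -> 2 < n -> ipath e P ->
  vertex_minor (cycle_graph n) e \/ count (fun v => (v == z) || e z v) P <= (fan_bound n).+3.
Proof.
move=> sg n3 ip; have [es ei] := sg; have uP := ipath_uniq ei ip.
have [zP|zP] := boolP (z \in P).
  right; case/splitPr: zP ip uP => q1 q2 ip uP.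
  have c2 : count (e z) q2 <= 1 by apply: count_nbr_path; apply: ipath_catr ip.
  have c1 : count (e z) q1 <= 1.
    rewrite -(count_rev (e z)); apply: count_nbr_path; rewrite -rev_rcons ipath_rev //.
    by apply: (@ipath_catl _ _ _ q2); rewrite cat_rcons.
  have cc s : z \notin s -> count (fun v => (v == z) || e z v) s = count (e z) s.
    by move=> zs; apply: eq_in_count => v vs /=; case: eqP vs zs => // -> ->.
  move: uP; rewrite uniq_catC /= mem_cat negb_or => /andP[/andP[z2 z1] _].
  rewrite count_cat /= !cc // eqxx ei /=; move: c1 c2; clear; move: (count _ _) (count _ _); lia.
have [hs|hs] := leqP (count (e z) P) (fan_bound n).+1.
  right; apply: leq_trans (leqW (leqW hs)); rewrite leq_eqVlt; apply/orP; left; apply/eqP.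
  by apply: eq_in_count => v vs /=; case: eqP vs zP => // -> ->.
left; have hP : has (e z) P by rewrite has_count; apply: leq_trans hs.
have [q1 [x [q [eP ex nq]]]] := split_first hP.
have [q2 [y [q3 [eq ey nq']]]] : exists q2 y q3, [/\ x :: q = q2 ++ y :: q3, e z y & ~~ has (e z) q3].
  by apply: split_last; rewrite /= ex.
have ipq : ipath e (rcons q2 y).
  by apply: (@ipath_catl _ _ _ q3); rewrite cat_rcons -eq; apply: ipath_catr (q1) _ _; rewrite -eP.
have sq : subseq (rcons q2 y) P.
  by rewrite eP eq -cat_rcons; apply: subseq_trans (suffix_subseq _ _); apply: prefix_subseq.
apply: (FAN (y := z) (p := rcons q2 y)) => //.
- by rewrite /fan ipq; apply: contra zP; apply: mem_subseq.
- apply: leq_trans hs _; rewrite eP eq count_cat -cat_rcons count_cat.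
  have -> : count (e z) q1 = 0 by apply/eqP; rewrite -leqn0 leqNgt -has_count.
  have -> : count (e z) q3 = 0 by apply/eqP; rewrite -leqn0 leqNgt -has_count.
  by rewrite addn0; apply: count_size.
- by case: q2 eq {ipq sq} => [|x' q2] /= [<-].
- by rewrite last_rcons.
Qed.

Lemma stage_cycle n : 2 < n -> exists K, forall (T : finType) (e : rel T) p0 p1 P0 r R b D,
  simple_graph e -> stage e p0 p1 P0 r R b D -> K <= size P0 -> vertex_minor (cycle_graph n) e.
Proof.
move=> n3; have [N hN] := ladder_cycle n3.
(* A short ladder has at most [N + 2] vertices, each touching at most [fan_bound n + 3] vertices of
   the path; the last factor enforces a gap of [fan_bound n + 2] untouched vertices. *)
exists (N.+2 * (fan_bound n).+3 * (fan_bound n).+3) => T e p0 p1 P0 r R b D sg [ld ip bP ct] hK.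
have [es ei] := sg; have [a0A A0A dis he] := ct.
set a := last p1 P0 in ld ct a0A A0A he; set P := p0 :: p1 :: P0 in ip bP ct A0A dis he.
have uld := lad_out ei ld.
have ipP : ipath e P := ipath_catl ip.
have [ear ebr] : e a r /\ e b r by rewrite !he ?A0A ?mem_head // !inE !eqxx ?orbT.
have DA z : z \in D -> z \in P ++ b :: D by move=> zD; rewrite mem_cat [z \in b :: D]in_cons zD !orbT.
have rDn : all (nadj e r) D.
  apply/allP => z zD; rewrite /nadj es he ?DA ?mem_head // eqxx andbT; apply/andP; split.
    by apply: contraNneq (dis z (DA z zD)) => <-; rewrite mem_head.
  by move: uld; rewrite /= !inE negb_or => /and3P[/andP[_ aD] bD _]; apply/norP; split;
    [apply: contraNneq aD => <-|apply: contraNneq bD => <-].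
have rb : r != b by apply: contraNneq (dis b _) => [<-|]; rewrite ?mem_head // A0A // !inE eqxx orbT.
(* [r] sees both frontier vertices, so replacing [a] by [r] gives a ladder with a closing edge. *)
have ldr : lad e p0 p1 r b (a :: D) by apply: ladS.
have [s [fs ps es']] := lad_fr es ldr.
have e01 : e p0 p1 by move: ipP; rewrite ipath_cons2 => /andP[].
have cl : fin_edge e (p0, p1) s by case: es' => ->; rewrite //= es.
have [hs|hs] := leqP N (size s); first exact: hN _ _ _ _ sg fs e01 cl hs.
set S := p0 :: p1 :: map snd s.
have cS : connd e (mem S) := fr_conn sg fs cl.
have aS : a \in S.
  have := @perm_drops _ (p0, p1) s; rewrite /= => /perm_mem ->.
  by rewrite !inE (perm_mem ps) mem_head !orbT.
pose t v := has (fun z => (v == z) || e z v) S.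
have [//|tb] : vertex_minor (cycle_graph n) e \/ forall z, count (fun v => (v == z) || e z v) P <= (fan_bound n).+3.
  have [h|/existsPn h] := boolP [exists z, (fan_bound n).+3 < count (fun v => (v == z) || e z v) P].
    case/existsP: h => z hz; left; have [//|] := touch_bound z sg n3 ipP.
    by rewrite leqNgt hz.
  by right=> z; rewrite leqNgt.
have ct' : count t P <= N.+2 * (fan_bound n).+3.
  apply: leq_trans (count_has_le (r := fun z v => (v == z) || e z v) S tb) _.
  by rewrite leq_mul2r /= size_map !ltnS ltnW.
have tin z : z \in S -> t z by move=> zS; apply/hasP; exists z; rewrite // eqxx.
have [|||s1 [y [g [z [s2 [eP ty tz ng sg']]]]]] := @gap _ t (fan_bound n).+2 p0 (p1 :: P0).
- by apply: tin; rewrite mem_head.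
- exact: tin.
- apply: leq_trans (_ : size P0 < _); last by [].
  rewrite ltnS; apply: leq_trans hK; rewrite leq_mul2r /=.
  by apply: leq_trans ct'; rewrite /= leq_addl.
have ipg : ipath e (y :: g ++ z :: s2) by apply: (@ipath_catr _ _ s1); rewrite -eP.
have ng' v : v \in g -> (v \notin S) /\ forall w, w \in S -> ~~ e v w.
  move=> vg; have := hasPn ng v vg => tv; split; first by apply: contra tv => /tin.
  by move=> w wS; apply: contra tv => evw; apply/hasP; exists w; rewrite // es evw orbT.
have gN : g != [::] by case: g sg' {eP ng ipg ng'}.
have yS : y \notin S.
  case: g gN ipg ng' {eP ng sg'} => // v g _; rewrite cat_cons ipath_cons2 => /andP[eyv _] ng'.
  have [_ h] := ng' v (mem_head _ _); by apply/negP => /h; rewrite es eyv.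
have zS : z \notin S.
  case/lastP: g gN ipg ng' {eP ng sg'} => // g v _; rewrite -cat_cons -rcons_cons ipath_cat => /and4P[_ _ evz _] ng'.
  have [|_ h] := ng' v; first by rewrite mem_rcons mem_head.
  by apply/negP => /h; rewrite evz.
have att v : v \notin S -> t v -> exists2 d, mem S d & e v d.
  move=> vS /hasP[w wS /orP[/eqP ev|ewv]]; first by rewrite ev wS in vS.
  by exists w; rewrite // es.
apply: (@CYC _ e (mem S) y g z n) => //.
- by apply: (@ipath_catl _ _ _ s2); rewrite cat_cons cat_rcons.
- by move=> v; rewrite inE mem_rcons inE => /or3P[/eqP->|/eqP->|/ng' []].
- by move=> v w /ng' [_ h] /h.
- exact: att.
- exact: att.
Qed.

Lemma path_cycle n : 2 < n -> exists L, forall (T : finType) (e : rel T) p, simple_graph e ->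
  prime_graph e -> ipath e p -> L <= size p -> vertex_minor (cycle_graph n) e.
Proof.
move=> n3; have [K hK] := stage_cycle n3.
exists K.+1.+4 => T e [|p0 [|p1 [|r R]]] // sg pr ip sp.
have R0 : R != [::] by case: R sp {ip}.
have [e1 [P1 [r1 [R1 [b1 [D1 [le1 st1 s1]]]]]]] := stage_init sg pr ip R0.
have [||||e2 [P2 [r2 [R2 [b2 [D2 [le2 st2 s2]]]]]]] := @stage_long _ K K _ _ _ _ _ _ _ _ _ _ st1.
- exact: lequiv_sg le1 sg.
- exact: prime_lequiv le1 sg pr.
- by apply: leq_trans s1; apply: ltnW; move: sp.
- by rewrite leq_addl.
have sg2 := lequiv_sg le2 (lequiv_sg le1 sg).
by apply: (vm_lequiv le1); apply: (vm_lequiv le2); apply: hK sg2 st2 s2.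
Qed.

(** * Ramsey-type lemmas *)

Lemma ramsey2 a b : exists N, forall (X : eqType) (r : rel X) (s : seq X), N <= size s ->
  exists s', subseq s' s /\ ((a <= size s' /\ pairwise r s') \/ (b <= size s' /\ pairwise (fun x y => ~~ r x y) s')).
Proof.
elim: a b => [|a IHa] b.
  by exists 0 => X r s _; exists [::]; split; [apply: sub0seq | left].
elim: b => [|b [N2 h2]].
  by exists 0 => X r s _; exists [::]; split; [apply: sub0seq | right].
have [N1 h1] := IHa b.+1; exists (N1 + N2).+1 => X r [//|x s]; rewrite [size _]/= ltnS => sN.
have : N1 <= size (filter (r x) s) \/ N2 <= size (filter (predC (r x)) s).
  by move: sN; rewrite -(count_predC (r x) s) !size_filter; move: (count _ _) (count _ _); lia.
have sub s1 p : subseq s1 (filter p s) -> subseq s1 s /\ all p s1.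
  move=> h; split; first by apply: subseq_trans h (filter_subseq _ _).
  by apply/allP => y /(mem_subseq h); rewrite mem_filter => /andP[].
case=> [/h1|/h2] h; have {h} [s' [/sub[ss al] [[h1' p1]|[h1' p1]]]] := h r.
- by exists (x :: s'); split; [rewrite /= eqxx | left; rewrite /= al].
- by exists s'; split; [apply: subseq_trans ss (subseq_cons _ _) | right].
- by exists s'; split; [apply: subseq_trans ss (subseq_cons _ _) | left].
by exists (x :: s'); split; [rewrite /= eqxx | right; rewrite /= p1 andbT].
Qed.

Lemma ramsey k : exists N, forall (X : eqType) (r : rel X) (s : seq X), N <= size s ->
  exists s' b, [/\ subseq s' s, k <= size s' & pairwise (fun x y => r x y == b) s'].
Proof.
have [N h] := ramsey2 k k; exists N => X r s /(h X r) [s' [ss [[h1 h2]|[h1 h2]]]].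
  by exists s', true; split=> //; apply: sub_pairwise h2 => x y ->.
by exists s', false; split=> //; apply: sub_pairwise h2 => x y /negbTE ->.
Qed.

Lemma majority (X : eqType) (p : pred X) s k : k.*2 <= size s ->
  exists s' b, [/\ subseq s' s, k <= size s' & all (fun x => p x == b) s'].
Proof.
move=> h; have : k <= count p s \/ k <= count (predC p) s.
  by move: h; rewrite -(count_predC p s); move: (count _ _) (count _ _); lia.
rewrite -!size_filter => -[h1|h1]; [exists (filter p s), true | exists (filter (predC p) s), false];
  split; rewrite ?filter_subseq //; apply/allP => x; rewrite mem_filter => /andP[+ _].
  by move=> ->.
by move=> /negbTE ->.
Qed.

(** A [w] that separates two entries splits the list; keep a part with half of the entries and
    record [w] with an entry of the opposite value. Thus [w] separates that entry from all later
    ones. Each round halves the list, whence [2 ^ k]. *)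
Lemma distinguish (W X : eqType) (r : W -> pred X) k (s : seq X) : 2 ^ k <= size s -> uniq s ->
  (forall x y, x \in s -> y \in s -> x != y -> exists w, r w x != r w y) ->
  exists ps : seq (W * X), [/\ size ps = k, {subset map snd ps <= s}, uniq (map snd ps),
    pairwise (fun p q => r p.1 q.2 != r p.1 p.2) ps &
    all (fun p => has (r p.1) s && ~~ all (r p.1) s) ps].
Proof.
elim: k s => [|k IH] s; first by exists [::].
rewrite expnS mul2n => sk us hs.
have k1 : 0 < 2 ^ k by rewrite expn_gt0.
case: s sk us hs => [|x [|y s]] sk us hs; [by move: sk k1 => /=; lia | by move: sk k1 => /=; lia |].
set S := x :: y :: s in sk us hs *.
have [hx hy] : x \in S /\ y \in S by rewrite !inE !eqxx orbT.
have nxy : x != y by move: us; rewrite /= inE negb_or => /andP[/andP[]].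
have [w hw] := hs x y hx hy nxy.
have [s' [b [ss sk' al]]] := majority (r w) sk.
have us' := subseq_uniq ss us.
have [ps [h1 h2 h3 h4 h5]] : exists ps : seq (W * X), [/\ size ps = k, {subset map snd ps <= s'}, uniq (map snd ps),
    pairwise (fun p q => r p.1 q.2 != r p.1 p.2) ps & all (fun p => has (r p.1) s' && ~~ all (r p.1) s') ps].
  apply: IH => // u v us1 vs; apply: hs; exact: (mem_subseq ss).
have [f fS fb] : exists2 f, f \in S & r w f != b.
  by have [h|h] := eqVneq (r w x) b; [exists y; rewrite // -h eq_sym | exists x].
exists ((w, f) :: ps); split.
- by rewrite /= h1.
- by move=> z; rewrite [map _ _]/= inE => /orP[/eqP->//|/h2 /(mem_subseq ss)].
- by rewrite /= h3 andbT; apply: contra fb => /h2 /(allP al).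
- rewrite /= h4 andbT; apply/allP => q qp; have /h2 /(allP al) /eqP -> : q.2 \in map snd ps by apply: map_f.
  by rewrite eq_sym.
apply/andP; split.
  rewrite /=; case rx : (r w x) hw => /=; case ry : (r w y) => // _; rewrite ?orbT ?andbF //.
apply: sub_all h5 => p /andP[/hasP[z zs rz] /allPn[z' zs' rz']]; apply/andP; split.
  by apply/hasP; exists z => //; apply: (mem_subseq ss).
by apply/allPn; exists z' => //; apply: (mem_subseq ss).
Qed.

(** Every vertex is reached by an induced path, so a ball of radius [m] is everything, and each unit
    of radius multiplies the size by at most [D + 1]. *)
Lemma moore (T : finType) (e : rel T) D m (F : {set T}) : connd e (mem F) ->
  (forall v, v \in F -> #|[set w in F | e v w]| <= D) ->
  (forall p, ipath e p -> all (mem F) p -> size p <= m) -> #|F| <= D.+1 ^ m.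
Proof.
move=> cF dF pF; have [->|[v vF]] := set_0Vmem F; first by rewrite cards0.
pose nb (B : {set T}) := B :|: \bigcup_(u in B) [set w in F | e u w].
have card_nb (B : {set T}) : B \subset F -> #|nb B| <= D.+1 * #|B|.
  move=> BF; rewrite /nb mulSn; apply: leq_trans (leq_card_setU _ _) _; rewrite leq_add2l.
  apply: (@leq_trans (\sum_(u in B) D)); last by rewrite sum_nat_const mulnC.
  pose G u := [set w in F | e u w]; rewrite -/(\bigcup_(u in B) G u).
  have hG u : u \in B -> #|G u| <= D by move=> uB; apply: dF; apply: (subsetP BF).
  clearbody G.
  apply: (@leq_trans (\sum_(u in B) #|G u|)); last by apply: leq_sum => u; exact: hG.
  elim/big_rec2: _ => [|u A1 A2 uB h]; first by rewrite cards0.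
  by apply: leq_trans (leq_card_setU _ _) _; rewrite leq_add2l.
have nbF (B : {set T}) : B \subset F -> nb B \subset F.
  move=> BF; rewrite subUset BF; apply/bigcupsP => u _; by apply/subsetP => w; rewrite inE => /andP[].
have itF k : iter k nb [set v] \subset F /\ #|iter k nb [set v]| <= D.+1 ^ k.
  elim: k => [|k [IH1 IH2]] /=; first by rewrite sub1set vF cards1.
  split; first exact: nbF.
  by apply: leq_trans (card_nb _ IH1) _; rewrite expnS leq_mul2l IH2 orbT.
have reach p u k : path e u p -> u \in iter k nb [set v] -> all (mem F) p -> last u p \in iter (size p + k) nb [set v].
  elim: p u k => //= w p IH u k /andP[euw pp] uk /andP[wF pF'].
  rewrite -[nb _]/(iter (size p + k).+1 nb [set v]) -addnS; apply: IH => //=; rewrite inE; apply/orP; right; apply/bigcupP; exists u => //.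
  by rewrite inE euw andbT.
have mono k k' : k <= k' -> iter k nb [set v] \subset iter k' nb [set v].
  move=> /subnK <-; rewrite addnC; elim: (k' - k) => [|d IH]; first by rewrite addn0.
  by rewrite addnS /=; apply: subset_trans IH (subsetUl _ _).
apply: leq_trans (proj2 (itF m)); apply/subset_leq_card/subsetP => w wF.
have [p [ip ap /eqP lp _]] := connect_ipath (Q := pred1 w) (cF v w vF wF) (eqxx w).
have pp : path e v p.
  elim: p v ip {ap lp vF itF reach mono} => //= x p IH v; case: p IH => [|y p] IH; first by rewrite !andbT.
  by move=> /andP[/andP[-> _]] /IH.
have := reach p v 0 pp; rewrite inE eqxx => /(_ isT ap); rewrite lp addn0; apply: subsetP; apply: mono.
by apply: ltnW; apply: (pF (v :: p)); rewrite //= vF.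
Qed.

(** * Matched cliques *)

(** Complementing at the inner vertices one by one shrinks the path to the edge [a t]; [x] and [y]
    see none of these vertices. *)
Lemma contract_path (T : finType) (s : seq T) : forall (e : rel T) a t x y, simple_graph e ->
  ipath e (a :: rcons s t) -> all (fun z => ~~ e z x && ~~ e z y) s ->
  exists l, [/\ {subset l <= s}, local_compls e l a t, local_compls e l x =1 e x &
    local_compls e l y =1 e y].
Proof.
elim: s => [|c s IH] e a t x y sg ip hs; first by exists [::]; split=> //; case/andP: ip => /andP[].
move: ip; rewrite rcons_cons ipath_cons2 => /and3P[eac /allP nac ip].
have [n [r er]] : exists n r, rcons s t = n :: r by case: (s) => [|n s']; [exists t, [::] | exists n, (rcons s' t)].
rewrite er ipath_cons2 in ip; case/and3P: ip => ecn /allP ncr ip.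
have [es ei] := sg; pose e1 := local_compl e c; have sg1 : simple_graph e1 := lc_sg c sg.
case/andP: hs => /andP[cx cy] hs.
have rx z : ~~ e c z -> e1 z =1 e z by move=> h w; rewrite /e1 lcE (negbTE h) /= andbF addbF.
have ip1 : ipath e1 (a :: rcons s t).
  have an : a != n by have /andP[] : nadj e a n by apply: nac; rewrite er mem_head.
  rewrite er ipath_cons2; apply/and3P; split.
  - have /andP[_ /negbTE nan] : nadj e a n by apply: nac; rewrite er mem_head.
    by rewrite /e1 lcE nan an ecn es eac.
  - apply/allP => z zr; have /andP[h1 h2] : nadj e a z by apply: nac; rewrite er inE zr orbT.
    have /andP[_ ncz] := ncr z zr.
    by rewrite /nadj h1 (proj1 sg1) rx // es.
  rewrite -(eq_ipath (e := e)) // => u v; rewrite !inE => /orP[/eqP->|ur].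
    move=> /orP[/eqP->|vr]; first by rewrite ei (proj2 sg1).
    by have /andP[_ ncz] := ncr v vr; rewrite (proj1 sg1) rx // es.
  by have /andP[_ ncz] := ncr u ur; rewrite rx.
have [|l [h1 h2 h3 h4]] := IH e1 a t x y sg1 ip1.
  apply/allP => z zs; have /andP[zx zy] := allP hs z zs.
  by rewrite !(proj1 sg1 z) !rx // !(es _ z) zx zy.
exists (c :: l); split=> //=.
- by move=> z; rewrite !inE => /orP[->//|/h1 ->]; rewrite orbT.
- by move=> z; rewrite h3 rx.
- by move=> z; rewrite h4 rx.
Qed.

Definition rung (T : eqType) (e : rel T) x y (p : T * T) :=
  [&& e x p.1, ~~ e x p.2, ~~ e y p.1, e y p.2 & e p.1 p.2].

(** Say that [v] is seen by [x] and not by [y]. Follow a path in [F] from [v] to the first neighbour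
    [t] of [y], let [a] be the last neighbour of [x] before [t], and contract what lies between. If
    [x] sees [t] too, complementing at [a] deletes that edge. *)
Lemma fiber_rung (T : finType) (e : rel T) (F : {set T}) x y : simple_graph e -> connd e (mem F) ->
  x \notin F -> y \notin F -> x != y ->
  (exists2 v, v \in F & e x v) -> (exists2 v, v \in F & e y v) ->
  (exists2 v, v \in F & e x v != e y v) ->
  exists l p, [/\ {subset l <= F}, p.1 \in F, p.2 \in F,
    rung (local_compls e l) x y p & local_compls e l x y = e x y].
Proof.
move=> sg cF; have [es ei] := sg.
have main x' y' : x' \notin F -> y' \notin F -> x' != y' -> (exists2 v, v \in F & e y' v) ->
    (exists2 v, v \in F & e x' v && ~~ e y' v) ->
    exists l p, [/\ {subset l <= F}, p.1 \in F, p.2 \in F,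
    rung (local_compls e l) x' y' p & local_compls e l x' y' = e x' y'].
  move=> xF yF xy [w wF eyw] [v vF /andP[exv neyv]].
  have [q [ip aq lq bq]] := connect_ipath (Q := e y') (cF v w vF wF) eyw.
  case/lastP: q ip aq lq bq => [|q t]; first by rewrite /= (negbTE neyv).
  rewrite last_rcons belast_rcons all_rcons => ip /andP[tF aq] eyt bq.
  have hv : has (e x') (v :: q) by rewrite /= exv.
  have [s1 [a [s2 [eq' exa ns2]]]] := split_last hv.
  have inF z : z \in v :: q -> z \in F by rewrite inE => /orP[/eqP->//|/(allP aq)].
  have aF : a \in F by apply: inF; rewrite eq' mem_cat mem_head orbT.
  have s2F z : z \in s2 -> z \in F by move=> zs; apply: inF; rewrite eq' mem_cat inE zs !orbT.
  have neya : ~~ e y' a by apply: (allP bq); rewrite eq' mem_cat mem_head orbT.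
  have ip2 : ipath e (a :: rcons s2 t).
    by apply: (@ipath_catr _ _ s1); rewrite -rcons_cons -rcons_cat -eq' rcons_cons.
  have [|l [h1 h2 h3 h4]] := contract_path (x := x') (y := y') sg ip2.
    apply/allP => z zs; rewrite !(es z) (hasPn ns2 z zs) /=; apply: (allP bq).
    by rewrite eq' mem_cat inE zs !orbT.
  have sg1 := lcs_sg l sg; set e1 := local_compls e l in h2 h3 h4 sg1.
  have [es1 ei1] := sg1.
  have [ext|ext] := boolP (e x' t); last first.
    exists l, (a, t); split=> //=; first by move=> z /h1 /s2F.
    by rewrite /rung /= -/e1 h2 !h3 !h4 exa ext neya eyt.
  exists (rcons l a), (a, t); rewrite /local_compls -cats1 foldl_cat /= -/(local_compls e l) -/e1.
  split=> //=; first by move=> z; rewrite mem_cat inE => /orP[/h1 /s2F //|/eqP->].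
    have [e1xa e1ya] : e1 x' a /\ ~~ e1 y' a by rewrite h3 h4 exa neya.
    have [e1xt e1yt] : e1 x' t /\ e1 y' t by rewrite h3 h4 ext eyt.
    have xt : x' != t by apply: contraNneq xF => ->.
    rewrite /rung /= !lcE (es1 a x') (es1 a y') e1xa (negbTE e1ya) e1xt e1yt h2 xt ei1.
    by rewrite ?andbF /= ?addbF ?e1xa ?e1ya ?e1yt.
  by rewrite lcE (es1 a y') h4 (negbTE neya) h3 !andbF addbF.
move=> xF yF xy hx hy [v vF]; case exv : (e x v); case eyv : (e y v) => // _.
  by apply: main => //; exists v; rewrite // exv eyv.
have [|||||l [[b a] [h1 h2 h3 /and5P[h4 h5 h6 h7 h8] h9]]] := main y x => //.
- by rewrite eq_sym.
- by exists v; rewrite // exv eyv.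
have [es' _] := lcs_sg l sg.
by exists l, (a, b); split=> //; rewrite ?[_ x y]es' ?h9 // /rung /= h7 h6 h5 h4 es' h8.
Qed.

Definition antis (T : finType) (e : rel T) (F G : {set T}) :=
  [forall u in F, forall v in G, nadj e u v].

Lemma antisP (T : finType) (e : rel T) (F G : {set T}) :
  reflect (forall u v, u \in F -> v \in G -> nadj e u v) (antis e F G).
Proof.
apply: (iffP forall_inP) => [h u v uF vG|h u uF]; first by have /forall_inP := h u uF; apply.
by apply/forall_inP => v; apply: h.
Qed.

Definition link4 (T : eqType) (e : rel T) (p q : T * T) :=
  [&& nadj e p.1 q.1, nadj e p.1 q.2, nadj e p.2 q.1 & nadj e p.2 q.2].

(** The fibers are pairwise anticomplete, so complementations inside one do not disturb the
    others. *)
Lemma fibers_rungs (T : finType) (Fs : seq {set T}) : forall (e : rel T) x y, simple_graph e -> x != y ->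
  (forall F, F \in Fs -> [/\ connd e (mem F), x \notin F & y \notin F]) ->
  (forall F, F \in Fs -> [/\ exists2 v, v \in F & e x v, exists2 v, v \in F & e y v &
     exists2 v, v \in F & e x v != e y v]) ->
  pairwise (antis e) Fs ->
  exists l ps, [/\ forall z, z \in l -> has (fun F : {set T} => z \in F) Fs, size ps = size Fs,
    all (fun p => has (fun F : {set T} => (p.1 \in F) && (p.2 \in F)) Fs) ps,
    local_compls e l x y = e x y &
    all (rung (local_compls e l) x y) ps && pairwise (link4 (local_compls e l)) ps].
Proof.
elim: Fs => [|F Fs IH] e x y sg xy h1 h2; first by move=> _; exists [::], [::].
rewrite pairwise_cons => /andP[/allP aF pF]; have [es ei] := sg.
have [cF xF yF] := h1 F (mem_head _ _); have [t1 t2 t3] := h2 F (mem_head _ _).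
have [l [p [l1 p1 p2 rp exy]]] := fiber_rung sg cF xF yF xy t1 t2 t3.
have sg1 := lcs_sg l sg; set e1 := local_compls e l in rp exy sg1; have [es1 ei1] := sg1.
have row G z w : G \in Fs -> z \in G -> e1 z w = e z w.
  move=> GF zG; apply: lcs_out => //; apply/allP => v /l1 vF.
  by have /antisP /(_ v z vF zG) /andP[] := aF G GF.
have conn G : G \in Fs -> connd e1 (mem G).
  move=> GF u v uG vG; have [cG _ _] := h1 G (mem_behead (s := F :: Fs) GF).
  by apply: connect_on_sub (cG u v uG vG) => s t sG tG; rewrite sG tG (row G).
have col G z w : G \in Fs -> z \in G -> e1 w z = e w z.
  by move=> GF zG; rewrite es1 (row G) // es.
have sub G : G \in Fs -> G \in F :: Fs by rewrite inE => ->; rewrite orbT.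
have [|||l' [ps [a1 a2 a3 a4 /andP[a5 a6]]]] := IH e1 x y sg1 xy.
- move=> G GF; have [_ xG yG] := h1 G (sub G GF); split=> //; exact: conn.
- move=> G GF; have [[u uG xu] [v vG yv] [w wG xyw]] := h2 G (sub G GF).
  by split; [exists u | exists v | exists w] => //; rewrite !(col G).
- have aFs : all (fun G => G \in Fs) Fs by apply/allP.
  apply: (sub_in_pairwise _ aFs pF).
  move=> G1 G2 G1F G2F /antisP h; apply/antisP => u v uG vG.
  by rewrite /nadj (row G1) //; apply: h.
set e2 := local_compls e1 l' in a4 a5 a6.
have eE : local_compls e (l ++ l') = e2 by rewrite /local_compls foldl_cat.
have [es2 ei2] := lcs_sg l' sg1 : simple_graph e2.
have row2 z w : z \in F -> e2 z w = e1 z w.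
  move=> zF; apply: lcs_out => //; apply/allP => v /a1 /hasP[G GF vG].
  by rewrite (row G) //; have /antisP /(_ z v zF vG) /andP[_] := aF G GF; rewrite es.
have col2 z w : z \in F -> e2 w z = e1 w z by move=> zF; rewrite es2 row2 // es1.
exists (l ++ l'), (p :: ps); rewrite eE; split.
- move=> z; rewrite mem_cat => /orP[/l1 zF|/a1 h] /=; first by rewrite zF.
  by rewrite h orbT.
- by rewrite /= a2.
- rewrite /= p1 p2 /=; apply: sub_all a3 => q h; by rewrite h orbT.
- by rewrite a4.
apply/andP; split; first by move: rp a5; rewrite /= /rung !col2 // => -> ->.
rewrite pairwise_cons a6 andbT; apply/allP => q qs; have /hasP[G GF /andP[q1 q2]] := allP a3 q qs.
have na u v : u \in F -> v \in G -> nadj e2 u v.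
  by move=> uF vG; rewrite /nadj row2 // (col G) //; have /antisP := aF G GF; apply.
by rewrite /link4 !na.
Qed.

(** Complementing at [x] turns the vertices [p.1] into a clique, complementing at [y] the vertices
    [p.2]; since [x] and [y] are not adjacent, the two operations do not interfere. *)
Lemma rungs_matched_nadj (T : finType) (e : rel T) x y ps n : simple_graph e -> x != y -> ~~ e x y ->
  all (rung e x y) ps -> pairwise (link4 e) ps -> n <= size ps -> vertex_minor (matched_cliques n) e.
Proof.
move=> sg xy nxy /allP rps /(pairwiseP (x, y)) lps sn; have [es ei] := sg.
pose q (i : 'I_n) := nth (x, y) ps i.
have qps i : q i \in ps by apply: mem_nth; apply: leq_trans (ltn_ord i) sn.
have lt i : (i : 'I_n) < size ps by apply: leq_trans (ltn_ord i) sn.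
have lq (i j : 'I_n) : i < j -> link4 e (q i) (q j) by move=> ij; apply: lps; rewrite ?inE.
pose f (u : bool * 'I_n) := if u.1 then (q u.2).1 else (q u.2).2.
have fx u : e x (f u) = u.1 by have /and5P[h1 h2 _ _ _] := rps _ (qps u.2); rewrite /f; case: u.1; rewrite ?h1 // (negbTE h2).
have fy u : e y (f u) = ~~ u.1 by have /and5P[_ _ h1 h2 _] := rps _ (qps u.2); rewrite /f; case: u.1; rewrite ?h2 // (negbTE h1).
have nf u w : u.2 != w.2 -> nadj e (f u) (f w).
  have W (u' w' : bool * 'I_n) : u'.2 < w'.2 -> nadj e (f u') (f w').
    by move=> /lq /and4P[h1 h2 h3 h4]; rewrite /f; case: u'.1; case: w'.1.
  case: (ltngtP u.2 w.2) => [h|h|/val_inj ->]; [by move=> _; apply: W | | by rewrite eqxx].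
  by move=> _; rewrite nadjC //; apply: W.
have df u w : f u = f w -> u = w.
  move=> fuw; have e1 : u.1 = w.1 by rewrite -!fx fuw.
  have [e2|/nf] := eqVneq u.2 w.2; last by rewrite fuw /nadj eqxx.
  by case: u w e1 e2 {fuw} => a i [b j] /= -> ->.
exists [:: x; y], f; split=> // u w.
have xy0 : e y x = false by rewrite es (negbTE nxy).
have e1y z : local_compl e x y z = e y z by rewrite lcE (negbTE nxy) !andbF addbF.
rewrite /= lcE !e1y lcE !fx !fy /matched_cliques.
have [e2|n2] := eqVneq u.2 w.2; last first.
  have /andP[-> /negbTE ->] := nf u w n2.
  by case: u.1; case: w.1.
have [e1|n1] := eqVneq u.1 w.1.
  have -> : u = w by case: u w e1 e2 => a i [b j] /= -> ->.
  by rewrite eqxx ei.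
have e1' : e (f u) (f w).
  have /and5P[_ _ _ _ h] := rps _ (qps w.2).
  by move: n1; rewrite /f e2; case: u.1; case: w.1 => // _; rewrite // es.
by rewrite e1'; move: n1; case: u.1; case: w.1; rewrite //= ?andbF.
Qed.

(** If [x] and [y] are adjacent, complementing at both vertices of one rung deletes the edge between
    them. This rung is lost, hence the strict inequality. *)
Lemma matched_of_fibers (T : finType) (Fs : seq {set T}) (e : rel T) x y n : simple_graph e -> x != y ->
  (forall F, F \in Fs -> [/\ connd e (mem F), x \notin F & y \notin F]) ->
  (forall F, F \in Fs -> [/\ exists2 v, v \in F & e x v, exists2 v, v \in F & e y v &
     exists2 v, v \in F & e x v != e y v]) ->
  pairwise (antis e) Fs -> n < size Fs -> vertex_minor (matched_cliques n) e.
Proof.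
move=> sg xy h1 h2 pw sF; have [l [ps [_ sps pF exy /andP[rps lps]]]] := fibers_rungs sg xy h1 h2 pw.
apply: (@vm_lequiv _ _ _ _ (local_compls e l)); first by apply: lequiv_lcs; apply: lequiv_refl.
have sg1 := lcs_sg l sg; set e1 := local_compls e l in exy rps lps sg1 *; rewrite -sps in sF.
have [n1|x1] := boolP (e1 x y); last by apply: (rungs_matched_nadj sg1 xy x1 rps lps); apply: ltnW.
case: ps sF pF rps lps {sps} => // p ps sp /andP[/hasP[F FF /andP[_ p2F]] _] /andP[/and5P[xa xb ya yb ab] rps].
rewrite pairwise_cons => /andP[/allP lp lps].
have [es ei] := sg1; pose e3 := local_compls e1 [:: p.1; p.2].
have sg3 : simple_graph e3 := lcs_sg _ sg1; have [es3 ei3] := sg3.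
have [_ xF _] := h1 F FF; have xp : x != p.2 by apply: contraNneq xF => ->.
apply: (@vm_lequiv _ _ _ _ e3); first by apply: lequiv_lcs; apply: lequiv_refl.
have n3 : ~~ e3 x y.
  have e2y z : local_compl e1 p.1 z y = e1 z y by rewrite lcE (es p.1 y) (negbTE ya) !andbF addbF.
  have px : local_compl e1 p.1 p.2 x by rewrite lcE (es p.2 x) (negbTE xb) eq_sym xp ab (es p.1 x) xa.
  by rewrite /e3 /= lcE !e2y px (es p.2 y) n1 xy yb.
have row z w : nadj e1 p.1 z -> nadj e1 p.2 z -> e3 z w = e1 z w.
  by move=> /andP[_ a1] /andP[_ a2]; apply: lcs_out => //=; rewrite a1 a2.
have rowq q : q \in ps -> e3 q.1 =1 e1 q.1 /\ e3 q.2 =1 e1 q.2.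
  by move=> /lp /and4P[l1 l2 l3 l4]; split=> w; apply: row.
apply: (rungs_matched_nadj (ps := ps) sg3 xy n3) => //.
  apply/allP => q qs; have [r1 r2] := rowq q qs; have := allP rps q qs.
  by rewrite /rung !(es3 x) !(es3 y) !r1 !r2 !(es _ x) !(es _ y).
have aps : all (fun q => q \in ps) ps by apply/allP.
apply: (sub_in_pairwise _ aps lps) => q q' qs _.
by have [r1 r2] := rowq q qs; rewrite /link4 /nadj !r1 !r2.
Qed.

(** * Half graphs *)

Lemma pairwise_rev (T : Type) (r : rel T) s : pairwise r (rev s) = pairwise (fun x y => r y x) s.
Proof.
elim: s => // x s IH; rewrite rev_cons pairwise_rcons IH /= all_rev.
by congr andb; apply: eq_all.
Qed.

(** Between different pairs [(f, u)] of the half graph, the only edges join a [u] to a later [f]. *)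
Definition hrel (T : eqType) (e : rel T) (q q' : T * T) :=
  [&& e q.2 q'.1, nadj e q.2 q'.2, nadj e q.1 q'.1 & nadj e q.1 q'.2].

Definition hown (T : eqType) (e : rel T) t (q : T * T) := [&& e t q.1, nadj e t q.2 & e q.1 q.2].

Definition hout (T : eqType) (e : rel T) (p : seq T) (q : T * T) :=
  all (fun z => nadj e z q.1 && nadj e z q.2) p.

(** The end [t] of the path built so far sees every [f]. Complementing at [f1], [u1] and [u2] joins
    [u1] to [t] and detaches [t] from the remaining [f], all of which [u1] still sees, so [u1] is
    the new end. Among the remaining [f], the effects of [u1] and [u2] cancel. *)
Lemma half_path (T : finType) L : forall (e : rel T) t p, simple_graph e -> ipath e (t :: p) ->
  all (hown e t) L -> all (hout e p) L -> pairwise (hrel e) L ->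
  exists e' p', [/\ lequiv e e', ipath e' p' & size p + size L <= size p'].
Proof.
elim: L => [|[f1 u1] L IH] e t p sg ip ho hp hr.
  by exists e, (t :: p); split=> //; [apply: lequiv_refl | rewrite addn0].
case: L IH ho hp hr => [|[f2 u2] L] IH ho hp hr.
  by exists e, (t :: p); split=> //; [apply: lequiv_refl | rewrite addn1].
have [es ei] := sg; set L2 := (f2, u2) :: L in IH ho hp hr *.
move: ho => /andP[/and3P[/= tf1 tu1 fu1] ho].
move: hp => /andP[/allP /= hp1 hp]; move: hr; rewrite pairwise_cons => /andP[/allP h1 hr].
have /andP[/allP /= h2 _] : all (hrel e (f2, u2)) L && pairwise (hrel e) L by rewrite -pairwise_cons.
have /and3P[/= tf2 tu2 fu2] : hown e t (f2, u2) by case/andP: ho.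
have /and4P[/= u1f2 u1u2 f1f2 f1u2] : hrel e (f1, u1) (f2, u2) by apply: h1; rewrite mem_head.
pose e1 := local_compl e f1; pose e2 := local_compl e1 u1; pose e3 := local_compl e2 u2.
have sg1 : simple_graph e1 := lc_sg f1 sg; have sg2 : simple_graph e2 := lc_sg u1 sg1.
have sg3 : simple_graph e3 := lc_sg u2 sg2; have [es3 ei3] := sg3.
have le : lequiv e e3 by apply/lequiv_lc/lequiv_lc/lequiv_lc/lequiv_refl.
have r1 z : ~~ e f1 z -> e1 z =1 e z by move=> h w; rewrite /e1 lcE (negbTE h) /= andbF addbF.
have r2 z : ~~ e1 u1 z -> e2 z =1 e1 z by move=> h w; rewrite /e2 lcE (negbTE h) /= andbF addbF.
have r3 z : ~~ e2 u2 z -> e3 z =1 e2 z by move=> h w; rewrite /e3 lcE (negbTE h) /= andbF addbF.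
have c1 z : ~~ e f1 z -> forall w, e1 w z = e w z by move=> h w; rewrite (proj1 sg1) r1 // es.
have c2 z : ~~ e1 u1 z -> forall w, e2 w z = e1 w z by move=> h w; rewrite (proj1 sg2) r2 // (proj1 sg1).
have {}ho : all (hown e t) L2 by [].
have {}hp : all (hout e p) L2 by [].
have [/andP[_ nf1u2] /andP[_ nu1u2] /andP[_ nf1f2]] := And3 f1u2 u1u2 f1f2.
have e1u2 : e1 u2 =1 e u2 by apply: r1.
have n1u2 : ~~ e1 u1 u2 by rewrite c1.
have e2u2 : e2 u2 =1 e u2 by move=> w; rewrite r2 // e1u2.
have rowu q : q \in L2 -> e3 q.2 =1 e q.2.
  move=> qL w; have /and4P[_ /andP[_ nu] _ /andP[_ nf]] := h1 q qL.
  have nu1 : ~~ e1 u1 q.2 by rewrite (c1 _ nf).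
  have q2 : e2 q.2 =1 e q.2 by move=> z; rewrite (r2 _ nu1) (r1 _ nf).
  move: qL; rewrite inE => /orP[/eqP->|qL]; first by rewrite /e3 lc_nbr.
  rewrite r3 // e2u2; by have /and4P[_ /andP[]] := h2 q qL.
have rowp z : z \in p -> e3 z =1 e z.
  move=> zp w; have /andP[/andP[_ n1] /andP[_ n2]] := hp1 z zp.
  have nf : ~~ e f1 z by rewrite es.
  have nu : ~~ e1 u1 z by rewrite (proj1 sg1) r1.
  have /allP /(_ z zp) /andP[_ /andP[_ n3]] : hout e p (f2, u2) by case/andP: hp.
  have nu2 : ~~ e2 u2 z by rewrite e2u2 es.
  by rewrite (r3 _ nu2) (r2 _ nu) (r1 _ nf).
have u2L q : q \in L2 -> e u2 q.1.
  by rewrite inE => /orP[/eqP->|/h2 /and4P[]] //=; rewrite es.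
have e1u1f q : q \in L2 -> e1 u1 q.1.
  by move=> qL; have /and4P[h3 _ /andP[_ n] _] := h1 q qL; rewrite c1.
have tu1' : e1 t u1.
  have /andP[tu /negbTE n] := tu1.
  by rewrite /e1 lcE n tu (es f1 t) tf1 fu1.
have nu2t : ~~ e2 u2 t by rewrite e2u2 es; case/andP: tu2.
have nu2u1 : ~~ e2 u2 u1 by rewrite e2u2 es.
have tu1n : e3 t u1 by rewrite r3 // (proj1 sg2) /e2 lc_nbr // (proj1 sg1).
have e2tf q : q \in L2 -> ~~ e3 t q.1.
  move=> qL; have /and4P[_ _ /andP[ff n] _] := h1 q qL; have /and3P[tf _ _] := allP ho q qL.
  have tq : t != q.1 by apply: contraNneq n => <-; rewrite es.
  by rewrite (r3 _ nu2t) /e2 lcE (c1 _ n) tf tq (proj1 sg1) tu1' e1u1f.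
have e3u1f q : q \in L2 -> e3 u1 q.1.
  by move=> qL; rewrite (r3 _ nu2u1) /e2 lc_nbr // e1u1f.
have e3ff q q' : q \in L2 -> q' \in L2 -> nadj e q.1 q'.1 -> nadj e3 q.1 q'.1.
  move=> qL qL' /andP[ff n]; rewrite /nadj ff /=.
  have /and4P[_ _ /andP[_ n1] _] := h1 q qL; have /and4P[_ _ /andP[_ n2] _] := h1 q' qL'.
  by rewrite /e3 lcE ff !e2u2 !u2L // /e2 lcE ff !e1u1f // (c1 _ n2) (negbTE n).
have [||||e' [p' [le' ip' sp']]] := IH e3 u1 (t :: p) sg3.
- rewrite ipath_cons2; apply/and3P; split; first by rewrite (es3 u1) tu1n.
    apply/allP => z zp; have /andP[_ /andP[zu n]] := hp1 z zp.
    by rewrite /nadj eq_sym zu (es3 u1) rowp.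
  rewrite -(eq_ipath (e := e)) // => z w; rewrite !inE => /orP[/eqP->|zp]; last by rewrite rowp.
  by move=> /orP[/eqP->|wp]; rewrite ?ei ?ei3 // (es3 t) rowp // es.
- apply/allP => q qL; rewrite /hown e3u1f //.
  have /and4P[_ /andP[uu n] _ _] := h1 q qL.
  rewrite /nadj uu (es3 u1) rowu // es n (es3 q.1) rowu //=.
  by have /and3P[_ _ ] := allP ho q qL; rewrite es.
- apply/allP => q qL; rewrite /hout /=; apply/andP; split; last first.
    have /allP hq := allP hp q qL; apply/allP => z zp; have := hq z zp.
    by rewrite /nadj !rowp.
  have /and3P[tf /andP[tu n] _] := allP ho q qL.
  rewrite /nadj e2tf // tu (es3 t) rowu // es n !andbT.
  by have /and4P[_ _ /andP[_ nf] _] := h1 q qL; apply: contraNneq nf => <-; rewrite es.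
- have aL : all (fun q => q \in L2) L2 by apply/allP.
  apply: (sub_in_pairwise _ aL hr) => q q' qL qL' /and4P[g1 /andP[g2 g2'] g3 /andP[g4 g4']].
  apply/and4P; split; first by rewrite rowu.
  + by rewrite /nadj g2 rowu.
  + exact: e3ff.
  + by rewrite /nadj g4 (es3 q.1) rowu // es.
exists e', p'; split=> //; first exact: lequiv_trans le le'.
by move: sp'; rewrite /= addSnnS.
Qed.

(** Merging consecutive pairs yields pairs whose two components are adjacent, as [hown] demands. *)
Fixpoint pairup (T : Type) (L : seq (T * T)) : seq (T * T) :=
  match L with
  | q :: q' :: L' => (q'.1, q.2) :: pairup L'
  | _ => [::]
  end.

Lemma size_pairup (T : Type) (L : seq (T * T)) : size (pairup L) = (size L)./2.
Proof.
have [m] := ubnP (size L); elim: m L => // m IH [|q [|q' L]] //=.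
by rewrite !ltnS => h; rewrite IH // ltnW.
Qed.

Lemma pairup_all (T : Type) (A B : pred T) (L : seq (T * T)) :
  all (fun q => A q.1 && B q.2) L -> all (fun q => A q.1 && B q.2) (pairup L).
Proof.
have [m] := ubnP (size L); elim: m L => // m IH [|q [|q' L]] //=.
rewrite !ltnS => h /and3P[/andP[_ ->] /andP[-> _] /IH -> //]; exact: ltnW.
Qed.

Lemma hrelE (T : eqType) (e : rel T) q q' :
  hrel e q q' = (e q.2 q'.1 && nadj e q.1 q'.1) && (nadj e q.2 q'.2 && nadj e q.1 q'.2).
Proof. by rewrite /hrel; case: (e _ _) => //=; rewrite andbCA andbA. Qed.

Lemma pairup_hrel_all (T : eqType) (e : rel T) x L : all (hrel e x) L -> all (hrel e x) (pairup L).
Proof.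
rewrite !(eq_all (hrelE e x)).
exact: (pairup_all (A := fun v => e x.2 v && nadj e x.1 v) (B := fun v => nadj e x.2 v && nadj e x.1 v)).
Qed.

Lemma pairup_hrel (T : finType) (e : rel T) (L : seq (T * T)) : symmetric e ->
  pairwise (hrel e) L -> pairwise (hrel e) (pairup L) /\ all (fun q => e q.1 q.2) (pairup L).
Proof.
move=> es; have [m] := ubnP (size L); elim: m L => // m IH [|q [|q' L]] // sL.
rewrite !pairwise_cons => /and3P[/andP[/and4P[h _ _ _] hq] hq' pL].
have [//|h1 h2] := IH L _ pL; first by move: sL; rewrite /= !ltnS; apply: ltnW.
rewrite /= h1 h2 es h !andbT; split=> //.
have := pairup_hrel_all hq; have := pairup_hrel_all hq'; move=> /allP a1 /allP a2; apply/allP => x xL.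
have /and4P[_ _ b1 b2] := a1 x xL; have /and4P[b3 b4 _ _] := a2 x xL.
by rewrite /hrel b1 b2 b3 b4.
Qed.

(** The second component of the first pair sees all later first components and serves as the initial
    end [t]. *)
Lemma half_clean (T : finType) (e : rel T) L : simple_graph e -> pairwise (hrel e) L ->
  exists e' p, [/\ lequiv e e', ipath e' p & (size L).-1./2 <= size p].
Proof.
move=> sg; case: L => [|q L]; first by exists e, [::]; split=> //; apply: lequiv_refl.
rewrite pairwise_cons => /andP[hq hL]; have [es ei] := sg.
have [h1 h2] := pairup_hrel es hL.
have [||||e' [p [le ip sp]]] := @half_path _ (pairup L) e q.2 [::] sg => //.
- have /allP a1 := pairup_hrel_all hq.
  apply/allP => x xL; have /and4P[b1 b2 _ _] := a1 x xL.
  by rewrite /hown b1 b2 (allP h2 x xL).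
- by apply/allP.
by exists e', p; split=> //; rewrite add0n size_pairup in sp.
Qed.

(** Reversing the list exchanges the two values of [m]. If the second components form a clique,
    complementing at the first component of the last pair, which sees all earlier ones of them,
    makes them independent. *)
Lemma half_ipath (T : finType) (e : rel T) (L : seq (T * T)) m b : simple_graph e ->
  pairwise (fun q q' => [&& nadj e q.1 q'.1, (q.2 != q'.2) && (e q.2 q'.2 == b),
     (q.2 != q'.1) && (e q.2 q'.1 == m) & (q'.2 != q.1) && (e q'.2 q.1 == ~~ m)]) L ->
  exists e' p, [/\ lequiv e e', ipath e' p & (size L - 2)./2 <= size p].
Proof.
move=> sg; have [es ei] := sg; wlog -> : m L / m = true.
  move=> W hL; case: m hL => hL; first exact: (W true).
  have [|e' [p [h1 h2 h3]]] := W true (rev L) erefl; last by exists e', p; rewrite size_rev in h3.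
  rewrite pairwise_rev; apply: sub_pairwise hL => q q' /and4P[g1 g2 g3 g4].
  by rewrite nadjC // g1 [_ == q.2]eq_sym [e q'.2 _]es g2 g3 g4.
case: b => hL; last first.
  have [|e' [p [h1 h2 h3]]] := @half_clean _ e L sg.
    apply: sub_pairwise hL => q q' /and4P[g1 /andP[g2 /eqP g2'] /andP[_ /eqP g3] /andP[g4 /eqP g4']].
    by rewrite /hrel g3 g1 /nadj g2 g2' eq_sym g4 es g4'.
  by exists e', p; split=> //; apply: leq_trans h3; apply: half_leq; rewrite -subn1; apply: leq_sub2l.
case/lastP: L hL => [|L q]; first by exists e, [::]; split=> //; apply: lequiv_refl.
rewrite pairwise_rcons => /andP[/allP hq hL].
pose e1 := local_compl e q.1; have sg1 : simple_graph e1 := lc_sg q.1 sg; have [es1 ei1] := sg1.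
have le : lequiv e e1 by apply/lequiv_lc/lequiv_refl.
have [|e' [p [h1 h2 h3]]] := @half_clean _ e1 L sg1; last first.
  exists e', p; split=> //; first exact: lequiv_trans le h1.
  by rewrite size_rcons subSS subn1.
have aL : all (fun x => x \in L) L by apply/allP.
apply: (sub_in_pairwise _ aL hL) => x y xL yL /and4P[/andP[g1 g1'] /andP[g2 /eqP g2'] /andP[_ /eqP g3] /andP[g4 /eqP g4']].
have fr z : z \in L -> e1 z.1 =1 e z.1.
  by move=> /hq /and4P[/andP[_ n] _ _ _] w; rewrite /e1 lcE (es q.1) (negbTE n) /= andbF addbF.
have uq z : z \in L -> e q.1 z.2 by move=> /hq /and4P[_ _ /andP[_ /eqP h] _]; rewrite es h.
apply/and4P; split.
- by rewrite es1 fr // es g3.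
- by rewrite /nadj g2 /e1 lcE g2 g2' !uq.
- by rewrite /nadj g1 fr.
by rewrite /nadj eq_sym g4 fr // es g4'.
Qed.

(** * Brooms *)

Record broom (T : finType) (e : rel T) c H (Fs : seq {set T}) l : Prop := Broom {
  br_path : ipath e (c :: H);
  br_fib : forall F, F \in Fs -> [/\ connd e (mem F), l <= #|F|, c \notin F,
     exists2 v, v \in F & e c v & forall h v, h \in H -> v \in F -> nadj e h v];
  br_anti : pairwise (antis e) Fs }.

(** The handle [H] is the same in the new broom, so a bound on its length survives repeated use. *)
Definition outcome (T : finType) (e : rel T) n m H l w :=
  vertex_minor (matched_cliques n) e \/
  (exists e' p, [/\ lequiv e e', ipath e' p & m <= size p]) \/
  exists e' c Fs, [/\ lequiv e e', broom e' c H Fs l & w <= size Fs].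

Lemma outcome_lequiv (T : finType) (e e' : rel T) n m H l w : lequiv e e' ->
  outcome e' n m H l w -> outcome e n m H l w.
Proof.
move=> le [h|[[e1 [p [l1 i1 s1]]]|[e1 [c [Fs [l1 b1 s1]]]]]]; [left|right; left|right; right].
- exact: vm_lequiv le h.
- by exists e1, p; split=> //; apply: lequiv_trans le l1.
by exists e1, c, Fs; split=> //; apply: lequiv_trans le l1.
Qed.

Lemma broom_sub (T : finType) (e : rel T) c H (Fs Fs' : seq {set T}) l :
  subseq Fs' Fs -> broom e c H Fs l -> broom e c H Fs' l.
Proof.
move=> ss [h1 h2 h3]; split=> //; last exact: subseq_pairwise ss h3.
by move=> F /(mem_subseq ss) /h2.
Qed.

Definition noN (T : finType) (e : rel T) u (F : {set T}) := [forall v in F, ~~ e u v].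
Definition eqN (T : finType) (e : rel T) c u (F : {set T}) := [forall v in F, e u v == e c v].

Lemma noNP (T : finType) (e : rel T) u (F : {set T}) : reflect (forall v, v \in F -> ~~ e u v) (noN e u F).
Proof. exact: forall_inP. Qed.

Lemma noNPn (T : finType) (e : rel T) u (F : {set T}) : ~~ noN e u F -> exists2 v, v \in F & e u v.
Proof. by move/forall_inPn => [v vF]; rewrite negbK; exists v. Qed.

Lemma eqNPn (T : finType) (e : rel T) c u (F : {set T}) : ~~ eqN e c u F -> exists2 v, v \in F & e c v != e u v.
Proof. by move/forall_inPn => [v vF h]; exists v; rewrite // eq_sym. Qed.

Lemma eqNP (T : finType) (e : rel T) c u (F : {set T}) : reflect (forall v, v \in F -> e u v = e c v) (eqN e c u F).
Proof. by apply: (iffP forall_inP) => h v vF; apply/eqP; rewrite h. Qed.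

Lemma connd_row (T : finType) (e e' : rel T) (F : {set T}) : (forall v w, v \in F -> e' v w = e v w) ->
  connd e (mem F) -> connd e' (mem F).
Proof. by move=> h cF u v uF vF; apply: connect_on_sub (cF u v uF vF) => s t sF tF; rewrite sF tF h. Qed.

Lemma unary_handle h k : exists N, forall (T X : eqType) (r : T -> pred X) (H : seq T) (L : seq X),
  size H <= h -> N <= size L ->
  (exists p L', [/\ p \in H, subseq L' L, k <= size L' & all (r p) L']) \/
  exists L', [/\ subseq L' L, k <= size L' & forall p, p \in H -> all (fun x => ~~ r p x) L'].
Proof.
elim: h => [|h [N IH]].
  by exists k => T X r [|//] L _ kL; right; exists L.
exists (N + k).*2 => T X r [|p H] L sH sL.
  right; exists L; split=> //; move: sL; clear; lia.
have [L1 [b [s1 k1 a1]]] := majority (r p) sL.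
case: b a1 => a1.
  left; exists p, L1; rewrite mem_head; split=> //; first by move: k1; clear; lia.
  by apply: sub_all a1 => x /eqP.
have [||[q [L2 [q1 q2 q3 q4]]]|[L2 [q1 q2 q3]]] := IH T X r H L1.
- by move: sH.
- by move: k1; clear; lia.
- by left; exists q, L2; rewrite inE q1 orbT; split=> //; apply: subseq_trans q2 s1.
right; exists L2; split=> //; first exact: subseq_trans q1 s1.
move=> q; rewrite inE => /orP[/eqP->|/q3 //].
by apply/allP => x /(mem_subseq q1) /(allP a1) /eqP ->.
Qed.

Lemma extend_fibers (T : finType) (e : rel T) (L : seq (T * {set T})) : simple_graph e ->
  (forall q, q \in L -> connd e (mem q.2) /\ exists2 v, v \in q.2 & e q.1 v) ->
  pairwise (fun q q' => [&& antis e q.2 q'.2, noN e q.1 q'.2, noN e q'.1 q.2 & ~~ e q.1 q'.1]) L ->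
  (forall q, q \in L -> connd e (mem (q.1 |: q.2))) /\ pairwise (antis e) [seq q.1 |: q.2 | q <- L].
Proof.
move=> [es ei] hL pL; split.
  move=> q /hL [cq [v vq ev]]; apply: conndU cq _ _ => //.
    by move=> u; rewrite /= inE => ->; rewrite orbT.
  move=> u; rewrite /= !inE => /orP[/eqP->|->//] _; exists v => //.
  by apply: connect1; rewrite /rel_on /= !inE eqxx vq ev orbT.
have aL : all (fun q => q \in L) L by apply/allP.
rewrite pairwise_map; apply: (sub_in_pairwise _ aL pL) => q q' qL qL' /and4P[/antisP a1 /noNP a2 /noNP a3 a4].
have [_ [v vq ev]] := hL q qL; have [_ [v' vq' ev']] := hL q' qL'.
apply/antisP => u w; rewrite !inE => /orP[/eqP->|uq] /orP[/eqP->|wq].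
- by rewrite /nadj a4 andbT; apply: contraTneq ev => ->; apply: a3.
- rewrite /nadj a2 // andbT; apply: contraTneq ev => ->; rewrite es; by have /andP[] := a1 v w vq wq.
- rewrite /nadj es a3 // andbT; apply: contraTneq ev' => <-; by have /andP[] := a1 u v' uq vq'.
exact: a1.
Qed.

Lemma grow_disjoint n m h w l : exists N, forall (T : finType) (e : rel T) c H (L : seq (T * {set T})),
  simple_graph e -> broom e c H (map snd L) l -> size H <= h ->
  pairwise (fun q q' => noN e q.1 q'.2 && noN e q'.1 q.2) L ->
  (forall q, q \in L -> (q.1 \notin q.2) && ~~ noN e q.1 q.2) -> N <= size L ->
  outcome e n m H l.+1 w.
Proof.
have [N1 h1] := unary_handle h (n + w).+2; have [N2 h2] := ramsey N1.
exists N2 => T e c H L sg br sH pL oL sL; have [es ei] := sg.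
have [L1 [b [ss1 sz1 pb]]] := h2 _ (fun q q' : T * {set T} => e q.1 q'.1) L sL.
have c_notu L' : subseq L' L -> 1 < size L' -> forall q, q \in L' -> c != q.1.
  move=> ss sL' q qL'; have := subseq_pairwise ss pL.
  have fib q' : q' \in L' -> exists2 v, v \in q'.2 & e c v.
    by move=> /(mem_subseq ss) h'; have [_ _ _ ? _] := br_fib br (map_f snd h').
  case: L' sL' {ss} qL' fib => [|q0 [|q1 L']] // _ + fib; rewrite inE => /orP[/eqP->|qL'].
    rewrite pairwise_cons => /andP[/andP[/andP[/noNP a1 _] _] _].
    have [|v vq ev] := fib q1; first by rewrite !inE eqxx orbT.
    by apply: contraTneq ev => ->; apply: a1.
  rewrite pairwise_cons => /andP[/allP /(_ q qL') /andP[_ /noNP a1] _].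
  have [|v vq ev] := fib q0; first by rewrite mem_head.
  by apply: contraTneq ev => ->; apply: a1.
have fin (e1 : rel T) L' : simple_graph e1 -> subseq L' L -> (forall q v t, q \in L' -> v \in q.2 -> e1 v t = e v t) ->
   pairwise (fun q q' => ~~ e1 q.1 q'.1) L' ->
   (forall q, q \in L' -> connd e1 (mem (q.1 |: q.2))) /\ pairwise (antis e1) [seq q.1 |: q.2 | q <- L'].
  move=> sg1 ss row pu; have [es1 ei1] := sg1; apply: extend_fibers => //.
    move=> q qL'; have qL := mem_subseq ss qL'; have [cq _ _ _ _] := br_fib br (map_f snd qL).
    have /andP[_ /noNPn [v vq ev]] := oL q qL; split; first by apply: connd_row cq => v' t; apply: row.
    by exists v; rewrite // es1 (row q) // es.
  have aL : all (fun q => q \in L') L' by apply/allP.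
  have := br_anti (broom_sub (map_subseq snd ss) br); rewrite pairwise_map => pA.
  have : pairwise (fun q q' => [&& antis e q.2 q'.2, noN e q.1 q'.2 && noN e q'.1 q.2 & ~~ e1 q.1 q'.1]) L'.
    have := subseq_pairwise ss pL; move: pA pu; elim: (L') => //= q L0 IH.
    move=> /andP[a1 /IH {}IH] /andP[a2 /IH {}IH] /andP[a3 /IH ->]; rewrite andbT.
    by apply/allP => x xL; move: (allP a1 x xL) (allP a2 x xL) (allP a3 x xL) => /= -> -> ->.
  move=> pA'; apply: (sub_in_pairwise _ aL pA') => q q' qL qL' /and3P[/antisP b1 /andP[/noNP b2 /noNP b3] b4].
  apply/and4P; split=> //.
  - by apply/antisP => u v uq vq; rewrite /nadj (row q) //; apply: b1.
  - by apply/noNP => v vq; rewrite es1 (row q') // es; apply: b2.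
  by apply/noNP => v vq; rewrite es1 (row q) // es; apply: b3.
have [//|//|[p [L2 [pH ss2 sz2 a2]]]|[L2 [ss2 sz2 a2]]] := h1 _ _ (fun p (q : T * {set T}) => e p q.1) H L1.
  left; have ss : subseq L2 L := subseq_trans ss2 ss1; have pb2 := subseq_pairwise ss2 pb.
  pose e1 := if b then local_compl e p else e.
  have sg1 : simple_graph e1 by rewrite /e1; case: (b) => //; apply: lc_sg.
  have le : lequiv e e1 by rewrite /e1; case: (b); [apply/lequiv_lc/lequiv_refl | apply: lequiv_refl].
  have [es1 ei1] := sg1.
  have pF q v : q \in L2 -> v \in q.2 -> nadj e p v.
    by move=> /(mem_subseq ss) qL vq; have [_ _ _ _ hh] := br_fib br (map_f snd qL); apply: hh.
  have row q v t : q \in L2 -> v \in q.2 -> e1 v t = e v t.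
    move=> qL vq; rewrite /e1; case: (b) => //.
    by rewrite lcE; have /andP[_ /negbTE ->] := pF q v qL vq; rewrite andbF addbF.
  have rowp t : e1 p t = e p t by rewrite /e1; case: (b); rewrite ?lc_nbr.
  have pu : pairwise (fun q q' => ~~ e1 q.1 q'.1) L2.
    have aL : all (fun q => q \in L2) L2 by apply/allP.
    have pq := subseq_pairwise ss pL.
    have : pairwise (fun q q' => (e q.1 q'.1 == b) && (q.1 != q'.1)) L2.
      move: pb2 pq; have : {subset L2 <= L} by apply: mem_subseq ss.
      elim: (L2) => //= q L0 IH sub /andP[b1 /IH {}IH] /andP[b2 /IH ->]; last first.
        by move=> x xL; apply: sub; rewrite inE xL orbT.
      rewrite andbT; apply/allP => x xL; rewrite (allP b1 x xL) /=.
      have /andP[_ /noNP b3] := allP b2 x xL; have /andP[_ /noNPn [v vq ev]] := oL q (sub q (mem_head _ _)).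
      by apply: contraTneq ev => ->; apply: b3.
    move=> pq'; apply: (sub_in_pairwise _ aL pq') => q q' qL qL' /andP[/eqP e2 n2].
    move: e2; rewrite /e1; case: (b) => [e2|->//].
    by rewrite lcE e2 n2 (allP a2 q qL) (allP a2 q' qL').
  have [cF aF] := fin e1 L2 sg1 ss row pu.
  apply: (vm_lequiv le).
  have cp : c != p by have := ipath_uniq ei (br_path br); rewrite /= => /andP[cH _]; apply: contraNneq cH => ->.
  apply: (matched_of_fibers sg1 cp _ _ aF); last by rewrite size_map; apply: leq_trans sz2; rewrite ltnS; apply/leqW/leq_addr.
    move=> F /mapP[q qL2 ->]; split; first exact: cF.
      rewrite !inE negb_or; apply/andP; split.
        by apply: (c_notu L2) => //; apply: leq_trans sz2.
      by have [_ _ ? _ _] := br_fib br (map_f snd (mem_subseq ss qL2)).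
    have /andP[_ /noNPn [v vq ev]] := oL q (mem_subseq ss qL2).
    rewrite !inE negb_or; apply/andP; split.
      by apply: contraTneq ev => <-; have /andP[] := pF q v qL2 vq.
    by apply/negP => pq; have /andP[] := pF q p qL2 pq; rewrite eqxx.
  move=> F /mapP[q qL2 ->]; have [_ _ _ [v vq ev] _] := br_fib br (map_f snd (mem_subseq ss qL2)).
  have e1cv : e1 c v by rewrite es1 (row q) // es.
  split.
  - by exists v; rewrite // inE vq orbT.
  - by exists q.1; rewrite ?inE ?eqxx // rowp; apply: (allP a2).
  exists v; first by rewrite inE vq orbT.
  by rewrite e1cv rowp; have /andP[_ /negbTE ->] := pF q v qL2 vq.
right; right; have ss := subseq_trans ss2 ss1; have pb2 := subseq_pairwise ss2 pb.
have Hu q p : q \in L2 -> p \in H -> ~~ e p q.1 by move=> qL /a2 /allP; apply.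
have mk (e1 : rel T) L' : lequiv e e1 -> subseq L' L2 -> (forall q v t, q \in L' -> v \in q.2 -> e1 v t = e v t) ->
   (forall p t, p \in H -> e1 p t = e p t) ->
   pairwise (fun q q' => ~~ e1 q.1 q'.1) L' -> w.+1 <= size L' ->
   exists e' c0 Fs, [/\ lequiv e e', broom e' c0 H Fs l.+1 & w <= size Fs].
  move=> le ss' row rowH pu sw; have sg1 := lequiv_sg le sg; have [es1 ei1] := sg1.
  have ssL := subseq_trans ss' ss; have [cF aF] := fin e1 L' sg1 ssL row pu.
  exists e1, c, [seq q.1 |: q.2 | q <- L']; split=> //; last by rewrite size_map; apply: ltnW.
  split=> //.
    rewrite -(eq_ipath (e := e)) ?(br_path br) // => u v; rewrite !inE => /orP[/eqP->|uH]; last by rewrite rowH.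
    by move=> /orP[/eqP->|vH]; rewrite ?ei ?ei1 // es1 rowH // es.
  move=> F /mapP[q qL' ->]; have qL := mem_subseq ssL qL'.
  have [b1 b2 b3 [v vq ev] b4] := br_fib br (map_f snd qL); have /andP[uq nN] := oL q qL.
  split; first exact: cF.
  - by rewrite cardsU1 uq; apply: b2.
  - rewrite !inE negb_or b3 andbT; case: (leqP 2 (size L')) => sL'; first exact: (c_notu L').
    by apply: (c_notu L2) => //; [apply: leq_trans sz2 | apply: mem_subseq ss' _ qL'].
  - by exists v; [rewrite inE vq orbT | rewrite es1 (row q) // es].
  move=> p v' pH; rewrite !inE => /orP[/eqP->|vq']; last by rewrite /nadj rowH //; apply: b4.
  have [v2 v2q ev2] := noNPn nN.
  rewrite /nadj rowH // (Hu q) ?(mem_subseq ss' qL') // andbT.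
  by apply: contraTneq ev2 => <-; have /andP[] := b4 p v2 pH v2q.
case: b pb2 {pb} => pb2; last first.
  apply: (mk e L2) => //; first exact: lequiv_refl.
    by apply: sub_pairwise pb2 => q q' /eqP ->.
  by apply: leq_trans sz2; rewrite ltnS; apply/leqW/leq_addl.
(* The first item is sacrificed in order to make the other [u]'s independent. *)
case: L2 ss2 sz2 a2 ss pb2 Hu mk => // q0 L2 ss2 sz2 a2 ss pb2 Hu mk.
have pq := subseq_pairwise ss pL.
have sub0 q : q \in L2 -> q \in q0 :: L2 by rewrite inE => ->; rewrite orbT.
move: pb2 pq; rewrite !pairwise_cons => /andP[/allP b1 b2] /andP[/allP b3 b4].
pose e1 := local_compl e q0.1; apply: (mk e1 L2).
- exact/lequiv_lc/lequiv_refl.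
- exact: subseq_cons.
- move=> q v t qL vq; have /andP[/noNP /(_ v vq) /negbTE nv _] := b3 q qL.
  by rewrite /e1 lcE nv andbF addbF.
- by move=> p t pH; rewrite /e1 lcE [e q0.1 p]es (negbTE (Hu q0 p (mem_head _ _) pH)) andbF addbF.
- have aL : all (fun q => q \in L2) L2 by apply/allP.
  have pq2 : pairwise (fun q q' => (e q.1 q'.1 == true) && (q.1 != q'.1)) L2.
    have : {subset L2 <= L} by move=> q /sub0 /(mem_subseq ss).
    move: b2 b4; elim: (L2) => //= q L0 IH /andP[d1 /IH {}IH] /andP[d2 /IH {}IH] sub.
    rewrite IH ?andbT; last by move=> x xL; apply: sub; rewrite inE xL orbT.
    apply/allP => x xL; rewrite (allP d1 x xL) /=.
    have /andP[_ /noNP d3] := allP d2 x xL; have /andP[_ /noNPn [v vq ev]] := oL q (sub q (mem_head _ _)).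
    by apply: contraTneq ev => ->; apply: d3.
  apply: (sub_in_pairwise _ aL pq2) => q q' qL qL' /andP[/eqP e2 n2].
  by rewrite /e1 lcE e2 n2 (eqP (b1 q qL)) (eqP (b1 q' qL')).
by move: sz2; rewrite [size (_ :: _)]/= ltnS; apply: leq_trans; rewrite ltnS leq_addl.
Qed.

(** Pivoting on the edge [c g]: [g] takes over the neighbourhood of [c], and two other vertices are
    toggled according to their edges to [c] and [g]. *)
Lemma pivE (T : finType) (e : rel T) c g (e' := local_compls e [:: c; g; c]) : simple_graph e -> e c g ->
  (forall x, x != c -> x != g -> e' g x = e c x) /\
  (forall x y, x != y -> x != c -> x != g -> y != c -> y != g ->
    e' x y = e x y (+) (e c x && e g y) (+) (e g x && e c y)).
Proof.
move=> sg ecg; have [es ei] := sg.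
have cg : c != g by apply: contraTneq ecg => ->; rewrite ei.
have gc : g != c by rewrite eq_sym.
pose e1 := local_compl e c; pose e2 := local_compl e1 g.
have sg1 : simple_graph e1 := lc_sg c sg; have sg2 : simple_graph e2 := lc_sg g sg1.
have e1c x : e1 c x = e c x by rewrite /e1 lc_nbr.
have e1g x : x != g -> e1 g x = e g x (+) e c x.
  by move=> xg; rewrite /e1 lcE eq_sym xg ecg.
have e2g x : e2 g x = e1 g x by rewrite /e2 lc_nbr.
have e1gc : e1 g c by rewrite (proj1 sg1) e1c.
have e2c x : x != c -> x != g -> e2 c x = e g x.
  move=> xc xg; rewrite /e2 lcE e1c eq_sym xc e1gc e1g //.
  by case: (e c x); case: (e g x).
split=> [x xc xg|x y xy xc xg yc yg].
  rewrite /e' /= -/e1 -/e2 lcE e2g e1g // (proj1 sg2) e2g e1gc e2c // eq_sym xg.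
  by case: (e c x); case: (e g x).
rewrite /e' /= -/e1 -/e2 lcE !e2c // xy /e2 lcE xy !e1g // /e1 lcE xy.
by case: (e x y); case: (e c x); case: (e c y); case: (e g x); case: (e g y).
Qed.

Definition triv (T : finType) (e : rel T) c u (F : {set T}) := noN e u F || eqN e c u F.

(* [L] lists pairs of a vertex and a fiber; [m1] and [m2] tell whether a vertex
   sees the fibers after and before its own one. *)
Definition normal (T : finType) (e : rel T) c m1 m2 (L : seq (T * {set T})) :=
  pairwise (fun q q' : T * {set T} => [&& triv e c q.1 q'.2 && (noN e q.1 q'.2 == ~~ m1),
    triv e c q'.1 q.2 && (noN e q'.1 q.2 == ~~ m2),
    q.1 != q'.1, q.1 \notin q'.2 & q'.1 \notin q.2]) L &&
  all (fun q : T * {set T} => (q.1 \notin q.2) && ~~ (if m1 then eqN e c q.1 q.2 else noN e q.1 q.2)) L.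

(** If [m1] and [m2] differ, the vertices [u] and representatives of the fibers form a half graph.
    If both are false, [grow_disjoint] applies. If both are true, each [u] sees the other fibers
    like [c]; a pivot on [c] and a vertex [g] of the first fiber adds the row of [c] to theirs,
    which reduces this to the second case with [g] in place of [c]. *)
Lemma normal_step n m h w l : exists N, forall (T : finType) (e : rel T) c H L m1 m2,
  simple_graph e -> broom e c H (map snd L) l -> size H <= h -> normal e c m1 m2 L -> N <= size L ->
  outcome e n m H l.+1 w.
Proof.
have [N1 h1] := grow_disjoint n m h w l; have [N2 h2] := ramsey (m.*2).+2.
exists (N1 + N2).+1 => T e c H L m1 m2 sg br sH /andP[nL oL] sL; have [es ei] := sg.
have fib q : q \in L -> exists2 v, v \in q.2 & e c v.
  by move=> qL; have [_ _ _ ? _] := br_fib br (map_f snd qL).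
have antiL : pairwise (fun q q' : T * {set T} => antis e q.2 q'.2) L.
  by have := br_anti br; rewrite pairwise_map.
have [m12|m12] := eqVneq m2 m1; last first.
  have em : m2 = ~~ m1 by case: (m1) (m2) m12 => -[].
  subst m2; right; left.
  (* A neighbour of [c] represents the fiber: a vertex that is trivial on the fiber sees this
     neighbour iff it sees any vertex of the fiber. *)
  pose f (q : T * {set T}) := odflt q.1 [pick v in q.2 | e c v].
  have fP q : q \in L -> f q \in q.2 /\ e c (f q).
    move=> /fib [v vq ev]; rewrite /f; case: pickP => [v' /andP[]//|/(_ v)]; by rewrite /= vq ev.
  have [|L1 [b [ss sz pb]]] := h2 _ (fun q q' : T * {set T} => e q.1 q'.1) L.
    by apply: leq_trans sL; apply: leqW; apply: leq_addl.
  have sub := mem_subseq ss.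
  have [|e' [p [le ip sp]]] := @half_ipath _ e [seq (f q, q.1) | q <- L1] m1 b sg; last first.
    exists e', p; split=> //; apply: leq_trans sp; rewrite size_map -[m]doubleK half_leq //.
    by rewrite leq_subRL ?add2n //; apply: leq_trans sz.
  rewrite pairwise_map; have aL : all (fun q => q \in L1) L1 by apply/allP.
  have : pairwise (fun q q' : T * {set T} => [&& antis e q.2 q'.2, e q.1 q'.1 == b,
     triv e c q.1 q'.2 && (noN e q.1 q'.2 == ~~ m1),
     triv e c q'.1 q.2 && (noN e q'.1 q.2 == ~~ ~~ m1) &
     [&& q.1 != q'.1, q.1 \notin q'.2 & q'.1 \notin q.2]]) L1.
    move: (subseq_pairwise ss antiL) pb (subseq_pairwise ss nL); elim: (L1) => //= q L0 IH.
    move=> /andP[a1 /IH {}IH] /andP[a2 /IH {}IH] /andP[a3 /IH ->]; rewrite andbT.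
    by apply/allP => x xL; move: (allP a1 x xL) (allP a2 x xL) (allP a3 x xL) => /= -> -> /and3P[-> -> ->].
  move=> pA; apply: (sub_in_pairwise _ aL pA) => q q' qL qL'.
  have [fq cfq] := fP q (sub _ qL); have [fq' cfq'] := fP q' (sub _ qL').
  move=> /and5P[/antisP c1 c2 c3 c4 /and3P[c5 c6 c7]] /=.
  have val u (F : {set T}) v k : v \in F -> e c v -> triv e c u F && (noN e u F == ~~ k) -> e u v == k.
    move=> vF cv /andP[/orP[nn|/eqNP nn] /eqP hk].
      by move: hk; rewrite nn => /esym /negbTE ->; move/noNP: nn => /(_ v vF) /negbTE ->.
    by rewrite nn // cv; case: k hk => // /noNP /(_ v vF); rewrite nn // cv.
  rewrite c1 // c5 c2 (val _ _ _ _ fq' cfq' c3) (val _ _ _ _ fq cfq c4) !andbT /=.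
  by apply/andP; split; [apply: contraNneq c6 => -> | apply: contraNneq c7 => ->].
subst m2; case: m1 nL oL => nL oL; last first.
  apply: (h1 T e c H L) => //; last by apply: leq_trans sL; apply: leqW; apply: leq_addr.
    by apply: sub_pairwise nL => q q' /and3P[/andP[_ /eqP ->] /andP[_ /eqP ->] _].
  by move=> q; apply: (allP oL).
case: L br nL oL sL fib antiL => // q0 L br nL oL sL fib antiL.
have [g gq cg] := fib q0 (mem_head _ _).
have [_ _ _ _ hh0] := br_fib br (mem_head q0.2 (map snd L)).
pose e' := local_compls e [:: c; g; c]; have [eg eE] := pivE sg cg; rewrite -/e' in eg eE.
have sg' : simple_graph e' := lcs_sg _ sg; have [es' ei'] := sg'.
have le : lequiv e e' by exists [:: c; g; c].
apply: (outcome_lequiv le).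
move: nL antiL; rewrite !pairwise_cons => /andP[/allP n0 nL] /andP[/allP a0 aL].
have sub q : q \in L -> q \in q0 :: L by rewrite inE => ->; rewrite orbT.
have Hc h' : h' \in H -> h' != c.
  move=> hH; have := ipath_uniq ei (br_path br); rewrite /= => /andP[cH _].
  by apply: contraNneq cH => <-.
have Hg h' : h' \in H -> (h' != g) && ~~ e g h'.
  by move=> hH; have /andP[-> nn] := hh0 h' g hH gq; rewrite es nn.
have vF q v : q \in L -> v \in q.2 -> [/\ v != c, v != g & e g v = false].
  move=> qL vq; have [_ _ cq _ _] := br_fib br (map_f snd (sub q qL)).
  have /antisP /(_ g v gq vq) /andP[gv /negbTE nn] := a0 q qL.
  by split=> //; [apply: contraNneq cq => <- | rewrite eq_sym].
have ugc q : q \in L -> [/\ q.1 != c, q.1 != g & e g q.1].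
  move=> qL; have /and5P[_ /andP[t /eqP ne] _ _ u0] := n0 q qL.
  have /andP[_ nq] := allP oL q (sub q qL).
  have egu : e q.1 g = e c g by move: t; rewrite /triv ne => /eqNP; apply.
  split; [|by apply: contraNneq u0 => ->|by rewrite es egu].
  by apply: contraNneq nq => ->; apply/eqNP.
have ev q q' v : q \in L -> q' \in L -> v \in q'.2 -> v != q.1 -> e' q.1 v = e q.1 v (+) e c v.
  move=> qL qL' vq nv; have [v1 v2 v3] := vF q' v qL' vq; have [u1 u2 u3] := ugc q qL.
  by rewrite eE ?[_ == v]eq_sym // u3 v3 andbF addbF.
have egv q v : q \in L -> v \in q.2 -> e' g v = e c v.
  by move=> qL vq; have [v1 v2 _] := vF q v qL vq; rewrite eg.
have brL : broom e' g H (map snd L) l.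
  split.
  - have := br_path br; case: H {sH hh0 br} Hc Hg => // h1' H Hc Hg; rewrite !ipath_cons2 => /and3P[ch /allP nch ip].
    apply/and3P; split.
    + by rewrite eg ?Hc ?mem_head //; have /andP[] := Hg h1' (mem_head _ _).
    + apply/allP => z zH; have zH' : z \in h1' :: H by rewrite inE zH orbT.
      have /andP[z1 z2] := Hg z zH'; have /andP[_ z3] := nch z zH.
      by rewrite /nadj eg ?Hc // z3 eq_sym z1.
    rewrite -(eq_ipath (e := e)) // => x y xH yH.
    have [->|xy] := eqVneq x y; first by rewrite ei ei'.
    have /andP[x1 /negbTE x2] := Hg x xH; have /andP[y1 /negbTE y2] := Hg y yH.
    by rewrite eE ?Hc // x2 y2 andbF !addbF.
  - move=> F /mapP[q qL ->]; have [b1 b2 b3 [v vq cv] b4] := br_fib br (map_f snd (sub q qL)).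
    have vv v1 v2 : v1 \in q.2 -> v2 \in q.2 -> e' v1 v2 = e v1 v2.
      move=> h1' h2'; have [->|n12] := eqVneq v1 v2; first by rewrite ei ei'.
      have [x1 x2 x3] := vF q v1 qL h1'; have [y1 y2 y3] := vF q v2 qL h2'.
      by rewrite eE // x3 y3 andbF !addbF.
    split=> //.
    + by move=> u1 u2 u1F u2F; apply: connect_on_sub (b1 u1 u2 u1F u2F) => x y xF yF; rewrite xF yF vv.
    + by apply/negP => gq'; have [_ ] := vF q g qL gq'; rewrite eqxx.
    + by exists v; rewrite // (egv q).
    move=> h' v' hH vq'; have [y1 y2 y3] := vF q v' qL vq'; have /andP[x1 /negbTE x2] := Hg h' hH.
    have /andP[nn ne] := b4 h' v' hH vq'.
    by rewrite /nadj nn eE ?(Hc h') // x2 y3 andbF !addbF.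
  rewrite pairwise_map; have aLL : all (fun q => q \in L) L by apply/allP.
  apply: (sub_in_pairwise _ aLL aL) => q q' qL qL' /antisP hq /=; apply/antisP => u v uq vq.
  have /andP[nn ne] := hq u v uq vq.
  have [x1 x2 x3] := vF q u qL uq; have [y1 y2 y3] := vF q' v qL' vq.
  by rewrite /nadj nn eE // x3 y3 andbF !addbF.
apply: (h1 T e' g H L) => //.
- have aLL : all (fun q => q \in L) L by apply/allP.
  apply: (sub_in_pairwise _ aLL nL) => q q' qL qL' /and5P[/andP[t1 /eqP n1] /andP[t2 /eqP n2] _ u1 u2].
  apply/andP; split; apply/noNP => v vq.
    rewrite (ev q q') //; last by apply: contraNneq u1 => <-.
    by move: t1; rewrite /triv n1 => /eqNP ->; rewrite // addbb.
  rewrite (ev q' q) //; last by apply: contraNneq u2 => <-.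
  by move: t2; rewrite /triv n2 => /eqNP ->; rewrite // addbb.
- move=> q qL; have /andP[uq /eqNPn [v vq ne]] := allP oL q (sub q qL); rewrite uq /=.
  apply/forall_inPn; exists v => //; rewrite negbK (ev q q) //; last by apply: contraNneq uq => <-.
  by move: ne; case: (e c v); case: (e q.1 v).
by move: sL; rewrite [size (_ :: _)]/= ltnS; apply: leq_trans; apply: leq_addr.
Qed.

(** If every outside vertex were trivial, [F] would be one side of a split, described by the
    neighbourhood of [c]. *)
Lemma nontriv_exists (T : finType) (e : rel T) c (F : {set T}) : simple_graph e -> prime_graph e ->
  1 < #|F| -> 1 < #|~: F| -> exists2 u, u \notin F & ~~ triv e c u F.
Proof.
move=> [es ei] pr F2 F2'.
have [/existsP[u /andP[uF nt]]|none] := boolP [exists u, (u \notin F) && ~~ triv e c u F].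
  by exists u.
case: (pr F); apply/is_splitP; split=> //; exists (e c), (fun y => ~~ noN e y F) => x y xF yF.
have : triv e c y F.
  by apply: contraNT none => nt; apply/existsP; exists y; rewrite yF.
rewrite es /triv; case: (boolP (noN e y F)) => [/noNP h _|_ /eqNP h]; first by rewrite (negbTE (h x xF)) andbF.
by rewrite h // andbT.
Qed.

Lemma pair_distinguished (T : finType) (e : rel T) x y : simple_graph e -> prime_graph e ->
  x != y -> 1 < #|~: [set x; y]| -> exists w, e w x != e w y.
Proof.
move=> [es ei] pr xy c2.
have [/existsP[w h]|none] := boolP [exists w, e w x != e w y]; first by exists w.
case: (pr [set x; y]); apply/is_splitP; split=> //; first by rewrite cards2 xy.
exists xpredT, (e x) => u v; rewrite !inE => /orP[/eqP->//|/eqP->] _.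
have /existsPn /(_ v) := none; rewrite negbK => /eqP h; by rewrite es -h es.
Qed.

Lemma fibers_cliques (T : finType) (e : rel T) c H Fs l u n : simple_graph e -> broom e c H Fs l ->
  all (fun F : {set T} => (u \notin F) && ~~ triv e c u F) Fs -> n < size Fs ->
  vertex_minor (matched_cliques n) e.
Proof.
move=> sg br /allP hu sF; have [h1 h2 h3] := br.
have cu : c != u.
  case: Fs hu sF {br h2 h3} => // F Fs /(_ F (mem_head _ _)) /andP[_ nt] _.
  by apply: contraNneq nt => <-; rewrite /triv; apply/orP; right; apply/eqNP.
apply: (matched_of_fibers sg cu _ _ h3 sF) => F FF; have [b1 b2 b3 b4 b5] := h2 F FF.
  by have /andP[] := hu F FF.
have /andP[_ ] := hu F FF; rewrite /triv negb_or => /andP[/noNPn h4 /eqNPn h5]; split=> //.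
Qed.

(** Four rounds of Ramsey's theorem make each outside vertex behave uniformly on the later and on
    the earlier fibers: trivial or not, then empty or not. A vertex that is nontrivial on many
    fibers gives matched cliques; the remaining cases are those of [normal_step]. *)
Lemma step_big n m h w l : 1 < l -> exists N, forall (T : finType) (e : rel T) c H Fs,
  simple_graph e -> prime_graph e -> broom e c H Fs l -> size H <= h -> N <= size Fs ->
  outcome e n m H l.+1 w.
Proof.
move=> l1; have [N0 h0] := normal_step n m h w l.
have [N1 r1] := ramsey (N0 + n.+3); have [N2 r2] := ramsey (N1 + n.+3).
have [N3 r3] := ramsey (N2 + n.+3); have [N4 r4] := ramsey (N3 + n.+3).
(* The slack [n.+3] leaves more than [n] fibers after the pair of the distinguished vertex is set
   aside. *)
have aux a k : a + n.+3 <= k.+1 -> n < k by clear; lia.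
exists (N4 + 2) => T e c H Fs sg pr br sH sF; have [es ei] := sg.
pose u (F : {set T}) := odflt c [pick u | (u \notin F) && ~~ triv e c u F].
have uP F : F \in Fs -> (u F \notin F) && ~~ triv e c (u F) F.
  move=> FF; have [_ lF cF _ _] := br_fib br FF.
  have F2' : 1 < #|~: F|.
    have [G [GF GF']] : exists G, G \in Fs /\ G != F.
      have : 2 <= size Fs by apply: leq_trans sF; apply: leq_addl.
      have : pairwise (antis e) Fs := br_anti br; have fib := br_fib br.
      case: Fs fib {br FF sF} => [|A [|B Fs]] fib //= /andP[/andP[/antisP aAB _] _] _.
      have [EA|nA] := eqVneq A F; last by exists A; rewrite mem_head.
      exists B; rewrite !inE eqxx orbT; split=> //; rewrite -EA; apply/eqP => EB; subst B.
      have [_ _ _ [v vA _] _] := fib A (mem_head _ _).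
      by have := aAB v v vA vA; rewrite /nadj eqxx.
    have [_ _ cG [v vG _] _] := br_fib br GF.
    have vF : v \notin F.
      have := br_anti br; apply: contraTN => vF; apply/negP => pA.
      have [i iF eF] := nthP F FF; have [j jF eG] := nthP F GF.
      have W i' j' : i' < j' -> j' < size Fs -> v \in nth F Fs i' -> v \in nth F Fs j' -> False.
        move=> ij js vi vj; move/(pairwiseP F): pA => /(_ i' j'); rewrite !inE (ltn_trans ij js) js ij.
        by move=> /(_ isT isT isT) /antisP /(_ v v vi vj); rewrite /nadj eqxx.
      case: (ltngtP i j) => [ij|ij|ij]; last by move: GF'; rewrite -eF -eG ij eqxx.
        by apply: (W i j); rewrite ?eF ?eG.
      by apply: (W j i); rewrite ?eF ?eG.
    rewrite -(_ : #|[set c; v]| = 2); last first.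
      by rewrite cards2 (_ : c != v) //; apply: contraNneq cG => ->.
    by apply/subset_leq_card/subsetP => z; rewrite !inE => /orP[] /eqP->.
  rewrite /u; case: pickP => [z //|none].
  have [z zF nt] := nontriv_exists c sg pr (leq_trans l1 lF) F2'.
  by have := none z; rewrite zF nt.
pose L := [seq (u F, F) | F <- Fs].
have sndL : map snd L = Fs by rewrite -map_comp map_id_in.
have LP q : q \in L -> (q.1 \notin q.2) && ~~ triv e c q.1 q.2 by move=> /mapP[F FF ->]; apply: uP.
have memF q : q \in L -> q.2 \in Fs by move=> /mapP[F FF ->].
have anL : pairwise (fun q q' : T * {set T} => antis e q.2 q'.2) L by have := br_anti br; rewrite -sndL pairwise_map.
have out (q q' : T * {set T}) : q \in L -> antis e q.2 q'.2 || antis e q'.2 q.2 -> q.1 \notin q'.2.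
  move=> qL an; have /andP[_] := LP q qL; rewrite /triv negb_or => /andP[/noNPn [v vq ev] _].
  apply: contraTN ev => uq; have : nadj e v q.1 || nadj e q.1 v.
    by case/orP: an => /antisP a; [rewrite a | rewrite (a q.1 v) // orbT].
  by rewrite [nadj e v _]nadjC // orbb => /andP[].
have brs L' : subseq L' L -> broom e c H (map snd L') l.
  by move=> ss; apply: broom_sub br; rewrite -sndL; apply: map_subseq.
have [|L1 [b1 [s1 z1 p1]]] := r4 _ (fun q q' : T * {set T} => triv e c q.1 q'.2) L.
  by rewrite size_map; apply: leq_trans sF; apply: leq_addr.
case: b1 p1 => p1; last first.
  left; case: L1 s1 z1 p1 => [|q0 L1] s1 z1; first by rewrite addnS in z1.
  rewrite pairwise_cons => /andP[/allP p1 _].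
  apply: (@fibers_cliques _ e c H (map snd L1) l q0.1) => //.
  - by apply: brs; apply: subseq_trans s1; apply: subseq_cons.
  - have := subseq_pairwise s1 anL; rewrite pairwise_cons => /andP[/allP aq _].
    apply/allP => F /mapP[q qL ->]; rewrite (out q0 q) ?aq ?(mem_subseq s1) ?mem_head //=.
    by have /eqP -> := p1 q qL.
  by rewrite size_map; apply: aux z1.
have [|L2 [b2 [s2 z2 p2]]] := r3 _ (fun q q' : T * {set T} => triv e c q'.1 q.2) L1.
  by apply: leq_trans z1; apply: leq_addr.
have s2' := s2; have {}s2 := subseq_trans s2 s1.
case: b2 p2 => p2; last first.
  left; case/lastP: L2 s2 s2' z2 p2 => [|L2 q0] s2 _ z2; first by rewrite addnS in z2.
  rewrite pairwise_rcons => /andP[/allP p2 _].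
  have q0L : q0 \in L by apply: (mem_subseq s2); rewrite mem_rcons mem_head.
  apply: (@fibers_cliques _ e c H (map snd L2) l q0.1) => //.
  - by apply: brs; apply: subseq_trans s2; apply: subseq_rcons.
  - have := subseq_pairwise s2 anL; rewrite pairwise_rcons => /andP[/allP aq _].
    apply/allP => F /mapP[q qL ->]; rewrite (out q0 q) ?aq ?orbT //=.
    by have /eqP -> := p2 q qL.
  by rewrite size_map; rewrite size_rcons in z2; apply: aux z2.
have [|L3 [b3 [s3 z3 p3]]] := r2 _ (fun q q' : T * {set T} => noN e q.1 q'.2) L2.
  by apply: leq_trans z2; apply: leq_addr.
have [|L4 [b4 [s4 z4 p4]]] := r1 _ (fun q q' : T * {set T} => noN e q'.1 q.2) L3.
  by apply: leq_trans z3; apply: leq_addr.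
have s34 := subseq_trans s4 s3; have s5 := subseq_trans s34 s2.
apply: (h0 T e c H L4 (~~ b3) (~~ b4)) => //; [exact: brs | | by apply: leq_trans z4; apply: leq_addr].
apply/andP; split; last first.
  apply/allP => q /(mem_subseq s5) /LP /andP[-> nt] /=; move: nt; rewrite /triv negb_or => /andP[t1 t2].
  by case: ifP.
have aL : all (fun q => q \in L4) L4 by apply/allP.
have : pairwise (fun q q' : T * {set T} => [&& antis e q.2 q'.2, triv e c q.1 q'.2, triv e c q'.1 q.2,
    noN e q.1 q'.2 == b3 & noN e q'.1 q.2 == b4]) L4.
  move: (subseq_pairwise s5 anL) (subseq_pairwise (subseq_trans s34 s2') p1) (subseq_pairwise s34 p2)
    (subseq_pairwise s4 p3) p4.
  elim: (L4) => //= q L0 IH /andP[a1 /IH {}IH] /andP[a2 /IH {}IH] /andP[a3 /IH {}IH] /andP[a4 /IH {}IH] /andP[a5 /IH ->].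
  rewrite andbT; apply/allP => x xL.
  by move: (allP a1 x xL) (allP a2 x xL) (allP a3 x xL) (allP a4 x xL) (allP a5 x xL) => /= -> /eqP -> /eqP -> -> ->.
move=> pA; apply: (sub_in_pairwise _ aL pA) => q q' /(mem_subseq s5) qL /(mem_subseq s5) qL' /and5P[an t1 t2 /eqP n1 /eqP n2].
rewrite t1 t2 n1 n2 !negbK !eqxx /= (out q q') ?an // (out q' q) ?an ?orbT // !andbT.
apply/negP => /eqP qq; have /andP[_] := LP q' qL'; by rewrite -qq t1.
Qed.

(** Every vertex is trivial on a singleton seen by [c], so primality is applied to pairs of
    singletons instead. [distinguish] then yields vertices that separate their own singleton from
    all later ones. *)
Lemma step_single n m h w : exists N, forall (T : finType) (e : rel T) c H Fs,
  simple_graph e -> prime_graph e -> broom e c H Fs 1 -> all (fun F : {set T} => #|F| == 1) Fs ->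
  size H <= h -> N <= size Fs -> outcome e n m H 2 w.
Proof.
have [N0 h0] := normal_step n m h w 1; have [N1 r1] := ramsey N0.
(* The summand 3 provides a third fiber for any two given ones; together with [c] it makes the
   complement of the pair large enough for [pair_distinguished]. *)
exists (2 ^ N1.*2 + 3) => T e c H Fs sg pr br /allP F1 sH sF; have [es ei] := sg.
pose f (F : {set T}) := odflt c [pick v in F].
have fP F : F \in Fs -> F = [set f F].
  by move=> /F1 /cards1P [v ->]; rewrite /f; case: pickP => [v'|/(_ v)]; rewrite inE ?eqxx // => /eqP ->.
have fmem F : F \in Fs -> f F \in F by move=> FF; have := set11 (f F); rewrite -(fP F FF).
pose s := map f Fs; have ss : size s = size Fs by rewrite size_map.
have adj : pairwise (nadj e) s.
  rewrite pairwise_map; have aF : all (fun F => F \in Fs) Fs by apply/allP.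
  apply: (sub_in_pairwise _ aF (br_anti br)) => F G FF GF /antisP h1 /=.
  by apply: h1; apply: fmem.
have us : uniq s by rewrite uniq_pairwise; apply: sub_pairwise adj => x y /andP[].
have indep x y : x \in s -> y \in s -> x != y -> nadj e x y.
  move=> /(nthP x) [i si <-] /(nthP x) [j sj <-] nij.
  case: (ltngtP i j) => ij; last by move: nij; rewrite ij eqxx.
    by move/(pairwiseP x): adj; apply; rewrite ?inE.
  by rewrite nadjC //; move/(pairwiseP x): adj; apply; rewrite ?inE.
have cs x : x \in s -> (c != x) && e c x.
  move=> /mapP[F FF ->]; have [_ _ cF [v vF cv] _] := br_fib br FF.
  have -> : f F = v by apply/esym/eqP; rewrite -in_set1 -(fP F FF).
  by rewrite cv andbT; apply: contraNneq cF => ->.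
have dist x y : x \in s -> y \in s -> x != y -> exists w, e w x != e w y.
  move=> xs ys xy; apply: pair_distinguished => //.
  have [z zs zxy] : exists2 z, z \in s & z \notin [:: x; y].
    have [/hasP[z zs h1]|/hasPn h1] := boolP (has (fun z => z \notin [:: x; y]) s); first by exists z.
    have : size s <= 2 by apply: (@uniq_leq_size _ s [:: x; y] us) => z /h1; rewrite negbK.
    by rewrite ss => h2; move: (leq_trans sF h2); rewrite addnS ltnS addnS ltnS addnS ltn0 ?addn0.
  rewrite -(_ : #|[set c; z]| = 2); last by rewrite cards2; have /andP[-> _] := cs z zs.
  apply/subset_leq_card/subsetP => t; rewrite !inE => /orP[] /eqP->.
    by rewrite negb_or; have /andP[-> _] := cs x xs; have /andP[-> _] := cs y ys.
  by move: zxy; rewrite !inE.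
have [|ps [sz1 sub u2 pw hs]] := @distinguish T T e N1.*2 s _ us dist.
  by rewrite ss; apply: leq_trans sF; apply: leq_addr.
have [|ps1 [d [s1 z1 a1]]] := @majority _ (fun p : T * T => e p.1 p.2) ps N1; first by rewrite sz1.
have [ps2 [b [s2 z2 p2]]] := r1 _ (fun q q' : T * T => e q'.1 q.2) ps1 z1.
have s12 := subseq_trans s2 s1.
pose L := [seq (p.1, [set p.2]) | p <- ps2].
have inS p : p \in ps2 -> p.2 \in s by move=> /(mem_subseq s12) pp; apply: sub; apply: map_f.
have wS p q : p \in ps2 -> q \in ps2 -> p.1 != q.2.
  move=> /(mem_subseq s12) pp qp; have /andP[/hasP[x xs ex] _] := allP hs p pp.
  apply: contraTneq ex => ->; have [->|nx] := eqVneq x q.2; first by rewrite ei.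
  by have /andP[] : nadj e q.2 x by apply: indep; rewrite ?inS // eq_sym.
have fibS p : p \in ps2 -> [set p.2] \in Fs by move=> /inS /mapP[F FF ->]; rewrite -(fP F FF).
(* [d] is the value on the own singleton; by choice of the pairs the value on later ones is [~~ d],
   and on earlier ones it is [b]. *)
apply: (h0 T e c H L (~~ d) b) => //; last by rewrite size_map.
  split; first exact: br_path br.
    by move=> F; rewrite -map_comp => /mapP[p pp ->]; apply: br_fib br _ (fibS p pp).
  rewrite -map_comp pairwise_map; have ap : all (fun p => p \in ps2) ps2 by apply/allP.
  have : pairwise (fun p q => p.2 != q.2) ps2.
    by have := subseq_uniq (map_subseq snd s12) u2; rewrite uniq_pairwise pairwise_map.
  move=> pp; apply: (sub_in_pairwise _ ap pp) => p q hp hq npq /=.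
  by apply/antisP => x y; rewrite !inE => /eqP-> /eqP->; apply: indep; rewrite ?inS.
have noN1 u x : noN e u [set x] = ~~ e u x.
  by apply/noNP/idP => [h1|h1 v]; [apply: h1; rewrite inE | rewrite inE => /eqP ->].
have tr u p : p \in ps2 -> triv e c u [set p.2].
  move=> /inS /cs /andP[_ ec]; rewrite /triv noN1; case eu : (e u p.2) => //=.
  by apply/eqNP => v; rewrite inE => /eqP ->; rewrite eu ec.
have dd p : p \in ps2 -> e p.1 p.2 = d by move=> /(mem_subseq s2) /(allP a1) /eqP.
apply/andP; split.
  rewrite pairwise_map; have ap : all (fun p => p \in ps2) ps2 by apply/allP.
  have : pairwise (fun q q' : T * T => (e q'.1 q.2 == b) && (e q.1 q'.2 != e q.1 q.2)) ps2.
    move: p2 (subseq_pairwise s12 pw); elim: (ps2) => //= q L0 IH /andP[a /IH {}IH] /andP[a' /IH ->].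
    by rewrite andbT; apply/allP => x xL; rewrite (allP a x xL) (allP a' x xL).
  move=> pp; apply: (sub_in_pairwise _ ap pp) => p q hp hq /andP[/eqP e1 e2] /=.
  rewrite !tr // !noN1 e1 eqxx !inE !wS // (dd p hp) in e2 *.
  have e3 : e p.1 q.2 = ~~ d by case: (e _ _) (d) e2 => -[].
  rewrite e3 eqxx /=; rewrite andbT; apply: contraTneq isT => pq.
  by have := dd q hq; rewrite -pq e3; case: (d).
apply/allP => _ /mapP[p pp ->] /=; rewrite inE wS //=.
case: ifP => hd; last by rewrite noN1 dd // negbK; move/negbFE: hd.
apply/forall_inPn; exists p.2; rewrite ?inE //.
by rewrite dd //; have /andP[_ ->] := cs _ (inS p pp); case: (d) hd.
Qed.

Lemma grow_step n m h w l : 0 < l -> exists N, forall (T : finType) (e : rel T) c H Fs,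
  simple_graph e -> prime_graph e -> broom e c H Fs l -> size H <= h -> N <= size Fs ->
  outcome e n m H l.+1 w.
Proof.
move=> l0; case: (ltnP 1 l) => l1; first exact: step_big.
have {l0 l1} -> : l = 1 by apply/eqP; rewrite eqn_leq l1 l0.
have [N h1] := step_single n m h w; exists (N + w).*2 => T e c H Fs sg pr br sH sF.
have [Fs' [b [ss sz al]]] := majority (fun F : {set T} => #|F| == 1) sF.
have br' := broom_sub ss br.
case: b al => al.
  apply: (h1 T e c H Fs') => //; last by apply: leq_trans sz; apply: leq_addr.
  by apply: sub_all al => F /eqP.
right; right; exists e, c, Fs'; split; first exact: lequiv_refl.
  case: br' => b1 b2 b3; split=> // F FF; have [c1 c2 c3 c4 c5] := b2 F FF; split=> //.
  by have /eqP := allP al F FF; move: c2; rewrite leq_eqVlt eq_sym => /orP[->|].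
by apply: leq_trans sz; apply: leq_addl.
Qed.

(** * Stars, and zooming into a huge fiber *)

Lemma star_indep (T : finType) (e : rel T) z H M : simple_graph e -> ipath e (z :: H) ->
  (forall x, x \in M -> e z x /\ forall h, h \in H -> nadj e h x) -> uniq M ->
  pairwise (fun x y => ~~ e x y) M ->
  broom e z H [seq [set x] | x <- M] 1.
Proof.
move=> [es ei] ip hM uM pM; split=> //.
  move=> F /mapP[x xM ->]; have [zx hx] := hM x xM; split.
  - by move=> u v /set1P-> /set1P->; apply: connect0.
  - by rewrite cards1.
  - by rewrite inE; apply: contraTneq zx => ->; rewrite ei.
  - by exists x; rewrite ?inE.
  by move=> h v hH /set1P->; apply: hx.
rewrite pairwise_map.
have : pairwise [rel x y | (x != y) && ~~ e x y] M by rewrite pairwise_relI -uniq_pairwise uM.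
by apply: sub_pairwise => x y xy; apply/antisP => u v /set1P-> /set1P->.
Qed.

(** Complementing at the leaf [x0] dissolves the clique of the other leaves and detaches them from
    [z]. So [x0] is the new center, and [z] joins the handle. *)
Lemma star_clique (T : finType) (e : rel T) z H x0 M : simple_graph e -> ipath e (z :: H) ->
  (forall x, x \in x0 :: M -> e z x /\ forall h, h \in H -> nadj e h x) -> uniq (x0 :: M) ->
  pairwise (fun x y => e x y) (x0 :: M) ->
  broom (local_compl e x0) x0 (z :: H) [seq [set x] | x <- M] 1.
Proof.
move=> sg ip hM uM; rewrite pairwise_cons => /andP[/allP x0M pM]; have [es ei] := sg.
have sg1 := lc_sg x0 sg; set e1 := local_compl e x0 in sg1 *; have [es1 ei1] := sg1.
have [zx0 hx0] := hM x0 (mem_head _ _).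
have rowH h t : h \in H -> e1 h t = e h t.
  by move=> hH; have /andP[_ /negbTE n] := hx0 h hH; rewrite /e1 lcE (es x0 h) n andbF addbF.
have e1x t : e1 x0 t = e x0 t by rewrite /e1 lc_nbr.
have inM x : x \in M -> x \in x0 :: M by move=> xM; rewrite inE xM orbT.
have zx x : x \in x0 :: M -> z != x by move=> /hM [zx _]; apply: contraTneq zx => ->; rewrite ei.
apply: star_indep => //.
- rewrite ipath_cons2; apply/and3P; split; first by rewrite e1x es.
    by apply/allP => h hH; have /andP[n1 n2] := hx0 h hH; rewrite /nadj eq_sym n1 es1 rowH.
  rewrite -(eq_ipath (e := e)) // => u v; rewrite !inE => /orP[/eqP->|uH]; last by rewrite rowH.
  by move=> /orP[/eqP->|vH]; rewrite ?ei ?ei1 // es1 rowH // es.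
- move=> x xM; rewrite e1x x0M //; split=> // h; rewrite inE => /orP[/eqP->|hH].
    have [zx' _] := hM x (inM x xM).
    by rewrite /nadj zx ?inM // /e1 lcE zx' zx ?inM // (es x0 z) zx0 x0M.
  by have [_ hx] := hM x (inM x xM); rewrite /nadj rowH //; apply: hx.
- by case/andP: uM.
have aM : all (fun x => x \in M) M by apply/allP.
have : pairwise [rel x y | e x y && (x != y)] M.
  by rewrite pairwise_relI -uniq_pairwise pM; case/andP: uM.
move=> pM'; apply: (sub_in_pairwise _ aM pM') => x y xM yM /andP[exy xy].
by rewrite /e1 lcE exy xy !x0M.
Qed.

Lemma star_broom w : exists N, forall (T : finType) (e : rel T) z H M, simple_graph e ->
  ipath e (z :: H) -> (forall x, x \in M -> e z x /\ forall h, h \in H -> nadj e h x) -> uniq M ->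
  N <= size M ->
  exists e' c' H' Fs, [/\ lequiv e e', broom e' c' H' Fs 1, w <= size Fs & size H <= size H'].
Proof.
have [N hN] := ramsey w.+1; exists N => T e z H M sg ip hM uM sM.
have [M' [b [ss sz pb]]] := hN _ e M sM; have sub := mem_subseq ss.
have uM' := subseq_uniq ss uM.
have hM' x : x \in M' -> e z x /\ forall h, h \in H -> nadj e h x by move=> /sub /hM.
case: b pb => pb; last first.
  exists e, z, H, [seq [set x] | x <- M']; split=> //; first exact: lequiv_refl.
    by apply: star_indep => //; apply: sub_pairwise pb => x y /eqP ->.
  by rewrite size_map; apply: ltnW.
case: M' ss sz sub uM' hM' pb => // x0 M' ss sz sub uM' hM' pb.
exists (local_compl e x0), x0, (z :: H), [seq [set x] | x <- M']; split.
- exact/lequiv_lc/lequiv_refl.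
- by apply: star_clique => //; apply: sub_pairwise pb => x y /eqP.
- by rewrite size_map.
exact: leqnSn.
Qed.

(* Follow the path from [d] towards the handle as long as many leaves are adjacent to it. *)
Lemma last_center k w : exists N, forall (T : finType) (e : rel T) d q M, size q <= k ->
  all (e d) M -> N <= size M ->
  exists q1 p q2 M', [/\ d :: q = q1 ++ p :: q2, subseq M' M, w <= size M', all (e p) M' &
    forall h, h \in q2 -> all (fun x => ~~ e h x) M'].
Proof.
elim: k => [|k [N IH]].
  by exists w => T e d [|//] M _ aM sM; exists [::], d, [::], M; split.
have [N' h'] := unary_handle k.+1 (N + w); exists N' => T e d q M sq aM sM.
have [[p [M1 [pq ss sz al]]]|[M1 [ss sz al]]] := h' _ _ e q M sq sM; last first.
  exists [::], d, q, M1; split=> //; first by apply: leq_trans sz; apply: leq_addl.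
  by apply/allP => x /(mem_subseq ss) /(allP aM).
case/splitPr: pq sq => q1 q2 sq.
have [||q3 [p' [q4 [M2 [e1 s2 z2 a2 n2]]]]] := IH T e p q2 M1 _ al.
- by move: sq; rewrite size_cat /= addnS ltnS; apply: leq_trans; apply: leq_addl.
- by apply: leq_trans sz; apply: leq_addr.
exists (d :: q1 ++ q3), p', q4, M2; split=> //; first by rewrite e1 /= -catA.
exact: subseq_trans s2 ss.
Qed.

(** Without a long induced path, the fiber has a vertex [d] of large degree. If [c] misses many
    neighbours of [d], a path in the fiber from [d] to the handle prolongs the handle, with the
    center at the last vertex that sees many of these leaves. If [c] sees many of them, a clique
    among them puts [c] into the handle by [star_clique]; an independent set is first turned into a
    clique, and detached from [c], by complementing at [d]. *)
Lemma zoom m w : exists N, forall (T : finType) (e : rel T) c H (F : {set T}) Fs l, simple_graph e ->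
  broom e c H Fs l -> F \in Fs -> N < #|F| ->
  (exists p, ipath e p /\ m <= size p) \/
  exists e' c' H' Fs', [/\ lequiv e e', broom e' c' H' Fs' 1, w <= size Fs' & size H < size H'].
Proof.
have [N1 h1] := star_broom w; have [N2 h2] := last_center m N1; have [N3 h3] := ramsey w.+2.
exists ((N2 + m + N3).*2.+1 ^ m) => T e c H F Fs l sg br FF cF; have [es ei] := sg.
have [cnF _ cnotF [v0 v0F cv0] HF] := br_fib br FF; have ipH := br_path br.
have [/existsP[t it]|nt] := boolP [exists t : m.+1.-tuple T, ipath e t].
  by left; exists t; rewrite size_tuple; split.
have short p : ipath e p -> size p <= m.
  move=> ip; rewrite leqNgt; apply: contra nt => sp; apply/existsP.
  have st : size (take m.+1 p) == m.+1 by rewrite size_takel.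
  exists (Tuple st) => /=; apply: (@ipath_catl _ _ _ (drop m.+1 p)); by rewrite cat_take_drop.
right.
have [/existsP[d /andP[dF hd]]|nd] := boolP [exists d, (d \in F) && ((N2 + m + N3).*2 < #|[set w in F | e d w]|)]; last first.
  have : #|F| <= (N2 + m + N3).*2.+1 ^ m.
    apply: (moore cnF) => [v vF|p ip _]; last exact: short.
    by rewrite leqNgt; apply: contra nd => h; apply/existsP; exists v; rewrite vF.
  by rewrite leqNgt cF.
set NB := [set w in F | e d w] in hd.
have [|M [b [ss sz al]]] := @majority _ (e c) (enum NB) (N2 + m + N3); first by rewrite -cardE ltnW.
have uM : uniq M by apply: subseq_uniq ss (enum_uniq _).
have MF x : x \in M -> x \in F /\ e d x by move=> /(mem_subseq ss); rewrite mem_enum inE => /andP[].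
have dc : d != c by apply: contraNneq cnotF => <-.
case: b al => al; last first.
  have [q [iq aq lq bq]] := connect_ipath (Q := e c) (cnF d v0 dF v0F) cv0.
  have qF z : z \in d :: q -> z \in F by rewrite inE => /orP[/eqP->//|/(allP aq)].
  have ipq : ipath e ((d :: q) ++ c :: H).
    rewrite lastI ipath_cat -lastI iq ipH es lq /=; apply/andP; split.
      apply/antiP => x y xb; have xF : x \in F by apply: qF; rewrite lastI mem_rcons inE xb orbT.
      rewrite inE => /orP[/eqP->|yH]; last by rewrite nadjC //; apply: HF.
      have nx : ~~ e c x := allP bq x xb.
      by rewrite /nadj es nx andbT; apply: contraNneq cnotF => <-.
    by apply/allP => y yH; rewrite nadjC //; apply: HF => //; apply: qF; apply: mem_last.
  pose M0 := filter (fun x => x \notin d :: q) M.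
  have sM0 : N2 <= size M0.
    have : size M = size (filter (mem (d :: q)) M) + size M0.
      by rewrite /M0 !size_filter count_predC.
    have : size (filter (mem (d :: q)) M) <= size (d :: q).
      apply: uniq_leq_size; first exact: filter_uniq.
      by move=> x; rewrite mem_filter => /andP[].
    have := short _ iq; move: sz; move: (size M) (size (filter _ M)) (size M0) (size (d :: q)).
    clear; lia.
  have sq : size q <= m by apply: ltnW; apply: (short (d :: q)).
  have aM0 : all (e d) M0 by apply/allP => x; rewrite mem_filter => /andP[_ /MF []].
  have [q1 [p [q2 [M' [eq' ss' sz' ap nq]]]]] := h2 T e d q M0 sq aM0 sM0.
  have ssM : subseq M' M := subseq_trans ss' (filter_subseq _ _).
  have ipp : ipath e (p :: q2 ++ c :: H).
    by apply: (@ipath_catr _ _ q1); move: ipq; rewrite eq' -catA.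
  have [|e' [c' [H' [Fs' [l1 l2 l3 l4]]]]] := h1 T e p (q2 ++ c :: H) M' sg ipp _ (subseq_uniq ssM uM) sz'.
    move=> x xM; split; first exact: (allP ap).
    have xM' := mem_subseq ssM xM; have [xF dx] := MF x xM'.
    move=> h; rewrite mem_cat inE => /or3P[hq|/eqP->|hH]; last exact: HF.
      rewrite /nadj (allP (nq h hq) x xM) andbT; apply: contraTneq (mem_subseq ss' xM) => <-.
      by rewrite mem_filter eq' mem_cat inE hq !orbT.
    rewrite /nadj (eqP (allP al x xM')) andbT; by apply: contraNneq cnotF => ->.
  exists e', c', H', Fs'; split=> //; apply: leq_trans l4.
  by rewrite size_cat /= addnS ltnS leq_addl.
have [|M1 [b [ss1 sz1 p1]]] := h3 _ e M; first by apply: leq_trans sz; apply: leq_addl.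
have uM1 := subseq_uniq ss1 uM.
have cM1 x : x \in M1 -> e c x by move=> /(mem_subseq ss1) /(allP al) /eqP.
have MF1 x : x \in M1 -> x \in F /\ e d x by move=> /(mem_subseq ss1) /MF.
case: b p1 => p1.
  case: M1 ss1 sz1 uM1 cM1 MF1 p1 => // x0 M1 ss1 sz1 uM1 cM1 MF1 p1.
  exists (local_compl e x0), x0, (c :: H), [seq [set x] | x <- M1]; split=> //.
  - exact/lequiv_lc/lequiv_refl.
  - apply: star_clique => //; last by apply: sub_pairwise p1 => x y /eqP.
    by move=> x xM; split; [apply: cM1 | move=> h hH; apply: HF => //; have [] := MF1 x xM].
  by rewrite size_map ltnW.
(* The complementation at [d] detaches the leaves from [c] only if [c] and [d] are adjacent; if they
   are not, one leaf is spent to join them. *)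
have [e1 [M2 [le1 c1 [ss2 sz2] [rowH rowM] cd]]] : exists e1 M2, [/\ lequiv e e1, True, subseq M2 M1 /\ w.+1 <= size M2,
    (forall h t, h \in H -> e1 h t = e h t) /\ (forall x t, x \in M2 -> e1 x t = e x t) & e1 c d].
  have [cd|ncd] := boolP (e c d).
    by exists e, M1; split=> //; [apply: lequiv_refl | split=> //; apply: ltnW].
  case: M1 ss1 sz1 uM1 cM1 MF1 p1 => // x0 M1 ss1 sz1 uM1 cM1 MF1.
  rewrite pairwise_cons => /andP[/allP px _].
  have [x0F dx0] := MF1 x0 (mem_head _ _).
  exists (local_compl e x0), M1; split=> //.
  - exact/lequiv_lc/lequiv_refl.
  - by split=> //; apply: subseq_cons.
  - split=> [h t hH|x t xM]; rewrite lcE.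
      by have /andP[_ /negbTE n] := HF h x0 hH x0F; rewrite (es x0 h) n andbF addbF.
    by rewrite (eqP (px x xM)) andbF addbF.
  by rewrite lcE (negbTE ncd) eq_sym dc (es x0) cM1 ?mem_head // (es x0) dx0.
have sg1 := lequiv_sg le1 sg; have [es1 ei1] := sg1.
have sub2 := mem_subseq ss2; have uM2 := subseq_uniq ss2 uM1.
have p2 := subseq_pairwise ss2 p1.
pose e2 := local_compl e1 d; have sg2 : simple_graph e2 := lc_sg d sg1; have [es2 ei2] := sg2.
have dH h : h \in H -> nadj e1 h d by move=> hH; rewrite /nadj rowH //; apply: HF.
have rowH2 h t : h \in H -> e2 h t = e h t.
  by move=> hH; have /andP[_ /negbTE n] := dH h hH; rewrite /e2 lcE (es1 d h) n andbF addbF rowH.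
have dM2 x : x \in M2 -> e1 d x by move=> xM; rewrite es1 rowM // es; have [] := MF1 x (sub2 x xM).
have e2d t : e2 d t = e1 d t by rewrite /e2 lc_nbr.
have ip2 : ipath e2 (d :: c :: H).
  rewrite ipath_cons2; apply/and3P; split; first by rewrite e2d es1.
    by apply/allP => h hH; have /andP[n1 n2] := dH h hH; rewrite /nadj eq_sym n1 e2d es1.
  rewrite -(eq_ipath (e := e)) // => u v; rewrite !inE => /orP[/eqP->|uH]; last by rewrite rowH2.
  by move=> /orP[/eqP->|vH]; rewrite ?ei ?ei2 // es2 rowH2 // es.
have hM2 x : x \in M2 -> e2 d x /\ forall h, h \in c :: H -> nadj e2 h x.
  move=> xM; rewrite e2d dM2 //; split=> // h; have [xF _] := MF1 x (sub2 x xM).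
  rewrite inE => /orP[/eqP->|hH]; last by rewrite /nadj rowH2 //; apply: HF.
  have cx : c != x by apply: contraNneq cnotF => ->.
  by rewrite /nadj cx /e2 lcE cx (es1 d c) cd dM2 // es1 rowM // es cM1 ?sub2.
case: M2 ss2 sz2 rowM sub2 uM2 p2 dM2 hM2 => // x0 M2 ss2 sz2 rowM sub2 uM2 p2 dM2 hM2.
exists (local_compl e2 x0), x0, (d :: c :: H), [seq [set x] | x <- M2]; split.
- exact/lequiv_lc/lequiv_lc.
- apply: star_clique => //.
  have aM : all (fun x => x \in x0 :: M2) (x0 :: M2) by apply/allP.
  have : pairwise [rel x y | (e x y == false) && (x != y)] (x0 :: M2).
    by rewrite pairwise_relI -uniq_pairwise uM2 andbT.
  move=> pM'; apply: (sub_in_pairwise _ aM pM') => x y xM yM /andP[/eqP exy xy].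
  by rewrite /e2 lcE rowM // exy xy !dM2.
- by rewrite size_map.
by rewrite /= ltnS leqnSn.
Qed.

Lemma grow_fibers n m h d : forall l w, 0 < l -> exists N, forall (T : finType) (e : rel T) c H Fs,
  simple_graph e -> prime_graph e -> broom e c H Fs l -> size H <= h -> N <= size Fs ->
  outcome e n m H (d + l) w.
Proof.
elim: d => [|d IH] l w l0.
  by exists w => T e c H Fs sg pr br sH sF; right; right; exists e, c, Fs; split=> //; apply: lequiv_refl.
have [N1 h1] := IH l.+1 w isT; have [N2 h2] := grow_step n m h N1 l0.
exists N2 => T e c H Fs sg pr br sH sF; rewrite addSnnS.
have [vm|[pp|[e' [c' [Fs' [le br' sF']]]]]] := h2 T e c H Fs sg pr br sH sF; [by left | by right; left |].
by apply: (outcome_lequiv le); apply: h1 br' sH sF'; [apply: lequiv_sg le sg | apply: prime_lequiv le sg pr].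
Qed.

Definition path_or_cliques (T : finType) (e : rel T) n m :=
  vertex_minor (matched_cliques n) e \/ exists e' p, [/\ lequiv e e', ipath e' p & m <= size p].

Lemma poc_lequiv (T : finType) (e e' : rel T) n m : lequiv e e' ->
  path_or_cliques e' n m -> path_or_cliques e n m.
Proof.
move=> le [h|[e1 [p [l1 i1 s1]]]]; first by left; apply: vm_lequiv le h.
by right; exists e1, p; split=> //; apply: lequiv_trans le l1.
Qed.

(** [k] is what the handle lacks to length [m]. Growing the fibers until one is huge and zooming
    into it lowers [k]. *)
Lemma broom_wins n m k : exists N, forall (T : finType) (e : rel T) c H Fs,
  simple_graph e -> prime_graph e -> broom e c H Fs 1 -> m <= size H + k -> N <= size Fs ->
  path_or_cliques e n m.
Proof.
elim: k => [|k [N1 IH]].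
  exists 0 => T e c H Fs sg pr br; rewrite addn0 => sH _; right; exists e, (c :: H); split.
  - exact: lequiv_refl.
  - exact: br_path br.
  exact: leqW.
(* A single fiber with more than [N2] vertices is enough for [zoom], so the fibers are grown with
   [w = 1]. *)
have [N2 h2] := zoom m N1; have [N3 h3] := @grow_fibers n m m N2 1 1 isT.
exists N3 => T e c H Fs sg pr br sH sF.
have [mH|mH] := leqP m (size H).
  right; exists e, (c :: H); split; [exact: lequiv_refl | exact: br_path br | exact: leqW].
have [vm|[pp|[e1 [c1 [Fs1 [le1 br1 sF1]]]]]] := h3 T e c H Fs sg pr br (ltnW mH) sF; [by left | by right |].
case: Fs1 br1 sF1 => // F Fs1 br1 _; have sg1 := lequiv_sg le1 sg.
have FF : F \in F :: Fs1 by rewrite mem_head.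
have [_ lF _ _ _] := br_fib br1 FF; rewrite addn1 in lF.
apply: (poc_lequiv le1).
have [[p [ip sp]]|[e2 [c2 [H2 [Fs2 [le2 br2 sF2 sH2]]]]]] := h2 _ _ _ _ _ _ _ sg1 br1 FF lF.
  by right; exists e1, p; split=> //; apply: lequiv_refl.
apply: (poc_lequiv le2); apply: (IH _ _ _ _ _ _ _ br2 _ sF2).
- exact: lequiv_sg le2 sg1.
- exact: prime_lequiv le2 sg1 (prime_lequiv le1 sg pr).
by apply: leq_trans sH _; rewrite addnS -addSn leq_add2r.
Qed.

(** * From large prime graphs to the theorem *)

Lemma prime_connected (T : finType) (e : rel T) : simple_graph e -> prime_graph e -> 3 < #|T| ->
  connd e (mem [set: T]).
Proof.
move=> [es ei] pr T4.
suff h x y : connect e x y.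
  move=> x y _ _; apply: connect_sub (h x y) => u v euv; apply: connect1.
  by rewrite /rel_on !inE.
apply/negPn/negP => nxy.
pose A := [set z | connect e x z].
have nA u v : u \in A -> v \notin A -> e u v = false.
  rewrite !inE => xu; apply: contraNF => euv; exact: connect_trans xu (connect1 euv).
have xA : x \in A by rewrite inE connect0.
have yA : y \notin A by rewrite inE.
have xy : x != y by apply: contraNneq yA => <-.
have c2 : 1 < #|[set x; y]| by rewrite cards2 xy.
have c2' : 1 < #|~: [set x; y]|.
  by have := cardsC [set x; y]; rewrite cards2 xy; move: T4; clear; lia.
(* Either the component of [x] and its complement have two vertices each, or [x] or [y] is isolated. *)
have [lA|lA] := leqP 2 #|A|; last first.
  have eA : A = [set x].
    by apply/eqP; rewrite eq_sym eqEcard sub1set xA cards1 -ltnS.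
  case: (pr [set x; y]); apply/is_splitP; split=> //; exists (fun z => z == y), (e y) => u v.
  rewrite !inE => /orP[/eqP->|/eqP->] hv; last by rewrite eqxx.
  rewrite (negbTE xy) nA // eA !inE; by case/norP: hv.
have [lA'|lA'] := leqP 2 #|~: A|.
  case: (pr A); apply/is_splitP; split=> //; exists (fun _ => false), (fun _ => false) => u v uA vA.
  exact: nA.
have eA : ~: A = [set y].
  by apply/eqP; rewrite eq_sym eqEcard sub1set inE yA cards1 -ltnS.
case: (pr [set x; y]); apply/is_splitP; split=> //; exists (fun z => z == x), (e x) => u v.
rewrite !inE => /orP[/eqP->|/eqP->] hv; first by rewrite eqxx.
rewrite eq_sym (negbTE xy) es nA //; have : v \notin ~: A by rewrite eA inE; case/norP: hv.
by rewrite inE negbK.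
Qed.

(** The first broom is the star of a vertex of large degree, with an empty [H] before [star_broom]
    is applied; such a vertex exists by [moore] unless there is a long induced path. *)
Lemma large_prime n m : exists N, forall (T : finType) (e : rel T),
  simple_graph e -> prime_graph e -> N <= #|T| -> path_or_cliques e n m.
Proof.
have [N1 h1] := broom_wins n m m; have [N2 h2] := star_broom N1.
exists ((N2.+1 ^ m).+1 + 4) => T e sg pr cT.
have cE : connd e (mem [set: T]) by apply: prime_connected => //; apply: leq_trans cT; apply: leq_addl.
have [/existsP[t it]|nt] := boolP [exists t : m.+1.-tuple T, ipath e t].
  by right; exists e, t; rewrite size_tuple; split=> //; apply: lequiv_refl.
have [/existsP[d hd]|nd] := boolP [exists d, N2 < #|[set w in [set: T] | e d w]|]; last first.
  have : #|[set: T]| <= N2.+1 ^ m.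
    apply: (moore cE) => [v _|p ip _]; first by rewrite leqNgt; apply: contra nd => h; apply/existsP; exists v.
    rewrite leqNgt; apply: contra nt => sp; apply/existsP.
    have st : size (take m.+1 p) == m.+1 by rewrite size_takel.
    exists (Tuple st) => /=; apply: (@ipath_catl _ _ _ (drop m.+1 p)); by rewrite cat_take_drop.
  rewrite cardsT leqNgt; case/negP; apply: leq_trans cT; exact: leq_addr.
have [||||e' [c' [H' [Fs [le br sF _]]]]] := h2 T e d [::] (enum [set w in [set: T] | e d w]) sg => //.
- by move=> x; rewrite mem_enum !inE.
- exact: enum_uniq.
- by rewrite -cardE ltnW.
apply: (poc_lequiv le); apply: (h1 _ _ _ _ _ _ _ br _ sF); first exact: lequiv_sg le sg.
  exact: prime_lequiv le sg pr.
exact: leq_addl.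
Qed.

Theorem theorem7p1 :
  forall n : nat, exists N : nat,
    forall (T : finType) (e : rel T),
      symmetric e -> irreflexive e -> prime_graph e -> N <= #|T| ->
      vertex_minor (cycle_graph n) e \/ vertex_minor (matched_cliques n) e.
Proof.
(* Cycles with at most three vertices are found inside a triangle, so the rest may assume
   [2 < k]. *)
move=> n; have [k [k3 hk]] : exists k, 2 < k /\ forall (T : finType) (e : rel T),
    vertex_minor (cycle_graph k) e -> vertex_minor (cycle_graph n) e.
  have [n3|n3] := leqP n 3; last by exists n; split=> //; apply: ltnW.
  by exists 3; split=> // T e; apply: cycle_graph3.
have [L hL] := path_cycle k3; have [N hN] := large_prime n L.
exists N => T e es ei pr cT; have sg : simple_graph e by split.
have [vm|[e' [p [le ip sp]]]] := hN T e sg pr cT; first by right.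
left; apply: hk; apply: (vm_lequiv le); apply: hL ip sp; first exact: lequiv_sg le sg.
exact: prime_lequiv le sg pr.
Qed.
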